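(* Let $G$ be a compact Lie group, let $Y=\langle\nabla_G,\alpha\rangle$ (with $\alpha\in\mathbb{R}^n$, $n=\dim G$) be a left-invariant real vector field on $G$, and let $\delta\ge1$. If there exists $c>0$ such that $$\|\nabla_G f\|_{L^2(G)}^{\delta-1}\,\|Yf\|_{L^2(G)}\ \ge\ c\,\|f\|_{L^2(G)}^{\delta}$$ for every $f\in H^1(G)$ with mean value zero, then $G$ is a torus.
   Context: $G$ is connected, with normalized Haar measure; ''mean value zero'' means $\int_Gf(x)\,dx=0$. $\mathcal{L}_G$ is the positive Laplace–Beltrami operator of a fixed bi-invariant Riemannian metric on $G$, and $X_1,\dots,X_n$ is a basis of real left-invariant vector fields with $\mathcal L_G=-(X_1^2+\dots+X_n^2)$; $\nabla_Gf=(X_1f,\dots,X_nf)$, $\|\nabla_G f\|_{L^2}^2=\sum_j\|X_jf\|_{L^2}^2$, and $\langle\nabla_G,\alpha\rangle=\sum_j\alpha_jX_j$. $H^1(G)$ is the usual $L^2$-based Sobolev space of order 1. For $\delta=1$ the factor $\|\nabla_G f\|^{\delta-1}$ is read as $1$. *)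

(* Defs.v *)
From HB Require Import structures.
From mathcomp Require Import all_boot all_order all_algebra.
From mathcomp Require Import all_classical all_reals all_analysis.
From mathcomp Require Import complex.

Set Implicit Arguments.
Unset Strict Implicit.
Unset Printing Implicit Defensive.

Import Order.TTheory GRing.Theory Num.Theory.
Import numFieldNormedType.Exports.

Local Open Scope classical_set_scope.
Local Open Scope ring_scope.

(* Only meant for open A and a finite-dimensional U: there, continuity of all
   the maps x |-> 'D_v f x is continuity of the differential. *)
Fixpoint Ck_on (R : realType) (U V : normedModType R) (k : nat) (A : set U)
    (f : U -> V) : Prop :=
  if k is k'.+1 then
    (forall x, A x -> differentiable f x) /\
    (forall v : U, Ck_on k' A (fun x => 'D_v f x))
  else forall x, A x -> {for x, continuous f}.

Definition smooth_on (R : realType) (U V : normedModType R) (A : set U)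
    (f : U -> V) : Prop :=
  forall k, Ck_on k A f.

(* The values of [chart_map] outside [chart_dom], and of [chart_inv] outside
   [chart_map @` chart_dom], are irrelevant. *)
Record chart (R : realType) (n : nat) (M : topologicalType) := Chart {
  chart_dom : set M;
  chart_map : M -> 'rV[R]_n;
  chart_inv : 'rV[R]_n -> M;
  chart_dom_open : open chart_dom;
  chart_img_open : open (chart_map @` chart_dom);
  chart_mapK : forall x, chart_dom x -> chart_inv (chart_map x) = x;
  chart_map_continuous :
    forall x, chart_dom x -> {for x, continuous chart_map};
  chart_inv_continuous :
    forall y, (chart_map @` chart_dom) y -> {for y, continuous chart_inv} }.

Definition chart_img (R : realType) (n : nat) (M : topologicalType)
    (c : chart R n M) : set 'rV[R]_n :=
  chart_map c @` chart_dom c.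

(* The atlas is not required to be maximal. The preferred charts [chart_at x]
   serve to identify the tangent space at x with 'rV[R]_n: a tangent vector at
   x is given by its components in the chart [chart_at x]. *)
HB.mixin Record isSmoothManifold (R : realType) (n : nat) M
    of Topological M := {
  atlas : set (chart R n M);
  chart_at : M -> chart R n M;
  chart_at_atlas : forall x, atlas (chart_at x);
  chart_at_dom : forall x, chart_dom (chart_at x) x;
  atlas_compatible : forall c d, atlas c -> atlas d ->
    smooth_on (chart_map c @` (chart_dom c `&` chart_dom d))
              (chart_map d \o chart_inv c);
  manifold_hausdorff : hausdorff_space M;
  manifold_second_countable : @second_countable M }.

#[short(type="smoothManifoldType")]
HB.structure Definition SmoothManifold (R : realType) (n : nat) :=
  {M of Topological M & isSmoothManifold R n M}.

(* Smooth maps from an open subset A of a normed space to a manifold. *)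
Definition smooth_into (R : realType) (n : nat) (M : smoothManifoldType R n)
    (U : normedModType R) (A : set U) (p : U -> M) : Prop :=
  (forall x, A x -> {for x, continuous p}) /\
  (forall d, @atlas R n M d ->
     smooth_on (A `&` p @^-1` chart_dom d) (chart_map d \o p)).

(* The multiplication is smooth on the product manifold, whose charts are the
   products of two charts. The distinguished point of a pointed type plays no
   role; measurable types are required to have one. *)
HB.mixin Record SmoothManifold_isLieGroup (R : realType) (n : nat) G
    of SmoothManifold R n G & Group G := {
  smooth_mul : forall c1 c2, @atlas R n G c1 -> @atlas R n G c2 ->
    smooth_into (chart_img c1 `*` chart_img c2)
      (fun z : 'rV[R]_n * 'rV[R]_n =>
         (chart_inv c1 z.1 * chart_inv c2 z.2)%g : G);
  smooth_inv : forall c, @atlas R n G c ->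
    smooth_into (chart_img c) (fun y => (chart_inv c y)^-1%g : G) }.

#[short(type="lieGroupType")]
HB.structure Definition LieGroup (R : realType) (n : nat) :=
  {G of Pointed G & Group G & SmoothManifold R n G &
        SmoothManifold_isLieGroup R n G}.

Section Manifold.
Variables (R : realType) (n : nat) (M : smoothManifoldType R n).

Definition smooth_fun (f : M -> R) : Prop :=
  forall c, @atlas R n M c -> smooth_on (chart_img c) (f \o chart_inv c).

Definition tangent_map (f : M -> M) (x : M) (v : 'rV[R]_n) : 'rV[R]_n :=
  'D_v (chart_map (chart_at (f x)) \o f \o chart_inv (chart_at x))
       (chart_map (chart_at x) x).

Definition vector_field := M -> 'rV[R]_n.

Definition vf_apply (X : vector_field) (f : M -> R) : M -> R := fun x =>
  'D_(X x) (f \o chart_inv (chart_at x)) (chart_map (chart_at x) x).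

(* Gram matrix, in the coordinate frame of the chart c at the point of
   coordinates y, of the field of bilinear forms h (given by their matrices in
   the frames of the preferred charts). *)
Definition coord_gram (h : M -> 'M[R]_n) (c : chart R n M) (y : 'rV[R]_n) :
    'M[R]_n :=
  let x := chart_inv c y in
  let J := jacobian (chart_map (chart_at x) \o chart_inv c) y in
  J *m h x *m J^T.

Record riemannian_metric := RiemannianMetric {
  gram :> M -> 'M[R]_n;
  gram_sym : forall x, (gram x)^T = gram x;
  gram_posdef : forall x (v : 'rV[R]_n),
    v != 0 -> 0 < (v *m gram x *m v^T) 0 0;
  gram_smooth : forall c, @atlas R n M c ->
    smooth_on (chart_img c) (coord_gram gram c) }.

Definition metric_ip (h : riemannian_metric) (x : M) (u v : 'rV[R]_n) : R :=
  (u *m h x *m v^T) 0 0.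

(* L f = - |h|^(-1/2) \sum_i \partial_i (|h|^(1/2) \sum_j h^ij \partial_j f),
   computed in the preferred chart at each point. *)
Definition laplace_beltrami (h : riemannian_metric) (f : M -> R) : M -> R :=
  fun x =>
    let c := chart_at x in
    let d (i : 'I_n) (u : 'rV[R]_n -> R) : 'rV[R]_n -> R :=
      fun y => 'D_(delta_mx 0 i) u y in
    let vol y := Num.sqrt (\det (coord_gram h c y)) in
    let flux i y :=
      vol y * \sum_j invmx (coord_gram h c y) i j * d j (f \o chart_inv c) y in
    let y0 := chart_map c x in
    - ((vol y0)^-1 * \sum_i d i (flux i) y0).

End Manifold.

Notation borel G := (g_sigma_algebraType (@open G)).

Section LieGroup.
Variables (R : realType) (n : nat) (G : lieGroupType R n).

Definition lmul (a : G) : G -> G := fun x => (a * x)%g.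
Definition rmul (a : G) : G -> G := fun x => (x * a)%g.

Definition left_invariant_vf (X : vector_field G) : Prop :=
  forall a x, tangent_map (lmul a) x (X x) = X (a * x)%g.

Definition vf_comb (X : 'I_n -> vector_field G) (alpha : 'rV[R]_n) :
    vector_field G :=
  fun x => \sum_j alpha 0 j *: X j x.

Definition left_invariant_basis (X : 'I_n -> vector_field G) : Prop :=
  (forall j, left_invariant_vf (X j)) /\
  (forall Z, left_invariant_vf Z -> exists! a : 'rV[R]_n, Z = vf_comb X a).

Definition bi_invariant_metric (h : riemannian_metric G) : Prop :=
  forall a x (u v : 'rV[R]_n),
    metric_ip h (a * x)%g (tangent_map (lmul a) x u) (tangent_map (lmul a) x v)
      = metric_ip h x u v /\
    metric_ip h (x * a)%g (tangent_map (rmul a) x u) (tangent_map (rmul a) x v)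
      = metric_ip h x u v.

(* p induces an isomorphism of Lie groups from R^k / Z^k onto G: it is a smooth
   surjective homomorphism with kernel Z^k, and its differentials are
   invertible, so that the inverse of the induced bijection is smooth too. *)
Definition is_torus : Prop :=
  exists (k : nat) (p : 'rV[R]_k -> G),
    [/\ smooth_into [set: 'rV[R]_k] p,
        forall u v, p (u + v) = (p u * p v)%g,
        forall x, exists u, p u = x,
        forall u, p u = 1%g <-> (forall i, u 0 i \is a Num.int) &
        forall u, bijective
          (fun v : 'rV[R]_k => 'D_v (chart_map (chart_at (p u)) \o p) u)].

Definition left_invariant_measure (mu : set (borel G) -> \bar R) : Prop :=
  forall (a : G) (A : set (borel G)), measurable A -> mu (lmul a @^-1` A) = mu A.

Variable mu : probability (borel G) R.

Definition in_L2 (f : G -> R[i]) : Prop :=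
  ((fun x : borel G => complex.Re (f x)) \in Lfun mu 2%:E) /\
  ((fun x : borel G => complex.Im (f x)) \in Lfun mu 2%:E).

Definition L2norm (f : G -> R[i]) : R :=
  Num.sqrt (\int[mu]_x (complex.Re (f x) ^+ 2 + complex.Im (f x) ^+ 2)).

Definition cintegral (f : G -> R[i]) : R[i] :=
  Complex (\int[mu]_x complex.Re (f x)) (\int[mu]_x complex.Im (f x)).

(* Left-invariant fields are divergence free for the Haar measure of a compact
   group, hence no zeroth-order term. *)
Definition weak_derivative (X : vector_field G) (f g : G -> R[i]) : Prop :=
  forall phi : G -> R, smooth_fun phi ->
    cintegral (fun x => f x * (vf_apply X phi x)%:C%C) =
    - cintegral (fun x => g x * (phi x)%:C%C).

(* f is in H^1, and Df, determined almost everywhere by f, is its gradient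
   (X_1 f, ..., X_n f). *)
Definition H1_gradient (X : 'I_n -> vector_field G) (f : G -> R[i])
    (Df : 'I_n -> G -> R[i]) : Prop :=
  in_L2 f /\ forall j, in_L2 (Df j) /\ weak_derivative (X j) f (Df j).

Definition gradient_norm (Df : 'I_n -> G -> R[i]) : R :=
  Num.sqrt (\sum_j L2norm (Df j) ^+ 2).

Definition directional (alpha : 'rV[R]_n) (Df : 'I_n -> G -> R[i]) :
    G -> R[i] :=
  fun x => \sum_j (alpha 0 j)%:C%C * Df j x.

End LieGroup.

(* Main.v *)
(* Tested on real smooth functions f of mean value zero with Yf = 0, the
   inequality says that Yf = 0 forces f to be constant. The coordinates of
   a |-> Ad(a)Y are killed by Y because [Y, Y] = 0, hence they are constant and
   Y is central; then [Y, v] = 0 for every v, so the coordinates of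
   a |-> Ad(a)v are killed by Y as well, and Ad is trivial: G, being connected,
   is commutative. In the chart at 1 the product of a commutative G is u + v up
   to an error O(|u||v|), so that u |-> lim (u / 2^k)^(2^k) is a homomorphism
   from the Lie algebra onto G, with discrete and cocompact kernel, that is,
   a lattice. *)
From HB Require Import structures.
Require Import Defs.
From mathcomp Require Import all_boot all_order all_algebra.
From mathcomp Require Import all_classical all_reals all_analysis.
From mathcomp Require Import complex ring lra finmap measurable_realfun.

Set Implicit Arguments.
Unset Strict Implicit.
Unset Printing Implicit Defensive.

Import Order.TTheory GRing.Theory Num.Theory.
Import numFieldNormedType.Exports.

Local Open Scope classical_set_scope.
Local Open Scope ring_scope.

(** * Continuously differentiable maps *)

(** No flow of a vector field is integrated. A left-invariant field acts through [left_derive], a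
    derivative in the chart at 1, and the bracket is read off the commutator map. The commutator,
    like the difference between the product and the sum of coordinates, is trivial as soon as one of
    its two arguments is. Hence the recurring study of functions of two variables that vanish on
    both axes: two uses of the mean value theorem give the symmetry of their mixed second
    derivative, from which the bracket is antisymmetric, and the bound O(|u||v|), on which every
    estimate for the exponential rests. The test functions are coordinates of a |-> Ad(a)v, hence
    globally smooth, and no cut-off is needed. Turning Yf = 0 into constancy uses that
    left-invariant fields integrate to 0, which requires right invariance of the measure; this is
    deduced from left invariance by Fubini. The exponential is first only known to be a homomorphism
    with a quadratic error at 0. Its smoothness follows formally, because differentiating f o E
    amounts to applying a left-invariant field to f. *)

Lemma scale_is_bilinear (R : realType) (V : normedModType R) :
  bilinear_for
    (GRing.Scale.Law.clone _ _ *:%R _) (GRing.Scale.Law.clone _ _ *:%R _)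
    (@GRing.scale R V).
Proof.
split=> [u'|u] a x y /=.
  by rewrite scalerDl scalerA.
by rewrite scalerDr !scalerA mulrC.
Qed.

HB.instance Definition _ (R : realType) (V : normedModType R) :=
  bilinear_isBilinear.Build R R V V _ _ (@GRing.scale R V)
    (scale_is_bilinear V).

Section Differentials.
Context {R : realType}.
Implicit Types U V W : normedModType R.

(** An explicit estimate yields both the existence and the value of the differential; the
    exponential is treated at 0 in this form. *)
Lemma differentiable_near V W (f : V -> W) (df : {linear V -> W}) x :
    continuous df ->
    (forall e, 0 < e ->
       \forall h \near 0, `|f (h + x) - f x - df h| <= e * `|h|) ->
  differentiable f x /\ 'd f x = df :> (V -> W).
Proof.
move=> dfc fe.
have E : f \o shift x = cst (f x) + df +o_ 0 id.
  apply/eqaddoP => e e0; move: (fe e e0); apply: filterS => h.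
  by rewrite /= opprD addrA.
have D := diff_unique dfc E.
by split => //; apply/diff_locallyP; rewrite D.
Qed.

Lemma differentiable_le V W (f : V -> W) x : differentiable f x ->
  forall e, 0 < e ->
    \forall h \near 0, `|f (h + x) - f x - 'd f x h| <= e * `|h|.
Proof.
move=> /diff_locally/eqaddoP H e e0; move: (H e e0); apply: filterS => h.
by rewrite /= opprD addrA.
Qed.

Lemma near_eq_differentiable V W (f g : V -> W) x :
  (\near x, f x = g x) -> differentiable f x -> differentiable g x.
Proof.
move=> fg df; suff [] : differentiable g x /\ 'd g x = 'd f x :> (V -> W) by [].
apply: differentiable_near; first exact: diff_continuous.
move=> e e0; have := differentiable_le df e0.
have H0 : \forall h \near (0 : V), f (h + x) = g (h + x).
  by move: fg; rewrite (near_shift 0 x); apply: filterS => h /=; rewrite subr0.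
have fx : f x = g x := nbhs_singleton fg.
by apply: filterS2 H0 => h <-; rewrite fx.
Qed.

Lemma differentiable_scale U V (a : U -> R) (f : U -> V) x :
  differentiable a x -> differentiable f x ->
  differentiable (fun y => a y *: f y) x.
Proof.
move=> da df.
have := @differentiable_bilin R R V V (@GRing.scale R V) (a x, f x).
have -> : (fun y => a y *: f y) =
  (fun p : R * V => p.1 *: p.2) \o (fun y => (a y, f y)) by [].
move=> H; apply: differentiable_comp; first exact: differentiable_pair.
by apply: H => p; exact: scale_continuous.
Qed.

Lemma derive_scale U V (a : U -> R) (f : U -> V) x v :
  differentiable a x -> differentiable f x ->
  'D_v (fun y => a y *: f y) x = 'D_v a x *: f x + a x *: 'D_v f x.
Proof.
move=> da df; rewrite deriveE; last exact: differentiable_scale.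
have -> : (fun y => a y *: f y) =
  (fun p : R * V => p.1 *: p.2) \o (fun y => (a y, f y)) by [].
have C : continuous (fun p : R * V => p.1 *: p.2).
  by move=> p; exact: scale_continuous.
have := @diff_bilin R R V V (@GRing.scale R V) (a x, f x) C.
have := @differentiable_bilin R R V V (@GRing.scale R V) (a x, f x) C.
move=> D E; rewrite diff_comp//; last exact: differentiable_pair.
by rewrite /= E diff_pair //= !deriveE// addrC.
Qed.

Lemma derive_comp U V W (f : U -> V) (g : V -> W) x v :
  differentiable f x -> differentiable g (f x) ->
  'D_v (g \o f) x = 'D_('D_v f x) g (f x).
Proof.
move=> df dg.
by rewrite (deriveE _ (differentiable_comp df dg)) diff_comp//= deriveE// deriveE.
Qed.

Lemma derive_pair U V W (f : U -> V) (g : U -> W) x v :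
  differentiable f x -> differentiable g x ->
  'D_v (fun y => (f y, g y)) x = ('D_v f x, 'D_v g x).
Proof.
move=> df dg; rewrite (deriveE _ (differentiable_pair df dg)) diff_pair//=.
by rewrite (deriveE _ df) (deriveE _ dg).
Qed.

Lemma derive_linear V W (l : {linear V -> W}) x v : continuous l -> 'D_v l x = l v.
Proof.
by move=> lc; rewrite deriveE ?diff_lin//; exact: linear_differentiable.
Qed.

Lemma derivevD V W (f : V -> W) x u v : differentiable f x ->
  'D_(u + v) f x = 'D_u f x + 'D_v f x.
Proof. by move=> df; do !rewrite (deriveE _ df); rewrite linearD. Qed.

Lemma derivevZ V W (f : V -> W) x a v : differentiable f x ->
  'D_(a *: v) f x = a *: 'D_v f x.
Proof. by move=> df; do !rewrite (deriveE _ df); rewrite linearZ. Qed.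

Lemma derivev_sum V W (f : V -> W) x I (r : seq I) (F : I -> V) : differentiable f x ->
  'D_(\sum_(i <- r) F i) f x = \sum_(i <- r) 'D_(F i) f x.
Proof.
move=> df; rewrite deriveE// linear_sum; apply: eq_bigr => i _.
by rewrite deriveE.
Qed.

End Differentials.

(** * Stability of C^k maps under sums, products and composition *)

Section ContinuousDifferentiability.
Context {R : realType}.
Implicit Types U V W : normedModType R.

Lemma Ck_on_subset U V k (A B : set U) (f : U -> V) :
  B `<=` A -> Ck_on k A f -> Ck_on k B f.
Proof.
move=> BA; elim: k f => [|k IH] f /=; first by move=> h x /BA/h.
by move=> [h1 h2]; split=> [x /BA/h1|v]//; exact: IH.
Qed.

(** In [Ck_on] the set only restricts the points at which total functions are tested; derivatives
    are never taken relative to [A]. So the condition splits over singletons, and local smoothness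
    can be glued. *)
Lemma Ck_on_pointwise U V k (A : set U) (f : U -> V) :
  (forall x, A x -> Ck_on k [set x] f) -> Ck_on k A f.
Proof.
elim: k f => [|k IH] f /= h; first by move=> x /h; exact.
by split=> [x /h [+ _]|v]; [exact|apply: IH => x /h [_]; exact].
Qed.

Lemma Ck_on_eq U V k (A : set U) (f g : U -> V) : open A ->
  (forall x, A x -> f x = g x) -> Ck_on k A f -> Ck_on k A g.
Proof.
move=> oA; elim: k f g => [|k IH] f g fg /=.
  move=> h x Ax; have nA : nbhs x A by exact: open_nbhs_nbhs.
  rewrite /prop_for /continuous_at -(fg _ Ax).
  have := h _ Ax; rewrite /prop_for /continuous_at.
  apply: cvg_trans; apply: near_eq_cvg.
  by apply: filterS nA => y /fg.
have N x : A x -> \near x, f x = g x.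
  by move=> Ax; apply: filterS (open_nbhs_nbhs (conj oA Ax)) => y /fg.
move=> [h1 h2]; split=> [x Ax|v].
  by apply: (near_eq_differentiable (N _ Ax)); exact: h1.
by apply: IH (h2 v) => x Ax; apply: near_eq_derive; exact: N.
Qed.

Lemma Ck_onS U V k (A : set U) (f : U -> V) : Ck_on k.+1 A f -> Ck_on k A f.
Proof.
elim: k f => [|k IH] f [h1 h2].
  by move=> x Ax; apply: differentiable_continuous; exact: h1.
by split => // v; apply: IH; exact: h2.
Qed.

Lemma Ck_on_cst U V k (A : set U) (c : V) : Ck_on k A (fun=> c).
Proof.
elim: k c => [|k IH] c; first by move=> x _; exact: cst_continuous.
split=> [x _|v]; first exact: differentiable_cst.
have -> : (fun x => 'D_v (fun=> c) x) = (fun=> 0 : V); last exact: IH.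
by apply/funext => x; exact: derive_cst.
Qed.

Lemma Ck_on_linear U V k (A : set U) (l : {linear U -> V}) :
  continuous l -> Ck_on k A l.
Proof.
move=> lc; case: k => [|k]; first by move=> x _; exact: lc.
split=> [x _|v]; first exact: linear_differentiable.
have -> : (fun x => 'D_v l x) = (fun=> l v); last exact: Ck_on_cst.
by apply/funext => x; exact: derive_linear.
Qed.

Lemma Ck_on_linear_comp U V W k (A : set U) (l : {linear V -> W}) (f : U -> V) :
  open A -> continuous l -> Ck_on k A f -> Ck_on k A (l \o f).
Proof.
move=> oA lc; elim: k f => [|k IH] f.
  by move=> h x Ax; apply: continuous_comp; [exact: h|exact: lc].
move=> [h1 h2]; split=> [x Ax|v].
  by apply: differentiable_comp; [exact: h1|exact: linear_differentiable].
apply: (@Ck_on_eq _ _ _ _ (l \o (fun x => 'D_v f x))) => //; last exact: IH (h2 v).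
move=> x Ax /=; rewrite derive_comp; [|exact: h1|exact: linear_differentiable].
by rewrite derive_linear.
Qed.

Lemma Ck_onD U V k (A : set U) (f g : U -> V) : open A ->
  Ck_on k A f -> Ck_on k A g -> Ck_on k A (fun x => f x + g x).
Proof.
move=> oA; elim: k f g => [|k IH] f g.
  by move=> h1 h2 x Ax; apply: continuousD; [exact: h1|exact: h2].
move=> [f1 f2] [g1 g2]; split=> [x Ax|v].
  by apply: differentiableD; [exact: f1|exact: g1].
apply: (@Ck_on_eq _ _ _ _ (fun x => 'D_v f x + 'D_v g x)) => //; last exact: IH (f2 v) (g2 v).
move=> x Ax; rewrite -[RHS]/('D_v (f + g) x) deriveD//; apply: diff_derivable.
  exact: f1.
exact: g1.
Qed.

Lemma Ck_on_sum U V k (A : set U) I (r : seq I) (F : I -> U -> V) : open A ->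
  (forall i, Ck_on k A (F i)) -> Ck_on k A (fun x => \sum_(i <- r) F i x).
Proof.
move=> oA h; elim: r => [|i r IH].
  by under eq_fun do rewrite big_nil; exact: Ck_on_cst.
by under eq_fun do rewrite big_cons; exact: Ck_onD.
Qed.

Lemma Ck_on_scale U V k (A : set U) (a : U -> R) (f : U -> V) : open A ->
  Ck_on k A a -> Ck_on k A f -> Ck_on k A (fun x => a x *: f x).
Proof.
move=> oA; elim: k a f => [|k IH] a f.
  by move=> h1 h2 x Ax; apply: continuousZ; [exact: h1|exact: h2].
move=> af ff; have [a1 a2] := af; have [f1 f2] := ff; split=> [x Ax|v].
  by apply: differentiable_scale; [exact: a1|exact: f1].
apply: (@Ck_on_eq _ _ _ _ (fun x => 'D_v a x *: f x + a x *: 'D_v f x)) => //.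
  move=> x Ax; rewrite derive_scale//; [exact: a1|exact: f1].
apply: Ck_onD => //; apply: IH.
- exact: a2.
- exact: Ck_onS ff.
- exact: Ck_onS af.
- exact: f2.
Qed.

(* V is finite-dimensional. *)
Definition framed V := exists m (e : 'I_m -> V) (l : 'I_m -> {linear V -> R}),
  (forall i, continuous (l i)) /\ forall v, v = \sum_i l i v *: e i.

(** The chain rule differentiates [g] in the direction ['D_v f x], which varies with [x], while
    [Ck_on] speaks of fixed directions. Expanding this direction in a frame gives a sum of products
    to which the induction applies. *)
Lemma Ck_on_comp U V W k (A : set U) (B : set V) (f : U -> V) (g : V -> W) :
  framed V -> open A -> (forall x, A x -> B (f x)) ->
  Ck_on k A f -> Ck_on k B g -> Ck_on k A (g \o f).
Proof.
move=> [m [e [l [lc le]]]] oA AB; elim: k g => [|k IH] g.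
  by move=> hf hg x Ax; apply: continuous_comp; [exact: hf|exact/hg/AB].
move=> ff gg; have [f1 f2] := ff; have [g1 g2] := gg; split=> [x Ax|v].
  by apply: differentiable_comp; [exact: f1|exact/g1/AB].
apply: (@Ck_on_eq _ _ _ _ (fun x => \sum_i (l i \o 'D_v f) x *: ('D_(e i) g \o f) x)) => //.
  move=> x Ax; rewrite derive_comp; [|exact: f1|exact/g1/AB].
  rewrite [in RHS](le ('D_v f x)) derivev_sum; last exact/g1/AB.
  by apply: eq_bigr => i _; rewrite derivevZ//; exact/g1/AB.
apply: Ck_on_sum => // i; apply: Ck_on_scale => //.
  by apply: Ck_on_linear_comp => //; exact: f2.
by apply: IH; [exact: Ck_onS|exact: g2].
Qed.

End ContinuousDifferentiability.

(** * Germs of smooth maps between normed spaces *)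

Section Germs.
Context {R : realType}.
Implicit Types U V W : normedModType R.

Definition linear_pack U V (f : U -> V) (fl : linear f) : {linear U -> V} :=
  HB.pack f (GRing.isLinear.Build R U V _ f fl).

Lemma derive_linear_comp U V W (l : V -> W) (f : U -> V) x v :
  linear l -> continuous l -> differentiable f x ->
  'D_v (fun y => l (f y)) x = l ('D_v f x).
Proof.
move=> ll lc df; have dl := @linear_differentiable _ _ _ (linear_pack ll) (f x) lc.
by rewrite [LHS](derive_comp v df dl) [LHS](@derive_linear _ _ _ (linear_pack ll) _ _ lc).
Qed.

Lemma derive_coord U m n (f : U -> 'M[R]_(m, n)) i j x v : differentiable f x ->
  'D_v (fun y => f y i j) x = 'D_v f x i j.
Proof.
move=> df; apply: (@derive_linear_comp _ _ _ (fun M : 'M[R]_(m, n) => M i j)) => //.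
  by move=> a u w; rewrite !mxE.
exact: coord_continuous.
Qed.

Lemma framed_R : framed R.
Proof.
have il : linear (id : R -> R) by [].
exists 1, (fun=> 1), (fun=> linear_pack il); split=> [i x|v]; first exact: cvg_id.
by rewrite big_ord1 /=; rewrite [_ *: _]mulr1.
Qed.

Lemma framed_rV n : framed 'rV[R]_n.
Proof.
have l (i : 'I_n) : linear (fun v : 'rV[R]_n => v 0 i).
  by move=> a u v; rewrite !mxE.
exists n, (fun i => delta_mx 0 i), (fun i => linear_pack (l i)); split.
  by move=> i; exact: coord_continuous.
by move=> v; rewrite [LHS]row_sum_delta.
Qed.

Lemma framed_prod U V : framed U -> framed V -> framed (U * V)%type.
Proof.
move=> [m [e [l [lc le]]]] [p [e' [l' [lc' le']]]].
have hl (i : 'I_m) : linear (fun z : U * V => l i z.1).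
  by move=> a u v /=; rewrite linearP.
have hl' (i : 'I_p) : linear (fun z : U * V => l' i z.2).
  by move=> a u v /=; rewrite linearP.
exists (m + p)%N, (fun i => match fintype.split i with inl j => (e j, 0) | inr j => (0, e' j) end),
  (fun i => match fintype.split i with
            | inl j => linear_pack (hl j)
            | inr j => linear_pack (hl' j)
            end).
split=> [i|[u v]].
  case: (fintype.split i) => j z; apply: continuous_comp;
    [exact: cvg_fst|exact: lc|exact: cvg_snd|exact: lc'].
rewrite big_split_ord /=; rewrite [X in X + _](_ : _ = (u, 0)).
  rewrite [X in _ + X](_ : _ = (0, v)); first by congr (_, _); rewrite ?addr0 ?add0r.
  transitivity (\sum_(i < p) ((0, l' i v *: e' i) : U * V)).
    by apply: eq_bigr => i _; rewrite (unsplitK (inr i)); congr (_, _); rewrite scaler0.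
  by rewrite [in RHS](le' v);
    elim/big_ind2 : _ => // [x1 x2 y1 y2 -> ->]; congr (_, _); rewrite addr0.
transitivity (\sum_(i < m) ((l i u *: e i, 0) : U * V)).
  by apply: eq_bigr => i _; rewrite (unsplitK (inl i)); congr (_, _); rewrite scaler0.
by rewrite [in RHS](le u);
  elim/big_ind2 : _ => // [x1 x2 y1 y2 -> ->]; congr (_, _); rewrite addr0.
Qed.

(** The open set is existential, so that sums, products and composites need no bookkeeping of
    domains. *)
Definition smooth_near U V (f : U -> V) (x : U) :=
  exists A, [/\ open A, A x & smooth_on A f].

Lemma smooth_on_near U V (A : set U) (f : U -> V) x :
  open A -> A x -> smooth_on A f -> smooth_near f x.
Proof. by exists A. Qed.

Lemma near_smooth_on U V (A : set U) (f : U -> V) :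
  (forall x, A x -> smooth_near f x) -> smooth_on A f.
Proof.
move=> h k; apply: Ck_on_pointwise => x /h [B [_ Bx /(_ k)]].
by apply: Ck_on_subset => _ ->.
Qed.

Lemma smooth_near_near U V (f : U -> V) x :
  smooth_near f x -> \near x, smooth_near f x.
Proof.
move=> [A [oA Ax h]]; apply: filterS (open_nbhs_nbhs (conj oA Ax)) => y Ay.
by exists A.
Qed.

Lemma smooth_near_eq U V (f g : U -> V) x : (\near x, f x = g x) ->
  smooth_near f x -> smooth_near g x.
Proof.
rewrite /prop_near1 nbhsE => -[B [oB Bx] fg] [A [oA Ax h]].
exists (A `&` B); split; [exact: openI|by []|] => k.
apply: (@Ck_on_eq _ _ _ _ _ f); [exact: openI|by move=> y [_ /fg]|].
by apply: Ck_on_subset (h k) => y [].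
Qed.

Lemma smooth_near_differentiable U V (f : U -> V) x :
  smooth_near f x -> differentiable f x.
Proof. by move=> [A [oA Ax /(_ 1%N) [h _]]]; exact: h. Qed.

Lemma smooth_near_continuous U V (f : U -> V) x :
  smooth_near f x -> {for x, continuous f}.
Proof. by move=> /smooth_near_differentiable/differentiable_continuous. Qed.

Lemma smooth_near_derive U V (f : U -> V) v x :
  smooth_near f x -> smooth_near ('D_v f) x.
Proof. by move=> [A [oA Ax h]]; exists A; split=> // k; have [_ hv] := h k.+1; exact: hv. Qed.

Lemma smooth_near_cst U V (c : V) (x : U) : smooth_near (fun=> c) x.
Proof. by exists setT; split=> //; [exact: openT|move=> k; exact: Ck_on_cst]. Qed.

Lemma smooth_near_linear U V (f : U -> V) x :
  linear f -> continuous f -> smooth_near f x.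
Proof.
move=> fl fc; exists setT; split=> //; first exact: openT.
by move=> k; exact: (@Ck_on_linear _ _ _ _ _ (linear_pack fl)).
Qed.

Lemma smooth_near_id U (x : U) : smooth_near id x.
Proof. by apply: smooth_near_linear => // y; exact: cvg_id. Qed.

Lemma smooth_near_fst U V (x : U * V) : smooth_near fst x.
Proof. by apply: smooth_near_linear => // y; exact: cvg_fst. Qed.

Lemma smooth_near_snd U V (x : U * V) : smooth_near snd x.
Proof. by apply: smooth_near_linear => // y; exact: cvg_snd. Qed.

Lemma smooth_nearD U V (f g : U -> V) x : smooth_near f x -> smooth_near g x ->
  smooth_near (fun y => f y + g y) x.
Proof.
move=> [A [oA Ax hA]] [B [oB Bx hB]]; exists (A `&` B).
split=> // [|k]; first exact: openI.
apply: Ck_onD; first exact: openI.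
  by apply: Ck_on_subset (hA k) => y [].
by apply: Ck_on_subset (hB k) => y [].
Qed.

Lemma smooth_near_scale U V (a : U -> R) (f : U -> V) x :
  smooth_near a x -> smooth_near f x -> smooth_near (fun y => a y *: f y) x.
Proof.
move=> [A [oA Ax hA]] [B [oB Bx hB]]; exists (A `&` B).
split=> // [|k]; first exact: openI.
apply: Ck_on_scale; first exact: openI.
  by apply: Ck_on_subset (hA k) => y [].
by apply: Ck_on_subset (hB k) => y [].
Qed.

Lemma smooth_near_sum U V I (r : seq I) (F : I -> U -> V) x :
  (forall i, smooth_near (F i) x) ->
  smooth_near (fun y => \sum_(i <- r) F i y) x.
Proof.
move=> h; elim: r => [|i r IH].
  by under eq_fun do rewrite big_nil; exact: smooth_near_cst.
by under eq_fun do rewrite big_cons; exact: smooth_nearD.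
Qed.

Lemma smooth_near_comp U V W (f : U -> V) (g : V -> W) x : framed V ->
  smooth_near f x -> smooth_near g (f x) -> smooth_near (g \o f) x.
Proof.
move=> fV sf [B [oB Bx hB]]; have cf := smooth_near_continuous sf.
have : nbhs x (f @^-1` B) by apply: cf; exact: open_nbhs_nbhs.
rewrite nbhsE => -[C [oC Cx] CB]; have [A [oA Ax hA]] := sf.
have oAC := openI oA oC.
exists (A `&` C); split=> // k; apply: (@Ck_on_comp _ _ _ _ _ _ B) => //.
  by move=> y [_ /CB].
by apply: Ck_on_subset (hA k) => y [].
Qed.

Lemma smooth_near_pair U V W (f : U -> V) (g : U -> W) x :
  framed V -> framed W ->
  smooth_near f x -> smooth_near g x -> smooth_near (fun y => (f y, g y)) x.
Proof.
move=> fV fW sf sg.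
have -> : (fun y => (f y, g y)) =
    fun y => ((fun v : V => (v, 0 : W)) \o f) y + ((fun w : W => (0 : V, w)) \o g) y.
  by apply/funext => y /=; congr (_, _); rewrite ?addr0 ?add0r.
apply: smooth_nearD; apply: smooth_near_comp => //; apply: smooth_near_linear.
- by move=> a u v; congr (_, _); rewrite /= scaler0 addr0.
- by move=> y; apply: cvg_pair; (exact: cvg_id || exact: cvg_cst).
- by move=> a u v; congr (_, _); rewrite /= scaler0 addr0.
- by move=> y; apply: cvg_pair; (exact: cvg_id || exact: cvg_cst).
Qed.

Lemma smooth_near_coord U n (f : U -> 'rV[R]_n) i x :
  smooth_near f x -> smooth_near (fun y => f y 0 i) x.
Proof.
move=> sf; apply: (@smooth_near_comp _ _ _ f (fun v : 'rV[R]_n => v 0 i)) => //.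
  exact: framed_rV.
apply: smooth_near_linear; last exact: coord_continuous.
by move=> a u v; rewrite !mxE.
Qed.

Lemma derive_partial U V W (F : U * V -> W) u w v :
  differentiable F (u, w) ->
  'D_v (fun y => F (u, y)) w = 'D_(0, v) F (u, w).
Proof.
move=> dF; have dw := smooth_near_differentiable (smooth_near_id w).
have dc : differentiable (fun=> u : U) w by exact: differentiable_cst.
have dp : differentiable (fun y : V => (u, y)) w := differentiable_pair dc dw.
rewrite [LHS](derive_comp v dp dF); congr ('D_ _ F _).
by rewrite (derive_pair v dc dw) derive_cst derive_id.
Qed.

(** Both [left_derive v f] and [Ad v] are derivatives at a fixed point of maps depending smoothly on
    a parameter; their smoothness comes from here. *)
Lemma smooth_near_partial U V W (F : U * V -> W) u w v :
  framed U -> framed V -> smooth_near F (u, w) ->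
  smooth_near (fun z => 'D_v (fun y => F (z, y)) w) u.
Proof.
move=> fU fV sF.
apply: (@smooth_near_eq _ _ ('D_(0, v) F \o (fun z : U => (z, w)))).
  have cp : {for u, continuous (fun z : U => (z, w))}.
    by apply: cvg_pair; (exact: cvg_id || exact: cvg_cst).
  have H : \forall z \near u, smooth_near F (z, w) := cp _ (smooth_near_near sF).
  apply: filterS H => z /= /smooth_near_differentiable dF.
  by rewrite derive_partial.
apply: smooth_near_comp; first exact: framed_prod.
  by apply: (@smooth_near_pair _ _ _ id (fun=> w)) => //;
    [exact: smooth_near_id|exact: smooth_near_cst].
exact: smooth_near_derive.
Qed.

End Germs.

(** * Manifolds and Lie groups *)

(** Makes a local statement global, typically a bound whose constant depends on the point: take a
    finite subcover. *)
Lemma compact_induction (T : ptopologicalType) (P : set T -> Prop) :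
  compact [set: T] -> P set0 -> (forall A B, P A -> P B -> P (A `|` B)) ->
  (forall A B, A `<=` B -> P B -> P A) ->
  (forall x : T, exists2 U, nbhs x U & P U) -> P setT.
Proof.
move=> cT P0 PU PS loc.
have /choice[U PUx] : forall x : T, exists U, [/\ open U, U x & P U].
  move=> x; have [V] := loc x; rewrite nbhsE => -[U [oU Ux] UV] PV.
  by exists U; split=> //; exact: PS PV.
move: cT; rewrite compact_cover => /(_ T setT U)[x _|x _|D _ cov].
- by have [] := PUx x.
- by exists x => //; have [] := PUx x.
apply: (PS _ (\big[setU/set0]_(i <- D) U i)).
  by rewrite -bigcup_fset.
by elim/big_ind : _ => // i _; have [] := PUx i.
Qed.

(** * Smooth maps into and out of a manifold *)

Section ManifoldGerms.
Context {R : realType} {n : nat} {M : smoothManifoldType R n}.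
Implicit Types (U V : normedModType R) (c d : chart R n M).

Lemma chart_imgP c x : chart_dom c x -> chart_img c (chart_map c x).
Proof. by move=> cx; exists x. Qed.

Lemma chart_img_nbhs c x :
  chart_dom c x -> nbhs (chart_map c x) (chart_img c).
Proof.
by move=> cx; apply: open_nbhs_nbhs; split; [exact: chart_img_open|exists x].
Qed.

Lemma chart_dom_nbhs c x : chart_dom c x -> nbhs x (chart_dom c).
Proof. by move=> cx; apply: open_nbhs_nbhs; split=> //; exact: chart_dom_open. Qed.

Lemma chart_inv_dom c y : chart_img c y -> chart_dom c (chart_inv c y).
Proof. by move=> [x cx <-]; rewrite chart_mapK. Qed.

Lemma chart_invK c y : chart_img c y -> chart_map c (chart_inv c y) = y.
Proof. by move=> [x cx <-]; rewrite chart_mapK. Qed.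

Definition smooth_into_near U (p : U -> M) (u : U) :=
  {for u, continuous p} /\
  forall d, @atlas R n M d -> chart_dom d (p u) -> smooth_near (chart_map d \o p) u.

Lemma smooth_into_intoP U (A : set U) (p : U -> M) : open A ->
  smooth_into A p <-> (forall u, A u -> smooth_into_near p u).
Proof.
move=> oA; split=> [[cp sp] u Au|h].
  split=> [|d ad du]; first exact: cp.
  have N : nbhs u (A `&` p @^-1` chart_dom d).
    apply: filterI; first exact: open_nbhs_nbhs.
    by apply: cp => //; exact: chart_dom_nbhs.
  move: N; rewrite nbhsE => -[B [oB Bu] BA].
  by exists B; split=> // k; apply: Ck_on_subset BA _; exact: sp.
split=> [u /h[]//|d ad]; apply: near_smooth_on => u [Au du].
by have [_] := h _ Au; exact.
Qed.

Lemma smooth_into_near_eq U (p q : U -> M) u : (\near u, p u = q u) ->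
  smooth_into_near p u -> smooth_into_near q u.
Proof.
move=> pq [cp sp]; have pu := nbhs_singleton pq; split.
  rewrite /prop_for /continuous_at -pu.
  by apply: cvg_trans cp; apply: near_eq_cvg; apply: filterS pq.
move=> d ad; rewrite -pu => /(sp _ ad); apply: smooth_near_eq.
by apply: filterS pq => z /= ->.
Qed.

Lemma smooth_into_near_comp U V (q : U -> V) (p : V -> M) u : framed V ->
  smooth_near q u -> smooth_into_near p (q u) -> smooth_into_near (p \o q) u.
Proof.
move=> fV sq [cp sp]; split.
  by apply: continuous_comp cp; exact: smooth_near_continuous.
by move=> d ad du; exact: (smooth_near_comp fV sq (sp _ ad du)).
Qed.

Lemma smooth_into_near_chart_inv c y : @atlas R n M c -> chart_img c y ->
  smooth_into_near (chart_inv c) y.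
Proof.
move=> ac cy; split=> [|d ad dy]; first exact: chart_inv_continuous.
apply: (@smooth_on_near _ _ _ (chart_map c @` (chart_dom c `&` chart_dom d)));
  last exact: atlas_compatible.
  (* The overlap of the two charts is open in the coordinates of [c], because [chart_inv c] is
     continuous. *)
  rewrite openE => z /= -[x [cx dx] <-].
  have cz := chart_imgP cx.
  have : nbhs (chart_map c x) (chart_img c `&` chart_inv c @^-1` chart_dom d).
    apply: filterI; first exact: chart_img_nbhs.
    by apply: (chart_inv_continuous cz); rewrite chart_mapK//; exact: chart_dom_nbhs.
  apply: filterS => w [[v cv <-]] /=; rewrite chart_mapK// => dv.
  by exists v.
by exists (chart_inv c y); [split=> //; exact: chart_inv_dom|exact: chart_invK].
Qed.

Lemma smooth_into_near_cst U (x : M) (u : U) : smooth_into_near (fun=> x) u.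
Proof.
split=> [|d ad dx]; first exact: cst_continuous.
exact: smooth_near_cst.
Qed.

(** Read in the preferred chart only; [smooth_at_comp] and [smooth_into_near_smooth_at] provide the
    independence of the chart. *)
Definition smooth_at V (f : M -> V) (x : M) :=
  smooth_near (f \o chart_inv (chart_at x)) (chart_map (chart_at x) x).

Lemma smooth_at_comp U V (p : U -> M) (f : M -> V) u :
  smooth_into_near p u -> smooth_at f (p u) -> smooth_near (f \o p) u.
Proof.
move=> [cp sp] sf; have cu := chart_at_dom (p u).
have := smooth_near_comp (framed_rV n) (sp _ (chart_at_atlas (p u)) cu) sf.
apply: smooth_near_eq.
have : \forall z \near u, chart_dom (chart_at (p u)) (p z).
  by apply: cp; exact: chart_dom_nbhs.
by apply: filterS => z /= dz; rewrite chart_mapK.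
Qed.

Lemma smooth_at_chart_map c x : @atlas R n M c -> chart_dom c x ->
  smooth_at (chart_map c) x.
Proof.
move=> ac cx; have xx := chart_at_dom x.
have [_] := smooth_into_near_chart_inv (chart_at_atlas x) (chart_imgP xx).
by apply=> //; rewrite chart_mapK.
Qed.

Lemma smooth_into_near_smooth_at V (f : M -> V) c x : @atlas R n M c ->
  chart_dom c x -> smooth_near (f \o chart_inv c) (chart_map c x) ->
  smooth_at f x.
Proof.
move=> ac cx sf; have xx := chart_at_dom x.
have si := smooth_into_near_chart_inv (chart_at_atlas x) (chart_imgP xx).
have [ci sci] := si.
have := sci _ ac; rewrite chart_mapK// => /(_ cx) s2.
have := @smooth_near_comp _ _ _ _ _ _ _ (framed_rV n) s2; rewrite /= chart_mapK//.
move=> /(_ _ _ sf); apply: smooth_near_eq.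
have : \forall z \near chart_map (chart_at x) x, chart_dom c (chart_inv (chart_at x) z).
  by apply: ci; rewrite chart_mapK//; exact: chart_dom_nbhs.
by apply: filterS => z /= cz; rewrite chart_mapK.
Qed.

Lemma smooth_funP (f : M -> R) : smooth_fun f <-> forall x, smooth_at f x.
Proof.
split=> [sf x|h c ac].
  apply: (@smooth_on_near _ _ _ (chart_img (chart_at x))).
    exact: chart_img_open.
  exact/chart_imgP/chart_at_dom.
  exact/sf/chart_at_atlas.
apply: near_smooth_on => y cy; apply: smooth_at_comp (h _).
exact: smooth_into_near_chart_inv.
Qed.

Lemma smooth_at_continuous V (f : M -> V) x : smooth_at f x -> {for x, continuous f}.
Proof.
move=> /smooth_near_continuous cf; have xx := chart_at_dom x.
have N := chart_dom_nbhs xx.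
have : {for x, continuous ((f \o chart_inv (chart_at x)) \o chart_map (chart_at x))}.
  by apply: continuous_comp cf; exact: chart_map_continuous.
rewrite /prop_for /continuous_at /= chart_mapK//; apply: cvg_trans.
by apply: near_eq_cvg; apply: filterS N => z cz /=; rewrite chart_mapK.
Qed.

Lemma smooth_at_cst V (a : V) x : smooth_at (fun=> a) x.
Proof. exact: smooth_near_cst. Qed.

Lemma smooth_atD V (f g : M -> V) x : smooth_at f x -> smooth_at g x ->
  smooth_at (fun y => f y + g y) x.
Proof. exact: smooth_nearD. Qed.

Lemma smooth_at_scale V (a : M -> R) (f : M -> V) x :
  smooth_at a x -> smooth_at f x -> smooth_at (fun y => a y *: f y) x.
Proof. exact: smooth_near_scale. Qed.

End ManifoldGerms.

(** * Smoothness and continuity of the group operations *)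

Section LieGroupGerms.
Context {R : realType} {n : nat} {G : lieGroupType R n}.
Implicit Types (U V : normedModType R).

Lemma smooth_into_near_mul U (p q : U -> G) u :
  smooth_into_near p u -> smooth_into_near q u ->
  smooth_into_near (fun z => (p z * q z)%g) u.
Proof.
move=> sp sq; have [cp hp] := sp; have [cq hq] := sq.
set c := chart_at (p u); set d := chart_at (q u).
have cu : chart_dom c (p u) := chart_at_dom _.
have du : chart_dom d (q u) := chart_at_dom _.
have ac : @atlas R n G c := chart_at_atlas _.
have ad : @atlas R n G d := chart_at_atlas _.
have oI : open (chart_img c `*` chart_img d).
  rewrite openE => z [z1 z2]; exists (chart_img c, chart_img d) => //.
  by split; apply: open_nbhs_nbhs; split=> //; exact: chart_img_open.
have /(smooth_into_intoP _ oI) h := smooth_mul _ _ ac ad.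
have sr : smooth_near (fun z => (chart_map c (p z), chart_map d (q z))) u.
  by apply: smooth_near_pair; [exact: framed_rV|exact: framed_rV|exact: hp|exact: hq].
have hu : (chart_img c `*` chart_img d) (chart_map c (p u), chart_map d (q u)).
  by split; exact: chart_imgP.
have := smooth_into_near_comp (framed_prod (framed_rV n) (framed_rV n)) sr (h _ hu).
apply: smooth_into_near_eq.
have N1 : \forall z \near u, chart_dom c (p z) by apply: cp; exact: chart_dom_nbhs.
have N2 : \forall z \near u, chart_dom d (q z) by apply: cq; exact: chart_dom_nbhs.
by apply: filterS2 N1 N2 => z /= h1 h2; rewrite !chart_mapK.
Qed.

Lemma smooth_into_near_inv U (p : U -> G) u :
  smooth_into_near p u -> smooth_into_near (fun z => (p z)^-1%g) u.
Proof.
move=> sp; have [cp hp] := sp.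
set c := chart_at (p u).
have cu : chart_dom c (p u) := chart_at_dom _.
have ac : @atlas R n G c := chart_at_atlas _.
have /(smooth_into_intoP _ (@chart_img_open _ _ _ c)) h := smooth_inv _ ac.
have := smooth_into_near_comp (framed_rV n) (hp _ ac cu) (h _ (chart_imgP cu)).
apply: smooth_into_near_eq.
have N1 : \forall z \near u, chart_dom c (p z) by apply: cp; exact: chart_dom_nbhs.
by apply: filterS N1 => z /= h1; rewrite chart_mapK.
Qed.

(** Continuity for the topology of [G] is recovered from the continuity part of [smooth_mul] by
    composing with the two charts. *)
Lemma mul_continuous : continuous (fun z : G * G => (z.1 * z.2)%g).
Proof.
move=> [x y].
set c := chart_at x; set d := chart_at y.
have cx : chart_dom c x := chart_at_dom _.
have dy : chart_dom d y := chart_at_dom _.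
have ac : @atlas R n G c := chart_at_atlas _.
have ad : @atlas R n G d := chart_at_atlas _.
have [h _] := smooth_mul _ _ ac ad.
have hxy : (chart_img c `*` chart_img d) (chart_map c x, chart_map d y).
  by split; exact: chart_imgP.
have {}h := h _ hxy.
have c1 : {for (x, y), continuous (fun z : G * G => chart_map c z.1)}.
  by apply: (@continuous_comp _ _ _ fst (chart_map c));
    [exact: cvg_fst|exact: chart_map_continuous].
have c2 : {for (x, y), continuous (fun z : G * G => chart_map d z.2)}.
  by apply: (@continuous_comp _ _ _ snd (chart_map d));
    [exact: cvg_snd|exact: chart_map_continuous].
have : {for (x, y), continuous (fun z : G * G => (chart_map c z.1, chart_map d z.2))}.
  exact: (cvg_pair c1 c2).
move=> /continuous_comp/(_ h).
rewrite /prop_for /continuous_at /= !chart_mapK//; apply: cvg_trans.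
apply: near_eq_cvg; exists (chart_dom c, chart_dom d) => /=.
  by split; exact: chart_dom_nbhs.
by move=> [a b] [/= ca db]; rewrite !chart_mapK.
Qed.

Lemma inv_continuous : continuous (fun x : G => x^-1%g).
Proof.
move=> x; set c := chart_at x.
have cx : chart_dom c x := chart_at_dom _.
have ac : @atlas R n G c := chart_at_atlas _.
have [h _] := smooth_inv _ ac.
have {}h := h _ (chart_imgP cx).
have : {for x, continuous (chart_map c)} by exact: chart_map_continuous.
move=> /continuous_comp/(_ h).
rewrite /prop_for /continuous_at /= !chart_mapK//; apply: cvg_trans.
apply: near_eq_cvg; apply: filterS (chart_dom_nbhs cx) => a ca /=.
by rewrite chart_mapK.
Qed.

Lemma continuous_mul (T : topologicalType) (f g : T -> G) x :
  {for x, continuous f} -> {for x, continuous g} ->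
  {for x, continuous (fun y => (f y * g y)%g)}.
Proof.
move=> cf cg; apply: (@continuous_comp _ _ _ (fun y => (f y, g y))
  (fun z : G * G => (z.1 * z.2)%g)); last exact: mul_continuous.
exact: (cvg_pair cf cg).
Qed.

Lemma continuous_inv (T : topologicalType) (f : T -> G) x :
  {for x, continuous f} -> {for x, continuous (fun y => (f y)^-1%g)}.
Proof. by move=> cf; apply: continuous_comp cf _; exact: inv_continuous. Qed.

Lemma lmul_continuous (a : G) : continuous (lmul a).
Proof. by move=> x; apply: continuous_mul; [exact: cst_continuous|exact: cvg_id]. Qed.

Lemma rmul_continuous (a : G) : continuous (rmul a).
Proof. by move=> x; apply: continuous_mul; [exact: cvg_id|exact: cst_continuous]. Qed.

(** Such a subgroup is open, and so is its complement, which is a union of cosets. *)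
Lemma connected_subgroup (H : set G) : connected [set: G] ->
  nbhs 1%g H -> (forall x y, H x -> H y -> H (x * y)%g) ->
  (forall x, H x -> H x^-1%g) -> forall x, H x.
Proof.
move=> Gc H1 HM HV.
have cosets x (P : set G) : (forall h, H h -> P (x * h)%g) -> nbhs x P.
  move=> HP; have : nbhs x (lmul x^-1%g @^-1` H).
    by apply: lmul_continuous; rewrite /lmul mulVg.
  apply: filterS => y /= Hy; have := HP _ Hy.
  by rewrite /lmul mulgA mulgV mul1g.
have -> : H = [set: G]; last by [].
apply: Gc; first by exists 1%g; exact: nbhs_singleton.
  exists H; last by rewrite setTI.
  by rewrite openE => x Hx; apply: cosets => h; exact: HM.
exists H; last by rewrite setTI.
rewrite -openC openE => x nHx; apply: cosets => h Hh Hxh; apply: nHx.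
by have := HM _ _ Hxh (HV _ Hh); rewrite -mulgA mulgV mulg1.
Qed.

End LieGroupGerms.

(** * Symmetry of second derivatives *)

Section MeanValue.
Context {R : realType}.
Implicit Types U V : normedModType R.

Lemma is_derive_line U (F : U -> R) (p w : U) t : differentiable F (p + t *: w) ->
  is_derive t 1 (fun s : R => F (p + s *: w)) ('D_w F (p + t *: w)).
Proof.
move=> dF.
have sl : smooth_near (fun s : R => p + s *: w) t.
  apply: smooth_nearD; first exact: smooth_near_cst.
  by apply: smooth_near_scale; [exact: smooth_near_id|exact: smooth_near_cst].
have dl := smooth_near_differentiable sl.
have dw : 'D_1 (fun s : R => p + s *: w) t = w.
  rewrite deriveD; last 2 first.
  - exact: derivable_cst.
  - apply: diff_derivable; apply: smooth_near_differentiable.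
    by apply: smooth_near_scale; [exact: smooth_near_id|exact: smooth_near_cst].
  rewrite derive_cst add0r derive_scale; last 2 first.
  - exact: smooth_near_differentiable (smooth_near_id t).
  - exact: differentiable_cst.
  by rewrite derive_cst scaler0 addr0 derive_id scale1r.
apply: DeriveDef.
  by apply: diff_derivable; exact: (@differentiable_comp _ _ _ _ (fun s : R => p + s *: w) F).
by have := derive_comp (1 : R) dl dF; rewrite dw.
Qed.

Lemma mvt_line U (F : U -> R) (p w : U) :
  (forall t : R, 0 <= t <= 1 -> differentiable F (p + t *: w)) ->
  exists2 t, 0 < t < 1 & F (p + w) - F p = 'D_w F (p + t *: w).
Proof.
move=> dF.
have [||c c01 E] := @MVT R (fun s => F (p + s *: w)) (fun s => 'D_w F (p + s *: w)) 0 1 ltr01.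
- move=> t; rewrite in_itv /= => /andP[t0 t1]; apply: is_derive_line; apply: dF.
  by rewrite !ltW.
- apply: derivable_within_continuous => t; rewrite in_itv /= => t01.
  have : is_derive t 1 (fun s : R => F (p + s *: w)) ('D_w F (p + t *: w)).
    by apply: is_derive_line; exact: dF.
  by move=> [].
exists c; first by move: c01; rewrite in_itv.
by move: E; rewrite scale1r scale0r addr0 subr0 mulr1.
Qed.

(** The mean value theorem is applied along [v], starting from the axis where [F] is 0, and then
    along [u] to the derivative ['D_(0, v) F], starting from the other axis, where this derivative
    is 0. *)
Lemma mvt_axes U V (F : U * V -> R) a b u v :
  (forall s t : R, 0 <= s <= 1 -> 0 <= t <= 1 -> smooth_near F (a + s *: u, b + t *: v)) ->
  (forall s : R, 0 <= s <= 1 -> F (a + s *: u, b) = 0) ->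
  (forall t : R, 0 <= t <= 1 -> F (a, b + t *: v) = 0) ->
  exists s t, [/\ 0 <= s <= 1, 0 <= t <= 1 &
    F (a + u, b + v) = 'D_(u, 0) ('D_(0, v) F) (a + s *: u, b + t *: v)].
Proof.
move=> sF F1 F2.
have I01 : 0 <= (1 : R) <= 1 by rewrite ler01 lexx.
have I00 : 0 <= (0 : R) <= 1 by rewrite ler01 lexx.
have Pv p q (r : R) : (p, q) + r *: (0, v) = (p, q + r *: v) :> U * V.
  by congr (_, _); rewrite /= scaler0 addr0.
have Pu p q (r : R) : (p, q) + r *: (u, 0) = (p + r *: u, q) :> U * V.
  by congr (_, _); rewrite /= scaler0 addr0.
have [|t t01 E1] := @mvt_line _ F (a + u, b) (0, v).
  move=> t t01; rewrite Pv; apply: smooth_near_differentiable.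
  by have := sF 1 t I01 t01; rewrite scale1r.
have t01' : 0 <= t <= 1 by case/andP: t01 => *; rewrite !ltW.
have [|s s01 E2] := @mvt_line _ ('D_(0, v) F) (a, b + t *: v) (u, 0).
  move=> s s01; rewrite Pu; apply: smooth_near_differentiable.
  by apply: smooth_near_derive; exact: sF.
have s01' : 0 <= s <= 1 by case/andP: s01 => *; rewrite !ltW.
exists s, t; split; [exact: s01'|exact: t01'|].
have E3 : 'D_(0, v) F (a, b + t *: v) = 0.
  have sF0 : smooth_near F (a, b + t *: v).
    by have := sF 0 t I00 t01'; rewrite scale0r addr0.
  have dF0 : differentiable F ((a, b) + t *: (0, v) : U * V).
    by rewrite Pv; exact: smooth_near_differentiable.
  have [_ ] := is_derive_line dF0; rewrite Pv => <-.
  (* [F] is known to vanish only on a segment of the axis, so it matters that [t] is strictly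
     between 0 and 1. *)
  rewrite (@near_eq_derive _ _ _ _ (fun=> 0)); first exact: derive_cst.
  have N : \forall r \near t, r \in `]0, 1[ by apply: near_in_itvoo; rewrite in_itv.
  apply: filterS N => r; rewrite in_itv /= => /andP[r0 r1].
  by rewrite Pv F2// !ltW.
have Pv1 p q : (p, q) + (0, v) = (p, q + v) :> U * V by congr (_, _); rewrite /= addr0.
have Pu1 p q : (p, q) + (u, 0) = (p + u, q) :> U * V by congr (_, _); rewrite /= addr0.
move: E1; rewrite Pv1 Pv.
have := F1 1 I01; rewrite scale1r => ->; rewrite subr0 => ->.
by move: E2; rewrite E3 subr0 Pu1 Pu.
Qed.

End MeanValue.

(** * Mixed second derivatives of functions vanishing on two axes *)

Section Schwarz.
Context {R : realType}.
Implicit Types U V W : normedModType R.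

Lemma derive2Z U (F : U -> R) x u v (s t : R) : smooth_near F x ->
  'D_(s *: u) ('D_(t *: v) F) x = s * t * 'D_u ('D_v F) x.
Proof.
move=> sF; have sFv := smooth_near_differentiable (smooth_near_derive v sF).
rewrite (@near_eq_derive _ _ _ _ (t *: 'D_v F)); last first.
  apply: filterS (smooth_near_near sF) => y /smooth_near_differentiable dF.
  by rewrite derivevZ.
rewrite derivevZ; last exact: differentiableZ.
by rewrite deriveZ ?[LHS]mulrA//; exact: diff_derivable.
Qed.

Lemma near_box U V (a : U) (b : V) (N : set (U * V)) : nbhs (a, b) N ->
  exists2 r : R, 0 < r &
    forall u v, `|u| < r -> `|v| < r -> N (a + u, b + v).
Proof.
move=> /nbhs_ballP[r /= r0 rN]; exists r => // u v ur vr; apply: rN.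
by split; rewrite -ball_normE /= opprD addNKr normrN.
Qed.

Lemma near0_scale_lt U (u : U) (r : R) : 0 < r -> \forall s \near (0 : R), `|s *: u| < r.
Proof.
move=> r0.
have : (fun s : R => s *: u) @ 0 --> (0 : R) *: u.
  by apply: cvgZr_tmp; exact: cvg_id.
rewrite scale0r => /cvgr_dist_lt/(_ r r0); apply: filterS => s.
by rewrite sub0r normrN.
Qed.

Lemma segment_lt U (u : U) (r s : R) : 0 <= s <= 1 -> `|u| < r -> `|s *: u| < r.
Proof.
move=> /andP[s0 s1]; apply: le_lt_trans.
by rewrite normrZ ger0_norm// ler_piMl.
Qed.

(** The second difference of [F] at the corner (a, b) reduces to its value at the opposite corner,
    the three other terms being 0; [mvt_axes] and the continuity of the mixed derivative do the
    rest. *)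
Lemma second_difference U V (F : U * V -> R) a b u v : smooth_near F (a, b) ->
  (\forall w \near a, F (w, b) = 0) -> (\forall z \near b, F (a, z) = 0) ->
  forall e : R, 0 < e -> \forall s \near (0 : R),
    `|F (a + s *: u, b + s *: v) - s ^+ 2 * 'D_(u, 0) ('D_(0, v) F) (a, b)|
      <= e * s ^+ 2.
Proof.
move=> sF F1 F2 e e0; set D := 'D_(u, 0) ('D_(0, v) F).
have cD : {for (a, b), continuous D}.
  by apply: smooth_near_continuous; do 2!apply: smooth_near_derive.
have [r1 r10 H1] := near_box (smooth_near_near sF).
have cDe : \forall z \near (a, b), `|D (a, b) - D z| <= e.
  by move: cD => /cvgr_dist_le/(_ e e0).
have [r2 r20 H2] := near_box cDe.
have /nbhs_ballP[r3 /= r30 H3] := F1.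
have /nbhs_ballP[r4 /= r40 H4] := F2.
pose r := Num.min (Num.min r1 r2) (Num.min r3 r4).
have r0 : 0 < r by rewrite !lt_min r10 r20 r30 r40.
have [N1 N2] := (near0_scale_lt u r0, near0_scale_lt v r0).
apply: filterS2 N1 N2 => s; rewrite !lt_min.
move=> /andP[/andP[u1 u2] /andP[u3 u4]] /andP[/andP[v1 v2] /andP[v3 v4]].
have [|||p [q [p01 q01 ->]]] := @mvt_axes _ _ _ F a b (s *: u) (s *: v).
- by move=> p q p01 q01; apply: H1; exact: segment_lt.
- move=> p p01; apply: H3; rewrite -ball_normE /= opprD addNKr normrN.
  exact: segment_lt.
- move=> p p01; apply: H4; rewrite -ball_normE /= opprD addNKr normrN.
  exact: segment_lt.
rewrite (_ : (s *: u, 0) = s *: (u, 0)); last by congr (_, _); rewrite /= scaler0.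
rewrite (_ : (0, s *: v) = s *: (0, v)); last by congr (_, _); rewrite /= scaler0.
rewrite derive2Z; last by apply: H1; exact: segment_lt.
rewrite -expr2 -mulrBr normrM ger0_norm ?sqr_ge0// mulrC ler_wpM2r ?sqr_ge0//.
by rewrite distrC; apply: H2; exact: segment_lt.
Qed.

Lemma small_sqr_eq0 (b : R) :
  (forall e : R, 0 < e -> \forall s \near (0 : R), `|s ^+ 2 * b| <= e * s ^+ 2) ->
  b = 0.
Proof.
move=> h; apply/eqP; rewrite -normr_eq0 eq_le normr_ge0 andbT.
apply/ler_addgt0Pl => e e0; rewrite addr0.
have /nbhs_ballP[r /= r0 H] := h e e0.
have := H (r / 2); rewrite -ball_normE /= sub0r normrN gtr0_norm ?divr_gt0//.
rewrite ltr_pdivrMr// ltr_pMr// ltr1n => /(_ isT).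
by rewrite normrM ger0_norm ?sqr_ge0// mulrC ler_pM2r// exprn_gt0 ?divr_gt0.
Qed.

(** Both sides are the limit of the same quotient F(a + s v, a + s u) / s^2, expanded once for [F]
    and once for [F] with its variables exchanged. *)
Lemma axes_derive_swap U (F : U * U -> R) a u v : framed U -> smooth_near F (a, a) ->
  (\forall w \near a, F (w, a) = 0) -> (\forall z \near a, F (a, z) = 0) ->
  'D_(u, 0) ('D_(0, v) (fun z : U * U => F (z.2, z.1))) (a, a) =
  'D_(v, 0) ('D_(0, u) F) (a, a).
Proof.
move=> fU sF F1 F2; apply/eqP; rewrite -subr_eq0; apply/eqP.
apply: small_sqr_eq0 => e e0; have e20 : 0 < e / 2 by rewrite divr_gt0.
have H1 := second_difference v u sF F1 F2 e20.
have sF' : smooth_near (fun z : U * U => F (z.2, z.1)) (a, a).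
  apply: (@smooth_near_comp _ _ _ _ (fun z : U * U => (z.2, z.1)) F (a, a)) => //.
    exact: framed_prod.
  by apply: smooth_near_pair => //; [exact: smooth_near_snd|exact: smooth_near_fst].
have H2 := second_difference u v sF' F2 F1 e20.
apply: filterS2 H1 H2 => s /=.
move: (F _) ('D_(v, 0) _ _) ('D_(u, 0) _ _) => A Q P h1 h2.
have -> : s ^+ 2 * (P - Q) = (A - s ^+ 2 * Q) - (A - s ^+ 2 * P) by ring.
rewrite (le_trans (ler_normB _ _))//.
rewrite [leRHS](_ : _ = e / 2 * s ^+ 2 + e / 2 * s ^+ 2); first exact: lerD.
by rewrite -mulrDl -splitr.
Qed.

End Schwarz.

(** * Left-invariant derivatives *)

Section Translations.
Context {R : realType} {n : nat} {G : lieGroupType R n}.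
Implicit Types (U V : normedModType R).

Local Notation phi := (chart_at (1%g : G)).
Local Notation z0 := (chart_map phi (1%g : G)).
Local Notation inv1 := (chart_inv phi).

Lemma chart1_dom : chart_dom phi (1%g : G).
Proof. exact: chart_at_dom. Qed.

Lemma chart1_inv : inv1 z0 = 1%g.
Proof. by rewrite chart_mapK//; exact: chart1_dom. Qed.

Lemma chart1_atlas : @atlas R n G phi.
Proof. exact: chart_at_atlas. Qed.

Lemma smooth_into_near_inv1 : smooth_into_near (inv1 : _ -> G) z0.
Proof.
by apply: smooth_into_near_chart_inv; [exact: chart1_atlas|exact/chart_imgP/chart1_dom].
Qed.

Lemma smooth_into_near_trans (x : G) :
  smooth_into_near (fun z => (x * inv1 z)%g) z0.
Proof.
by apply: smooth_into_near_mul; [exact: smooth_into_near_cst|exact: smooth_into_near_inv1].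
Qed.

(* Derivative of f at x along the left-invariant field with value v at 1. *)
Definition left_derive V (v : 'rV[R]_n) (f : G -> V) (x : G) : V :=
  'D_v (fun z => f (x * inv1 z)%g) z0.

Lemma smooth_near_trans V (f : G -> V) x : smooth_at f x ->
  smooth_near (fun z => f (x * inv1 z)%g) z0.
Proof.
move=> sf; apply: (smooth_at_comp (smooth_into_near_trans x)).
by rewrite /= chart1_inv mulg1.
Qed.

Lemma smooth_at_left_derive V v (f : G -> V) x :
  smooth_at f x -> smooth_at (left_derive v f) x.
Proof.
move=> sf; have xx := chart_at_dom x.
apply: (@smooth_near_partial _ _ _ _
  (fun z => f (chart_inv (chart_at x) z.1 * inv1 z.2)%g)); [exact: framed_rV|exact: framed_rV|].
apply: (@smooth_at_comp _ _ _ _ _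
  (fun z : 'rV[R]_n * 'rV[R]_n => chart_inv (chart_at x) z.1 * inv1 z.2)%g).
  apply: smooth_into_near_mul.
    apply: (@smooth_into_near_comp _ _ _ _ _ fst); [exact: framed_rV|exact: smooth_near_fst|].
    by apply: smooth_into_near_chart_inv; [exact: chart_at_atlas|exact/chart_imgP].
  apply: (@smooth_into_near_comp _ _ _ _ _ snd); [exact: framed_rV|exact: smooth_near_snd|].
  exact: smooth_into_near_inv1.
by rewrite /= chart_mapK// chart1_inv mulg1.
Qed.

Lemma left_deriveM v (f g : G -> R) x : smooth_at f x -> smooth_at g x ->
  left_derive v (fun y => f y * g y) x =
  left_derive v f x * g x + f x * left_derive v g x.
Proof.
move=> /smooth_near_trans/smooth_near_differentiable df.
move=> /smooth_near_trans/smooth_near_differentiable dg.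
have := derive_scale v df dg; rewrite /= chart1_inv mulg1.
exact.
Qed.

Lemma left_deriveD V v (f g : G -> V) x : smooth_at f x -> smooth_at g x ->
  left_derive v (fun y => f y + g y) x = left_derive v f x + left_derive v g x.
Proof.
move=> /smooth_near_trans/smooth_near_differentiable/diff_derivable df.
move=> /smooth_near_trans/smooth_near_differentiable/diff_derivable dg.
exact: (deriveD (df v) (dg v)).
Qed.

Lemma left_derive_cst V v (a : V) x : left_derive v (fun=> a) x = 0.
Proof. exact: derive_cst. Qed.

Lemma left_derive_sum V (f : G -> V) x I (r : seq I) (F : I -> 'rV[R]_n) :
  smooth_at f x ->
  left_derive (\sum_(i <- r) F i) f x = \sum_(i <- r) left_derive (F i) f x.
Proof.
by move=> /smooth_near_trans/smooth_near_differentiable df; exact: derivev_sum.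
Qed.

Lemma left_deriveZ V (f : G -> V) x a v : smooth_at f x ->
  left_derive (a *: v) f x = a *: left_derive v f x.
Proof.
by move=> /smooth_near_trans/smooth_near_differentiable df; exact: derivevZ.
Qed.

Lemma left_derive_coord m v (f : G -> 'rV[R]_m) i x : smooth_at f x ->
  left_derive v (fun y => f y 0 i) x = left_derive v f x 0 i.
Proof.
move=> /smooth_near_trans/smooth_near_differentiable df.
exact: derive_coord.
Qed.

(** Near [x], f o [chart_inv c] factors through y |-> x^-1 y read in the chart at 1. Any coordinate
    derivative is thus a left-invariant one, in the transported direction. *)
Lemma chart_derive V (f : G -> V) c x u : @atlas R n G c -> chart_dom c x ->
  smooth_at f x ->
  'D_u (f \o chart_inv c) (chart_map c x) =
  left_derive ('D_u (fun y => chart_map phi (x^-1 * chart_inv c y)%g) (chart_map c x)) f x.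
Proof.
move=> ac cx sf; rewrite /left_derive.
set F := fun z => _; set q := fun y => _.
have sq : smooth_into_near (fun y => (x^-1 * chart_inv c y)%g) (chart_map c x).
  apply: smooth_into_near_mul; first exact: smooth_into_near_cst.
  by apply: smooth_into_near_chart_inv => //; exact: chart_imgP.
have qx : q (chart_map c x) = z0 by rewrite /q chart_mapK// mulVg.
have dq : differentiable q (chart_map c x).
  apply: smooth_near_differentiable.
  have [_] := sq; apply; first exact: chart1_atlas.
  by rewrite /= chart_mapK// mulVg; exact: chart1_dom.
have dF : differentiable F (q (chart_map c x)).
  by rewrite qx; apply: smooth_near_differentiable; exact: smooth_near_trans.
rewrite -qx -(derive_comp u dq dF); apply: near_eq_derive.
have : \forall y \near chart_map c x, chart_dom phi (x^-1 * chart_inv c y)%g.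
  have [cq _] := sq; apply: cq; rewrite chart_mapK// mulVg.
  exact/chart_dom_nbhs/chart1_dom.
apply: filterS => y dy; rewrite /F /q /= chart_mapK//.
by rewrite mulgA mulgV mul1g.
Qed.

(** Left invariance, for the translation by [x] at the point 1, says that [X x] is the image of
    [X 1] under the differential of that translation; then the chain rule applies. *)
Lemma vf_apply_left (X : vector_field G) (f : G -> R) x :
  left_invariant_vf X -> smooth_at f x ->
  vf_apply X f x = left_derive (X 1%g) f x.
Proof.
move=> XL sf; have xx := chart_at_dom x.
have := XL x 1%g; rewrite /tangent_map /lmul /= => XE.
have E : X x = 'D_(X 1%g) (fun z => chart_map (chart_at x) (x * inv1 z)%g) z0.
  by move: XE; rewrite mulg1 => <-; rewrite /comp.
have sd : smooth_near (fun z => chart_map (chart_at x) (x * inv1 z)%g) z0.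
  apply: smooth_near_trans; apply: smooth_at_chart_map => //.
  exact: chart_at_atlas.
have x1 : chart_map (chart_at x) (x * inv1 z0)%g = chart_map (chart_at x) x.
  by rewrite chart1_inv mulg1.
rewrite /vf_apply E -[in X in 'D_ _ _ X = _]x1.
have dd := smooth_near_differentiable sd.
have df : differentiable (f \o chart_inv (chart_at x)) (chart_map (chart_at x) (x * inv1 z0)%g).
  by rewrite x1; exact: smooth_near_differentiable.
have := derive_comp (X 1%g) dd df => <-; apply: near_eq_derive.
have : \forall z \near z0, chart_dom (chart_at x) (x * inv1 z)%g.
  have [cq _] := smooth_into_near_trans x; apply: cq; rewrite chart1_inv mulg1.
  exact: chart_dom_nbhs.
by apply: filterS => z dz /=; rewrite chart_mapK.
Qed.

Lemma near_chart1 (P : G -> Prop) :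
  (\forall z \near z0, P (inv1 z)) -> nbhs (1%g : G) P.
Proof.
move=> H; have c1 : {for (1%g : G), continuous (chart_map phi)}.
  exact/chart_map_continuous/chart1_dom.
have : \forall x \near (1%g : G), P (inv1 (chart_map phi x)) := c1 _ H.
apply: filterS2 (chart_dom_nbhs chart1_dom) => x dx.
by rewrite chart_mapK.
Qed.

(** The differential of the product at (1, 1) is the addition, since the product with 1 on either
    side is the identity. *)
Lemma derive_chart1_mul U (p q : U -> G) u v :
  smooth_into_near p u -> smooth_into_near q u -> p u = 1%g -> q u = 1%g ->
  'D_v (fun y => chart_map phi (p y * q y)%g) u =
  'D_v (chart_map phi \o p) u + 'D_v (chart_map phi \o q) u.
Proof.
move=> sp sq pu qu.
have d1 := chart1_dom; have a1 := chart1_atlas.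
pose m := fun z : 'rV[R]_n * 'rV[R]_n => chart_map phi (inv1 z.1 * inv1 z.2)%g.
have sm : smooth_near m (z0, z0).
  apply: (@smooth_at_comp _ _ _ _ _ (fun z : 'rV[R]_n * 'rV[R]_n => inv1 z.1 * inv1 z.2)%g).
    apply: smooth_into_near_mul.
      by apply: (@smooth_into_near_comp _ _ _ _ _ fst);

      [exact: framed_rV|exact: smooth_near_fst|exact: smooth_into_near_inv1].
    by apply: (@smooth_into_near_comp _ _ _ _ _ snd);

      [exact: framed_rV|exact: smooth_near_snd|exact: smooth_into_near_inv1].
  by rewrite /= chart1_inv mulg1; exact: smooth_at_chart_map.
have dm := smooth_near_differentiable sm.
have Np : \forall y \near u, chart_dom phi (p y).
  by have [cp _] := sp; apply: cp; rewrite pu; exact: chart_dom_nbhs.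
have Nq : \forall y \near u, chart_dom phi (q y).
  by have [cq _] := sq; apply: cq; rewrite qu; exact: chart_dom_nbhs.
have dp : differentiable (chart_map phi \o p) u.
  apply: smooth_near_differentiable; have [_] := sp; apply => //.
  by rewrite pu.
have dq : differentiable (chart_map phi \o q) u.
  apply: smooth_near_differentiable; have [_] := sq; apply => //.
  by rewrite qu.
pose pq y := ((chart_map phi \o p) y, (chart_map phi \o q) y).
have dpq : differentiable pq u by exact: differentiable_pair.
have pq0 : pq u = (z0, z0) by rewrite /pq /= pu qu.
have -> : 'D_v (fun y => chart_map phi (p y * q y)%g) u = 'D_v (m \o pq) u.
  apply: near_eq_derive; apply: filterS2 Np Nq => y py qy.
  by rewrite /m /= !chart_mapK.
have dm' : differentiable m (pq u) by rewrite pq0.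
rewrite (derive_comp v dpq dm') pq0 (derive_pair v dp dq).
set a := 'D_v _ u; set b := 'D_v _ u.
have -> : (a, b) = (a, 0) + (0, b) by congr (_, _); rewrite /= ?addr0 ?add0r.
rewrite (derivevD _ _ dm); congr (_ + _).
  have sw : smooth_near (fun z : 'rV[R]_n => (z, z0)) z0.
    by apply: (@smooth_near_pair _ _ _ _ id (fun=> z0));
      [exact: framed_rV|exact: framed_rV|exact: smooth_near_id|exact: smooth_near_cst].
  have E : 'D_a (fun z : 'rV[R]_n => (z, z0)) z0 = (a, 0).
    rewrite (derive_pair a (smooth_near_differentiable (smooth_near_id z0))
      (@differentiable_cst _ _ _ z0 z0)).
    by rewrite derive_id derive_cst.
  rewrite -E -(derive_comp a (smooth_near_differentiable sw) dm).
  rewrite (@near_eq_derive _ _ _ _ id) ?derive_id//.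
  apply: filterS (chart_img_nbhs d1) => z dz.
  by rewrite /m /= chart1_inv mulg1 chart_invK.
rewrite -(derive_partial _ dm).
rewrite (@near_eq_derive _ _ _ _ id) ?derive_id//.
apply: filterS (chart_img_nbhs d1) => z dz.
by rewrite /m /= chart1_inv mul1g chart_invK.
Qed.

Lemma derive_chart1_inv U (p : U -> G) u v :
  smooth_into_near p u -> p u = 1%g ->
  'D_v (fun y => chart_map phi (p y)^-1%g) u = - 'D_v (chart_map phi \o p) u.
Proof.
move=> sp pu.
have := derive_chart1_mul v sp (smooth_into_near_inv sp) pu.
rewrite pu invg1 => /(_ erefl).
under [X in 'D_v X u = _]eq_fun do rewrite mulgV.
rewrite derive_cst => /eqP; rewrite eq_sym addrC addr_eq0 => /eqP.
exact.
Qed.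

End Translations.

(** * The adjoint representation *)

Section Adjoint.
Context {R : realType} {n : nat} {G : lieGroupType R n}.
Implicit Types (U V : normedModType R) (v : 'rV[R]_n).

Local Notation phi := (chart_at (1%g : G)).
Local Notation z0 := (chart_map phi (1%g : G)).
Local Notation inv1 := (chart_inv phi).

Lemma smooth_into_near_conj (a : G) :
  smooth_into_near (fun z => (a * inv1 z * a^-1)%g) z0.
Proof.
apply: smooth_into_near_mul; last exact: smooth_into_near_cst.
exact: smooth_into_near_trans.
Qed.

Definition Ad v (a : G) : 'rV[R]_n :=
  'D_v (fun z => chart_map phi (a * inv1 z * a^-1)%g) z0.

Lemma conj_near1 (a : G) :
  smooth_near (fun z => chart_map phi (a * inv1 z * a^-1)%g) z0.
Proof.
have [_] := smooth_into_near_conj a; apply; first exact: chart1_atlas.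
by rewrite chart1_inv mulg1 mulgV; exact: chart1_dom.
Qed.

Lemma smooth_at_Ad v a : smooth_at (Ad v) a.
Proof.
have aa := chart_at_dom a.
pose p (z : 'rV[R]_n * 'rV[R]_n) : G :=
  (chart_inv (chart_at a) z.1 * inv1 z.2 * (chart_inv (chart_at a) z.1)^-1)%g.
have sp : smooth_into_near p (chart_map (chart_at a) a, z0).
  have s1 : smooth_into_near (fun z : 'rV[R]_n * 'rV[R]_n => chart_inv (chart_at a) z.1)
      (chart_map (chart_at a) a, z0).
    apply: (@smooth_into_near_comp _ _ _ _ _ fst); [exact: framed_rV|exact: smooth_near_fst|].
    by apply: smooth_into_near_chart_inv; [exact: chart_at_atlas|exact/chart_imgP].
  apply: smooth_into_near_mul; last exact: smooth_into_near_inv.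
  apply: smooth_into_near_mul; first exact: s1.
  apply: (@smooth_into_near_comp _ _ _ _ _ snd); [exact: framed_rV|exact: smooth_near_snd|].
  exact: smooth_into_near_inv1.
apply: (@smooth_near_partial _ _ _ _ (chart_map phi \o p)); [exact: framed_rV|exact: framed_rV|].
have [_] := sp; apply; first exact: chart1_atlas.
by rewrite /p /= chart_mapK// chart1_inv mulg1 mulgV; exact: chart1_dom.
Qed.

Lemma AdM v a b : Ad v (a * b)%g = Ad (Ad v b) a.
Proof.
rewrite /Ad.
have db := smooth_near_differentiable (conj_near1 b).
have b0 : chart_map phi (b * inv1 z0 * b^-1)%g = z0.
  by rewrite chart1_inv mulg1 mulgV.
have da : differentiable (fun z => chart_map phi (a * inv1 z * a^-1)%g)
    (chart_map phi (b * inv1 z0 * b^-1)%g).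
  by rewrite b0; exact: smooth_near_differentiable (conj_near1 a).
have := derive_comp v db da; rewrite b0 => <-; apply: near_eq_derive.
have : \forall z \near z0, chart_dom phi (b * inv1 z * b^-1)%g.
  have [cb _] := smooth_into_near_conj b; apply: cb.
  by rewrite chart1_inv mulg1 mulgV; exact/chart_dom_nbhs/chart1_dom.
by apply: filterS => z dz /=; rewrite chart_mapK// invgM !mulgA.
Qed.

Lemma AdD u v a : Ad (u + v) a = Ad u a + Ad v a.
Proof. exact: derivevD (smooth_near_differentiable (conj_near1 a)). Qed.

Lemma AdZ k v a : Ad (k *: v) a = k *: Ad v a.
Proof. exact: derivevZ (smooth_near_differentiable (conj_near1 a)). Qed.

Lemma Ad_continuous a : continuous (Ad^~ a).
Proof.
have da := smooth_near_differentiable (conj_near1 a).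
have -> : Ad^~ a = 'd (fun z => chart_map phi (a * inv1 z * a^-1)%g) z0 :> (_ -> _).
  by apply/funext => w; exact: deriveE.
exact: diff_continuous.
Qed.

(** By [AdM], Ad(az)v = Ad(a)Ad(z)v, and the continuous linear map Ad(a) commutes with the
    derivative in z. *)
Lemma left_derive_Ad u v a : left_derive u (Ad v) a = Ad (left_derive u (Ad v) 1%g) a.
Proof.
have ll : linear (Ad^~ a) by move=> k w w'; rewrite AdD AdZ.
have sv := smooth_near_differentiable (smooth_near_trans (smooth_at_Ad v 1%g)).
have E : 'D_u (fun y => Ad (Ad v (1 * inv1 y)%g) a) z0 =
    Ad ('D_u (fun y => Ad v (1 * inv1 y)%g) z0) a.
  exact: (derive_linear_comp u ll (@Ad_continuous a) sv).
have F : (fun z => Ad v (a * inv1 z)%g) = (fun y => Ad (Ad v (1 * inv1 y)%g) a).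
  apply/funext => z.
  rewrite mul1g.
  exact: AdM.
rewrite /left_derive.
rewrite F.
exact: E.
Qed.

Lemma Ad0 a : Ad 0 a = 0.
Proof. exact: derive0. Qed.

Lemma Ad1 v : Ad v 1%g = v.
Proof.
rewrite /Ad (@near_eq_derive _ _ _ _ id) ?derive_id//.
apply: filterS (chart_img_nbhs chart1_dom) => z dz.
by rewrite mul1g invg1 mulg1 chart_invK.
Qed.

(** The Lie bracket [u, v], as the derivative at 1 along [u] of a |-> Ad(a)v. *)
Definition bracket u v := left_derive u (Ad v) 1%g.

(** The commutator is the product of a z a^-1 and z^-1, both equal to 1 at z = 1, so that
    [derive_chart1_mul] adds the two derivatives. *)
Lemma derive_commutator (a : G) v :
  'D_v (fun z => chart_map phi (a * inv1 z * a^-1 * (inv1 z)^-1)%g) z0 = Ad v a - v.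
Proof.
rewrite derive_chart1_mul.
- congr (_ + _); rewrite derive_chart1_inv; last exact: chart1_inv.
    congr (- _); rewrite (@near_eq_derive _ _ _ _ id) ?derive_id//.
    by apply: filterS (chart_img_nbhs chart1_dom) => z dz /=; rewrite chart_invK.
  exact: smooth_into_near_inv1.
- exact: smooth_into_near_conj.
- by apply: smooth_into_near_inv; exact: smooth_into_near_inv1.
- by rewrite chart1_inv mulg1 mulgV.
- by rewrite chart1_inv invg1.
Qed.

(* The commutator of w and z is trivial when w = 1 or z = 1, and exchanging w
   and z inverts it: its mixed second derivative, which is the bracket, is
   therefore both swapped and negated. *)
Lemma bracketC u v : bracket u v = - bracket v u.
Proof.
pose k (z : 'rV[R]_n * 'rV[R]_n) : G :=
  (inv1 z.1 * inv1 z.2 * (inv1 z.1)^-1 * (inv1 z.2)^-1)%g.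
have fnn := framed_prod (framed_rV (R := R) n) (framed_rV n).
have sk : smooth_into_near k (z0, z0).
  have s1 : smooth_into_near (fun z : 'rV[R]_n * 'rV[R]_n => inv1 z.1 : G) (z0, z0).
    by apply: (@smooth_into_near_comp _ _ _ _ _ fst);
      [exact: framed_rV|exact: smooth_near_fst|exact: smooth_into_near_inv1].
  have s2 : smooth_into_near (fun z : 'rV[R]_n * 'rV[R]_n => inv1 z.2 : G) (z0, z0).
    by apply: (@smooth_into_near_comp _ _ _ _ _ snd);
      [exact: framed_rV|exact: smooth_near_snd|exact: smooth_into_near_inv1].
  apply: smooth_into_near_mul; last exact: smooth_into_near_inv.
  apply: smooth_into_near_mul; last exact: smooth_into_near_inv.
  exact: smooth_into_near_mul.
have k1 w : k (w, z0) = 1%g by rewrite /k /= chart1_inv invg1 !mulg1 mulgV.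
have k2 z : k (z0, z) = 1%g by rewrite /k /= chart1_inv invg1 mul1g mulg1 mulgV.
have k0 : k (z0, z0) = 1%g := k1 z0.
have kV w z : k (w, z) = (k (z, w))^-1%g by rewrite /k /= !invgM !invgK !mulgA.
(* Subtracting [z0] makes [F] vanish on both axes. *)
pose F z := chart_map phi (k z) - z0.
have sF : smooth_near F (z0, z0).
  apply: smooth_nearD; last exact: smooth_near_cst.
  have [_] := sk; apply; first exact: chart1_atlas.
  by rewrite k0; exact: chart1_dom.
have sFs : smooth_near (fun z => F (z.2, z.1)) (z0, z0).
  apply: (@smooth_near_comp _ _ _ _ (fun z : 'rV[R]_n * 'rV[R]_n => (z.2, z.1)) F (z0, z0)) => //.
  by apply: smooth_near_pair;
    [exact: framed_rV|exact: framed_rV|exact: smooth_near_snd|exact: smooth_near_fst].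
have sc (c : 'rV[R]_n) : smooth_near (fun z : 'rV[R]_n => (c, z)) z0.
  by apply: (@smooth_near_pair _ _ _ _ (fun=> c) id);
    [exact: framed_rV|exact: framed_rV|exact: smooth_near_cst|exact: smooth_near_id].
have sc' (c : 'rV[R]_n) : smooth_near (fun z : 'rV[R]_n => (z, c)) z0.
  by apply: (@smooth_near_pair _ _ _ _ id (fun=> c));
    [exact: framed_rV|exact: framed_rV|exact: smooth_near_id|exact: smooth_near_cst].
have cc' (c : 'rV[R]_n) := smooth_near_continuous (sc' c).
have D2 (H : 'rV[R]_n * 'rV[R]_n -> 'rV[R]_n) x y : smooth_near H (z0, z0) ->
    'D_(x, 0) ('D_(0, y) H) (z0, z0) = 'D_x (fun w => 'D_y (fun z => H (w, z)) z0) z0.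
  move=> sH.
  have dH := smooth_near_differentiable (smooth_near_derive (0, y) sH).
  have E : 'D_x (fun w : 'rV[R]_n => (w, z0)) z0 = (x, 0).
    rewrite (derive_pair x (smooth_near_differentiable (smooth_near_id z0))
      (@differentiable_cst _ _ _ z0 z0)).
    by rewrite derive_id derive_cst.
  have := derive_comp x (smooth_near_differentiable (sc' z0)) dH.
  rewrite E => <-; apply: near_eq_derive.
  have N : \forall w \near z0, smooth_near H (w, z0) := cc' z0 _ (smooth_near_near sH).
  apply: filterS N => w /smooth_near_differentiable dw /=.
  by rewrite derive_partial.
have dsub (g : 'rV[R]_n -> 'rV[R]_n) c y : differentiable g z0 ->
    'D_y (fun z => g z - c) z0 = 'D_y g z0.
  move=> dg; have dy : derivable g z0 y by exact: diff_derivable.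
  by rewrite (deriveB dy (derivable_cst c z0 y)) derive_cst subr0.
have skw w : smooth_into_near (fun z => k (w, z)) z0.
  apply: smooth_into_near_mul; last exact/smooth_into_near_inv/smooth_into_near_inv1.
  exact: smooth_into_near_conj.
have skw' w : smooth_into_near (fun z => k (z, w)) z0.
  under eq_fun do rewrite kV; exact: smooth_into_near_inv.
have dphi (p : 'rV[R]_n -> G) : smooth_into_near p z0 -> p z0 = 1%g ->
    differentiable (chart_map phi \o p) z0.
  move=> sp p0; apply: smooth_near_differentiable; have [_] := sp; apply.
    exact: chart1_atlas.
  by rewrite p0; exact: chart1_dom.
(* For fixed [w] the inner derivative is that of a commutator, Ad(w)y - y, and its derivative in [w]
   is the bracket. *)
have BF x y : 'D_(x, 0) ('D_(0, y) F) (z0, z0) = bracket x y.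
  rewrite (D2 _ _ _ sF).
  have -> : (fun w => 'D_y (fun z => F (w, z)) z0) = (fun w => Ad y (1 * inv1 w)%g - y).
    apply/funext => w; rewrite mul1g.
    have E1 := dsub _ z0 y (dphi _ (skw w) (k1 w)).
    exact: (etrans E1 (derive_commutator (inv1 w) y)).
  have dA := smooth_near_differentiable (smooth_near_trans (smooth_at_Ad y (1%g : G))).
  by rewrite (dsub _ y x dA).
(* Exchanging the variables inverts the commutator, by [kV], and [derive_chart1_inv] turns the
   inverse into a sign. *)
have BFs x y : 'D_(x, 0) ('D_(0, y) (fun z => F (z.2, z.1))) (z0, z0) = - bracket x y.
  rewrite (D2 _ _ _ sFs).
  have -> : (fun w => 'D_y (fun z => F (z, w)) z0) = (fun w => - (Ad y (1 * inv1 w)%g - y)).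
    apply/funext => w; rewrite mul1g.
    have E1 := dsub _ z0 y (dphi _ (skw' w) (k2 w)).
    have E2 : (fun z => chart_map phi (k (z, w))) = (fun z => chart_map phi (k (w, z))^-1%g).
      by apply/funext => z; rewrite kV.
    have E3 := derive_chart1_inv y (skw w) (k1 w).
    have E4 := derive_commutator (inv1 w) y.
    exact: (etrans E1 (etrans (congr1 (fun f => 'D_y f z0) E2) (etrans E3 (congr1 -%R E4)))).
  have dA := smooth_near_differentiable (smooth_near_trans (smooth_at_Ad y (1%g : G))).
  have dAy : derivable (fun w => Ad y (1 * inv1 w)%g - y) z0 x.
    by apply: diff_derivable; apply: differentiableB => //; exact: differentiable_cst.
  by rewrite (deriveN dAy) (dsub _ y x dA).
(* [axes_derive_swap] rests on the mean value theorem and is scalar, so one works coordinate by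
   coordinate. *)
have C (H : 'rV[R]_n * 'rV[R]_n -> 'rV[R]_n) x y i : smooth_near H (z0, z0) ->
    'D_(x, 0) ('D_(0, y) (fun z => H z 0 i)) (z0, z0) =
    'D_(x, 0) ('D_(0, y) H) (z0, z0) 0 i.
  move=> sH.
  have E : \forall z \near (z0, z0), 'D_(0, y) H z 0 i = 'D_(0, y) (fun z => H z 0 i) z.
    apply: filterS (smooth_near_near sH) => z /smooth_near_differentiable dz.
    by rewrite derive_coord.
  rewrite -(near_eq_derive _ E); apply: derive_coord.
  exact: smooth_near_differentiable (smooth_near_derive (0, y) sH).
have V1 i : \forall w \near z0, F (w, z0) 0 i = 0.
  by apply: (@filterE _ (nbhs z0)) => w; rewrite /F k1 subrr mxE.
have V2 i : \forall w \near z0, F (z0, w) 0 i = 0.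
  by apply: (@filterE _ (nbhs z0)) => w; rewrite /F k2 subrr mxE.
apply/rowP => i; rewrite mxE.
have S := axes_derive_swap u v (framed_rV n) (smooth_near_coord i sF) (V1 i) (V2 i).
have E := etrans (esym (C _ u v i sFs)) (etrans S (C _ v u i sF)).
have B1 := congr1 (fun M : 'rV[R]_n => M 0 i) (BF v u).
have B2 := congr1 (fun M : 'rV[R]_n => M 0 i) (BFs u v).
have := etrans (esym B2) (etrans E B1).
move: (bracket u v) (bracket v u) => b c.
by rewrite mxE => <-; rewrite opprK.
Qed.

Lemma bracketvv v : bracket v v = 0.
Proof.
have /eqP := bracketC v v; rewrite -addr_eq0 -mulr2n -scaler_nat scaler_eq0.
by rewrite pnatr_eq0 => /eqP.
Qed.

(** The centraliser of [a] is a subgroup, so it is enough that it contain a neighbourhood of 1.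
    There the commutator with [a] has zero derivative, hence is constant. *)
Lemma Ad_trivial_commutes : connected [set: G] -> (forall v a, Ad v a = v) ->
  forall x y : G, (x * y = y * x)%g.
Proof.
move=> Gc AdE a; apply: connected_subgroup => //; last 2 first.
- by move=> x y ax ay; rewrite mulgA ax -mulgA ay mulgA.
- move=> x ax; apply: (mulgI x); apply: (mulIg x).
  by rewrite !mulgA mulgV mul1g -ax -!mulgA mulVg mulg1.
apply: near_chart1.
pose q (x : G) : G := (a * x * a^-1 * x^-1)%g.
have dq z v : chart_img phi z -> chart_dom phi (q (inv1 z)) ->
    smooth_near (chart_map phi \o q \o inv1) z /\ 'D_v (chart_map phi \o q \o inv1) z = 0.
  move=> iz dz; set x := inv1 z.
  have a1 := chart1_atlas (G := G).
  have si : smooth_into_near (inv1 : _ -> G) z by exact: smooth_into_near_chart_inv.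
  have sq : smooth_into_near (q \o inv1) z.
    apply: smooth_into_near_mul; last exact: smooth_into_near_inv.
    apply: smooth_into_near_mul; last exact: smooth_into_near_cst.
    by apply: smooth_into_near_mul => //; exact: smooth_into_near_cst.
  have sn : smooth_near (chart_map phi \o q \o inv1) z.
    by have [_] := sq; apply.
  split=> //.
  have xd : chart_dom phi x by exact: chart_inv_dom.
  have zx : z = chart_map phi x by rewrite /x chart_invK.
  have sx : smooth_at (chart_map phi \o q) x.
    by apply: (smooth_into_near_smooth_at (c := phi)) => //; rewrite -zx.
  have := chart_derive v (chart1_atlas (G := G)) xd sx; rewrite -zx => E.
  apply: (etrans E).
  rewrite /left_derive; set w := 'D_v _ _.
  pose r (y : G) : G := (q x * x * y * x^-1)%g.
  (* q(xy) = q(x) x q(y) x^-1 reduces the derivative of [q] at [x] to its derivative at 1, which is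
     Ad(a)w - w = 0. *)
  have qr z' : q (x * inv1 z')%g = r (q (inv1 z')).
    rewrite /r /q !mulgA invgM !mulgA.
    by rewrite -(mulgA _ (x^-1)%g x) mulVg mulg1 -(mulgA _ (a^-1)%g a) mulVg mulg1.
  have sc : smooth_into_near (fun z' => q (inv1 z')) z0.
    apply: smooth_into_near_mul; first exact: smooth_into_near_conj.
    exact/smooth_into_near_inv/smooth_into_near_inv1.
  have q1 : q (inv1 z0) = 1%g by rewrite /q chart1_inv mulg1 mulgV invg1 mulg1.
  have sc' : smooth_near (chart_map phi \o (fun z' => q (inv1 z'))) z0.
    by have [_] := sc; apply; rewrite ?q1//; exact: chart1_dom.
  have sr : smooth_near (chart_map phi \o (fun z' => r (inv1 z'))) z0.
    have [_] : smooth_into_near (fun z' => r (inv1 z')) z0.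
      apply: smooth_into_near_mul; last exact: smooth_into_near_cst.
      exact: smooth_into_near_trans.
    have r1 : r (inv1 z0) = q x by rewrite /r chart1_inv mulg1 -mulgA mulgV mulg1.
    by apply; [exact: a1|rewrite r1].
  have q0 : (chart_map phi \o (fun z' => q (inv1 z'))) z0 = z0 by rewrite /= q1.
  have := @derive_comp _ _ _ _ (chart_map phi \o (fun z' => q (inv1 z')))
    (chart_map phi \o (fun z' => r (inv1 z'))) z0 w (smooth_near_differentiable sc').
  rewrite q0 => /(_ (smooth_near_differentiable sr)).
  have -> : 'D_w (chart_map phi \o (fun z' => q (inv1 z'))) z0 = 0.
    by have := derive_commutator a w; rewrite AdE subrr.
  rewrite derive0 => <-; apply: near_eq_derive.
  have : \forall z' \near z0, chart_dom phi (q (inv1 z')).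
    by have [cc _] := sc; apply: cc; rewrite q1; exact/chart_dom_nbhs/chart1_dom.
  by apply: filterS => z' dz'; rewrite /= qr chart_mapK.
have N : \forall z \near z0, chart_img phi z /\ chart_dom phi (q (inv1 z)).
  apply: filterI; first exact/chart_img_nbhs/chart1_dom.
  have [cc _] : smooth_into_near (fun z => q (inv1 z)) z0.
    apply: smooth_into_near_mul; first exact: smooth_into_near_conj.
    exact/smooth_into_near_inv/smooth_into_near_inv1.
  by apply: cc; rewrite /q chart1_inv mulg1 mulgV invg1 mulg1; exact/chart_dom_nbhs/chart1_dom.
(* On a ball the segment from [z0] to [z] stays in the region where the derivative vanishes. *)
have /nbhs_ballP[e /= e0 eN] := N.
apply/nbhs_ballP; exists e => // z ze /=.
have [_ dz] := eN _ ze.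
have qz : chart_map phi (q (inv1 z)) = z0.
  apply/rowP => i.
  have L (t : R) : 0 <= t <= 1 -> smooth_near (chart_map phi \o q \o inv1) (z0 + t *: (z - z0)) /\
      'D_(z - z0) (chart_map phi \o q \o inv1) (z0 + t *: (z - z0)) = 0.
    move=> t01; have [] := eN (z0 + t *: (z - z0)).
      rewrite -ball_normE /= opprD addNKr normrN; apply: segment_lt => //.
      by move: ze; rewrite -ball_normE /= distrC.
    exact: dq.
  have [|t t01] := @mvt_line _ _ (fun y => (chart_map phi \o q \o inv1) y 0 i) z0 (z - z0).
    move=> t /L[h _]; apply: smooth_near_differentiable; exact: smooth_near_coord.
  have -> : z0 + (z - z0) = z by rewrite addrC subrK.
  move=> E.
  have q1 : q (inv1 z0) = 1%g by rewrite /q chart1_inv mulg1 mulgV invg1 mulg1.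
  have [|sl dl] := L t; first by case/andP: t01 => *; rewrite !ltW.
  move: E; rewrite /= q1 => /eqP; rewrite subr_eq => /eqP ->.
  rewrite (derive_coord _ _ _ (smooth_near_differentiable sl)) dl.
  by rewrite mxE add0r.
have : q (inv1 z) = 1%g by rewrite -[LHS](chart_mapK dz) qz chart1_inv.
rewrite /q => /(canRL (mulgK _)); rewrite mul1g invgK => /(canRL (mulgK _)).
by rewrite invgK.
Qed.

(* The coordinates of a |-> Ad(a)y are annihilated by y since [y, y] = 0, so
   they are constant and y is central; then [y, v] = 0 for all v and the same
   argument applies to a |-> Ad(a)v. *)
Lemma left_derive_constant_commutes (y : 'rV[R]_n) : connected [set: G] ->
  (forall f : G -> R, (forall x, smooth_at f x) ->
     (forall x, left_derive y f x = 0) -> forall x x', f x = f x') ->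
  forall x x' : G, (x * x' = x' * x)%g.
Proof.
move=> Gc H; apply: Ad_trivial_commutes => //.
have K v : bracket y v = 0 -> forall a, Ad v a = v.
  move=> yv a; rewrite -[RHS](Ad1 v); apply/rowP => i.
  apply: (H (fun x => Ad v x 0 i)) => x; first exact: smooth_near_coord (smooth_at_Ad v x).
  rewrite left_derive_coord; last exact: smooth_at_Ad.
  by rewrite left_derive_Ad -/(bracket y v) yv Ad0 mxE.
move=> v; apply: (K v); rewrite bracketC.
have -> : bracket v y = 0; last by rewrite oppr0.
rewrite /bracket (_ : Ad y = fun=> y) ?left_derive_cst//.
by apply/funext => a; apply: K; exact: bracketvv.
Qed.

End Adjoint.

(** * Haar measure *)

Section HaarMeasure.
Context {R : realType} {n : nat} {G : lieGroupType R n}.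
Local Notation bG := (borel G).

Lemma open_borel (A : set G) : open A -> measurable (A : set bG).
Proof. by move=> oA; exact: sub_sigma_algebra. Qed.

Lemma measurable_fun_open d (T : measurableType d) (f : T -> bG) :
  (forall A : set G, open A -> measurable (f @^-1` A)) -> measurable_fun setT f.
Proof.
move=> h; apply: (@measurability _ _ T bG setT f (@open G) erefl) => _ [A oA <-].
by rewrite setTI; exact: h.
Qed.

Lemma continuous_borel_measurable (f : G -> G) : continuous f ->
  measurable_fun setT (f : bG -> bG).
Proof.
move=> cf; apply: measurable_fun_open => A oA; apply: open_borel.
by apply: open_comp => // x _; exact: cf.
Qed.

Lemma continuous_real_measurable (f : G -> R) : continuous f ->
  measurable_fun setT (f : bG -> R).
Proof.
move=> cf; apply: (measurability _ (RGenOInfty.measurableE R)) => _ [_ [x ->] <-].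
rewrite setTI; apply: open_borel.
by apply: open_comp => [y _|]; [exact: cf|exact: interval_open].
Qed.

(** Second countability makes [W] a countable union of rectangles with sides in the basis [B]. The
    injection [e] numbers the basis, so each [F i j] is one such rectangle or is empty. *)
Lemma open_prod_measurable (W : set (G * G)) : open W ->
  measurable (W : set (bG * bG)%type).
Proof.
move=> oW; have [B /countable_injP[e einj] [oB Bb]] := @manifold_second_countable R n G.
pose F i j : set (bG * bG)%type := [set z | exists U V, [/\ B U /\ B V, e U = i, e V = j,
  U `*` V `<=` W & (U `*` V) z]].
have -> : W = \bigcup_i \bigcup_j F i j.
  apply/seteqP; split=> [[x y] Wxy|z [i _ [j _ [U [V [_ _ _ UV]]]]]]; last exact: UV.
  have : nbhs (x, y) W by exact: open_nbhs_nbhs.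
  move=> [[P Q] /= [xP yQ] PQ].
  have [U [BU Ux] UP] := Bb x P xP; have [V [BV Vy] VQ] := Bb y Q yQ.
  exists (e U) => //; exists (e V) => //; exists U, V; split=> //.
  by move=> [a b] [Ua Vb]; apply: PQ; split; [exact: UP|exact: VQ].
apply: bigcupT_measurable => i; apply: bigcupT_measurable => j.
have [[U [V [[BU BV] <- <- UV]]]|no] := pselect (exists U V,
    [/\ B U /\ B V, e U = i, e V = j & U `*` V `<=` W]).
  have -> : F (e U) (e V) = U `*` V.
    apply/seteqP; split=> [z [U' [V' [[BU' BV'] eU eV _ UV']]]|z UVz]; last by exists U, V.
    have <- : U' = U by apply: einj => //; exact: mem_set.
    by have <- : V' = V by apply: einj => //; exact: mem_set.
  by apply: measurableX; apply: open_borel; exact: oB.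
have -> : F i j = set0; last exact: measurable0.
by rewrite -subset0 => z [U [V [BUV eU eV UV _]]]; apply: no; exists U, V.
Qed.

Variable mu : probability (borel G) R.
Hypothesis mu_haar : left_invariant_measure mu.

(** Fubini for W = {(x, y) : x^-1 y in A}: its sections at fixed [x] are the translates xA, and
    those at fixed [y] are the translates y A^-1. *)
Lemma haar_inv (A : set bG) : measurable A -> mu ((fun x : G => x^-1%g) @^-1` A) = mu A.
Proof.
move=> mA.
pose W : set (bG * bG)%type := [set z | A ((z.1 : G)^-1 * (z.2 : G))%g].
have mW : measurable W.
  have h : measurable_fun setT (fun z : bG * bG => ((z.1 : G)^-1 * (z.2 : G))%g : bG).
    apply: measurable_fun_open => O oO; apply: open_prod_measurable.
    have c : continuous (fun z : G * G => (z.1^-1 * z.2)%g).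
      move=> z.
      apply: (@continuous_mul _ _ _ _ (fun z : G * G => z.1^-1%g) snd); last exact: cvg_snd.
      by apply: (@continuous_inv _ _ _ _ fst); exact: cvg_fst.
    by apply: (open_comp (f := fun z : G * G => (z.1^-1 * z.2)%g)) => // z _; exact: c.
  by rewrite -[W]setTI; exact: h.
have := indic_fubini_tonelli mu mu mW.
rewrite indic_fubini_tonelli_FE// indic_fubini_tonelli_GE//.
have iA : measurable ((fun x : G => x^-1%g) @^-1` A : set bG).
  rewrite -[X in measurable X]setTI.
  exact: (continuous_borel_measurable inv_continuous).
have -> : (\int[mu]_x (mu \o xsection W) x = mu A)%E.
  rewrite (eq_integral (fun=> mu A)).
    by rewrite integral_cst//= probability_setT mule1.
  move=> x _ /=; rewrite -(mu_haar (x : G)^-1%g mA); congr (mu _).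
  apply/seteqP; split=> y; first by move/set_mem.
  by move=> h; exact: mem_set.
have -> : (\int[mu]_y (mu \o ysection W) y = mu ((fun x : G => x^-1%g) @^-1` A))%E.
  rewrite (eq_integral (fun=> mu ((fun x : G => x^-1%g) @^-1` A))).
    by rewrite integral_cst//= probability_setT mule1.
  move=> y _ /=; rewrite -(mu_haar (y : G)^-1%g iA); congr (mu _).
  apply/seteqP; split=> x; first by move/set_mem; rewrite /W /= /lmul invgM invgK.
  by move=> h; apply: mem_set; move: h; rewrite /W /= /lmul invgM invgK.
by move=> ->.
Qed.

(** Inversion preserves the measure and exchanges right and left translations. *)
Lemma haar_right (a : G) (A : set bG) : measurable A -> mu (rmul a @^-1` A) = mu A.
Proof.
move=> mA.
have iA : measurable ((fun x : G => x^-1%g) @^-1` A : set bG).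
  rewrite -[X in measurable X]setTI.
  exact: (continuous_borel_measurable inv_continuous).
have rA : measurable (rmul a @^-1` A : set bG).
  rewrite -[X in measurable X]setTI.
  exact: (continuous_borel_measurable (@rmul_continuous _ _ _ a)).
rewrite -(haar_inv rA) -(haar_inv mA) -(mu_haar a^-1%g iA); congr (mu _).
by apply/seteqP; split=> x; rewrite /= /rmul /lmul invgM invgK.
Qed.

Hypothesis G_compact : compact [set: G].

(** If [A] were null, so would be its translates; these cover [G], and by compactness finitely many
    suffice. *)
Lemma haar_open_gt0 (A : set G) : open A -> A !=set0 -> (0 < mu (A : set bG))%E.
Proof.
move=> oA [a Aa]; rewrite lt_neqAle measure_ge0 andbT; apply/eqP => A0.
have : mu.-negligible [set: bG].
  apply: (@compact_induction _ (fun B : set G => mu.-negligible (B : set bG))) => //.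
  - exact: negligible_set0.
  - by move=> B C; exact: negligibleU.
  - by move=> B C BC; exact: negligibleS.
  move=> x; exists (lmul (a * x^-1)%g @^-1` A).
    apply: lmul_continuous; rewrite /lmul -mulgA mulVg mulg1.
    exact: open_nbhs_nbhs.
  have mA : measurable (A : set bG) by exact: open_borel.
  exists (lmul (a * x^-1)%g @^-1` A); split=> //; last by rewrite mu_haar.
  rewrite -[X in measurable X]setTI.
  exact: (continuous_borel_measurable (@lmul_continuous _ _ _ _)).
move=> [N [mN N0 GN]].
have := probability_setT mu; rewrite (_ : setT = N) ?N0; last first.
  by apply/seteqP; split=> // x _; exact: GN.
by move=> /eqP; rewrite eq_sym onee_eq0.
Qed.

End HaarMeasure.

(** * Integration by parts for the Haar measure *)

Section HaarIntegral.
Context {R : realType} {n : nat} {G : lieGroupType R n}.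
Local Notation bG := (borel G).
Local Notation phi := (chart_at (1%g : G)).
Local Notation z0 := (chart_map phi (1%g : G)).
Local Notation inv1 := (chart_inv phi).

Hypothesis G_compact : compact [set: G].
Variable mu : probability (borel G) R.
Hypothesis mu_haar : left_invariant_measure mu.

Lemma continuous_compact_bounded (f : G -> R) : continuous f ->
  exists M, forall x, `|f x| <= M.
Proof.
move=> cf.
suff [M HM] : exists M, forall x, [set: G] x -> `|f x| <= M by exists M => x; exact: HM.
apply: (@compact_induction _ (fun B : set G => exists M, forall x, B x -> `|f x| <= M)) => //.
- by exists 0.
- move=> A B [M HM] [M' HM']; exists (Num.max M M') => x [/HM|/HM'] h;
    by rewrite le_max h ?orbT.
- by move=> A B AB [M HM]; exists M => x /AB/HM.
move=> x; exists (f @^-1` ball (f x) 1); first by apply: cf; exact: nbhsx_ballx.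
exists (`|f x| + 1) => y; rewrite /= -ball_normE /= => /ltW fxy.
by rewrite -lerBlDl (le_trans _ fxy)// (le_trans (lerB_dist _ _))// distrC.
Qed.

Lemma continuous_integrable (f : G -> R) : continuous f ->
  mu.-integrable setT (EFin \o (f : bG -> R)).
Proof.
move=> cf; have mf := continuous_real_measurable cf.
apply: (measurable_bounded_integrable measurableT _ mf).
  by apply: (@le_lt_trans _ _ 1%E); [exact: probability_le1|exact: ltry].
have [M HM] := continuous_compact_bounded cf.
exists M; split; first exact: num_real.
by move=> N /ltW MN x _ /=; exact: le_trans (HM x) MN.
Qed.

Lemma continuous_Lfun2 (f : G -> R) : continuous f -> (f : bG -> R) \in Lfun mu 2%:E.
Proof.
move=> cf; apply/andP; split; apply/mem_set => /=.
  exact: continuous_real_measurable.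
rewrite /finite_norm unlock; apply: poweR_lty => /=.
have cf2 : continuous (fun x => `|f x| ^+ 2).
  move=> x; have cn : {for x, continuous (fun x => `|f x|)}.
    by apply: continuous_comp (cf x) _; exact: norm_continuous.
  have := cvgM cn cn; rewrite /continuous_at expr2; exact.
rewrite (eq_integral (EFin \o ((fun x : bG => `|f x| ^+ 2) : bG -> R))).
  by apply: integrable_lty => //; exact: continuous_integrable.
by move=> x _ /=; rewrite powR_mulrn.
Qed.

Lemma Rintegral_right (f : G -> R) a : continuous f ->
  \int[mu]_x f (x * a)%g = \int[mu]_x f x.
Proof.
move=> cf; congr fine.
have mr : measurable_fun [set: bG] (rmul a : bG -> bG).
  by apply: continuous_borel_measurable; exact: rmul_continuous.
have mf : measurable_fun [set: bG] (fun x : bG => (f x)%:E).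
  by apply/measurable_EFinP; exact: continuous_real_measurable.
have cfr : continuous (f \o rmul a).
  by move=> x; apply: continuous_comp; [exact: rmul_continuous|exact: cf].
have ir : mu.-integrable (rmul a @^-1` setT) ((EFin \o f) \o (rmul a : bG -> bG)).
  exact: (continuous_integrable cfr).
have := integral_pushforward mr mf ir measurableT.
rewrite preimage_setT /= => <-; apply: eq_measure_integral => A mA _.
exact: haar_right.
Qed.

(* The curve t |-> phi^-1 (z0 + t v) through 1 has velocity v, and the integral
   of f (x gamma(t)) over x does not depend on t. *)
Lemma integral_left_derive (f : G -> R) v : (forall x, smooth_at f x) ->
  \int[mu]_x left_derive v f x = 0.
Proof.
move=> sf; have cf : continuous f by move=> x; exact: smooth_at_continuous.
pose g (t : R) : G := inv1 (z0 + t *: v).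
pose F (t : R) (x : bG) : R := f (x * g t)%g.
(* Differentiation under the integral needs an interval of [t] and a bound on the derivative
   independent of [x]. Locally in [x] they come from continuity of the derivative in both
   variables. *)
have [e [M [e0 H]]] : exists e M : R, 0 < e /\ forall x : G, [set: G] x ->
    forall t, `|t| < e -> differentiable (F^~ x) t /\ `|'D_1 (F^~ x) t| <= M.
  apply: (@compact_induction _ (fun B : set G => exists e M : R, 0 < e /\ forall x : G, B x ->
    forall t, `|t| < e -> differentiable (F^~ x) t /\ `|'D_1 (F^~ x) t| <= M)) => //.
  - by exists 1, 0.
  - move=> A B [e1 [M1 [e10 H1]]] [e2 [M2 [e20 H2]]].
    exists (Num.min e1 e2), (Num.max M1 M2); split; first by rewrite lt_min e10 e20.
    move=> x ABx t; rewrite lt_min => /andP[t1 t2].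
    case: ABx => [Ax|Bx].
      by have [d h] := H1 _ Ax _ t1; split=> //; rewrite le_max h.
    by have [d h] := H2 _ Bx _ t2; split=> //; rewrite le_max h orbT.
  - by move=> A B AB [e [M [e0 H]]]; exists e, M; split=> // x /AB; exact: H.
  move=> x; have xx := chart_at_dom x; set c := chart_at x in xx *.
  have ac : @atlas R n G c by exact: chart_at_atlas.
  pose p (z : 'rV[R]_n * R) : G := (chart_inv c z.1 * g z.2)%g.
  have sp : smooth_into_near p (chart_map c x, 0).
    apply: smooth_into_near_mul.
      apply: (@smooth_into_near_comp _ _ _ _ _ fst); [exact: framed_rV|exact: smooth_near_fst|].
      by apply: smooth_into_near_chart_inv => //; exact: chart_imgP.
    apply: (@smooth_into_near_comp _ _ _ _ _ (fun z : 'rV[R]_n * R => z0 + z.2 *: v)).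
    - exact: framed_rV.
    - apply: smooth_nearD; first exact: smooth_near_cst.
      by apply: smooth_near_scale; [exact: smooth_near_snd|exact: smooth_near_cst].
    - by rewrite /= scale0r addr0; exact: smooth_into_near_inv1.
  have sH : smooth_near (f \o p) (chart_map c x, 0) := smooth_at_comp sp (sf _).
  have cD := smooth_near_continuous (smooth_near_derive ((0, 1) : 'rV[R]_n * R) sH).
  set D := 'D_((0, 1) : 'rV[R]_n * R) (f \o p) in cD.
  have cDe : \forall z \near (chart_map c x, 0 : R), `|D (chart_map c x, 0) - D z| <= 1.
    by move: cD => /cvgr_dist_le/(_ 1 ltr01).
  have [r1 r10 H1] := near_box (smooth_near_near sH).
  have [r2 r20 H2] := near_box cDe.
  pose r := Num.min r1 r2.
  have r0 : 0 < r by rewrite lt_min r10 r20.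
  exists (chart_dom c `&` chart_map c @^-1` ball (chart_map c x) r).
    apply: filterI; first exact: chart_dom_nbhs.
    by apply: (chart_map_continuous xx); exact: nbhsx_ballx.
  exists r, (`|D (chart_map c x, 0)| + 1); split=> // y [cy].
  rewrite /= -ball_normE /= distrC lt_min => /andP[y1 y2] t.
  rewrite lt_min => /andP[t1 t2].
  have yE : chart_map c x + (chart_map c y - chart_map c x) = chart_map c y.
    by rewrite addrC subrK.
  have := H1 _ _ y1 t1; have := H2 _ _ y2 t2; rewrite yE add0r => Dt st.
  have FE : F^~ y = fun s => (f \o p) (chart_map c y, s).
    by apply/funext => s; rewrite /F /= /p /= chart_mapK.
  have dt := smooth_near_differentiable st.
  split.
    rewrite FE; apply: differentiable_comp (dt) => //.
    apply: smooth_near_differentiable.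
    by apply: (@smooth_near_pair _ _ _ _ (fun=> chart_map c y) id);
      [exact: framed_rV|exact: framed_R|exact: smooth_near_cst|exact: smooth_near_id].
  rewrite FE (derive_partial _ dt) -/D -lerBlDl (le_trans _ Dt)//.
  by rewrite (le_trans (lerB_dist _ _))// distrC.
have cF t : continuous (F t : G -> R).
  by move=> x; apply: (@continuous_comp _ _ _ (rmul (g t)) f); [exact: rmul_continuous|exact: cf].
have M0 : 0 <= M.
  by have [|_] := H 1%g I 0; [rewrite normr0|apply: le_trans].
have Ie t : `]-e, e[%classic t -> `|t| < e by rewrite /= in_itv /= ltr_norml.
have DU : derive1 (fun t => \int[mu]_x F t x) 0 = \int[mu]_x (partial1of2 F ^~ x) 0.
  apply: (@differentiation_under_integral R _ bG mu F setT measurableT 0 (- e) e _ _ _ (fun=> M)).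
  - by rewrite /= in_itv /= oppr_lt0 e0.
  - by move=> t _; exact: continuous_integrable.
  - by move=> t x /Ie te _; apply: diff_derivable; have [] := H x I t te.
  - by [].
  - by apply: continuous_integrable => x; exact: cst_continuous.
  - by move=> t x /Ie te _; rewrite partial1of2E; have [] := H x I t te.
(* [F t] is the right translate of [f] by [g t], hence the need for [haar_right]. *)
have E0 : (fun t => \int[mu]_x F t x) = fun=> \int[mu]_x f x.
  by apply/funext => t; exact: Rintegral_right.
have D0 : derive1 (fun t => \int[mu]_x F t x) 0 = 0 by rewrite E0; exact: derive1_cst.
apply: etrans (etrans (esym DU) D0).
apply: eq_Rintegral => x _; rewrite partial1of2E /left_derive.
have d0 : differentiable (fun z => f ((x : G) * inv1 z)%g) (z0 + 0 *: v).
  rewrite scale0r addr0; apply: smooth_near_differentiable.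
  exact: smooth_near_trans.
by have [_] := is_derive_line d0; rewrite scale0r addr0 => <-.
Qed.

Lemma integral_by_parts (f g : G -> R) v :
  (forall x, smooth_at f x) -> (forall x, smooth_at g x) ->
  \int[mu]_x (f x * left_derive v g x) = - \int[mu]_x (left_derive v f x * g x).
Proof.
move=> sf sg.
have c (h : G -> R) : (forall x, smooth_at h x) -> continuous h.
  by move=> sh x; exact: smooth_at_continuous.
have sd (h : G -> R) w : (forall x, smooth_at h x) -> forall x, smooth_at (left_derive w h) x.
  by move=> sh x; exact: smooth_at_left_derive.
have sM (h k : G -> R) : (forall x, smooth_at h x) -> (forall x, smooth_at k x) ->
    forall x, smooth_at (fun y => h y * k y) x.
  by move=> sh sk x; exact: smooth_at_scale.
have := integral_left_derive v (sM _ _ sf sg).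
under eq_Rintegral do rewrite left_deriveM//.
rewrite RintegralD//.
- by move=> /eqP; rewrite addrC addr_eq0 => /eqP.
- exact/continuous_integrable/c/sM/sg/sd.
- exact/continuous_integrable/c/sM/sd/sg.
Qed.

(** The open set where [f] is nonzero is null, hence empty by [haar_open_gt0]. *)
Lemma continuous_integral_eq0 (f : G -> R) : continuous f -> (forall x, 0 <= f x) ->
  \int[mu]_x f x = 0 -> forall x, f x = 0.
Proof.
move=> cf f0 If x.
apply/eqP/negPn/negP => fx.
have oA : open (f @^-1` [set~ 0]).
  apply: open_comp => [y _|]; first exact: cf.
  by rewrite openC; exact: closed_eq.
have Ax : (f @^-1` [set~ 0]) !=set0 by exists x; exact/eqP.
have := haar_open_gt0 mu_haar G_compact oA Ax.
rewrite ltNge => /negP; apply.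
have mf : measurable_fun [set: bG] (fun x : bG => (f x)%:E).
  by apply/measurable_EFinP; exact: continuous_real_measurable.
have /integrableP[_ fi] := continuous_integrable cf.
have : (\int[mu]_x `|(EFin \o (f : bG -> R)) x| = 0)%E.
  have E : (\int[mu]_x `|(EFin \o (f : bG -> R)) x| = \int[mu]_x (f x)%:E)%E.
    by apply: eq_integral => y _ /=; rewrite ger0_norm.
  rewrite E; rewrite E in fi; rewrite -[LHS]fineK; first by move: If; rewrite /Rintegral => ->.
  by rewrite ge0_fin_numE// integral_ge0// => y _; rewrite lee_fin.
move/(ae_eq_integral_abs _ _ mf) => /(_ measurableT) [N [mN N0 NA]].
rewrite -N0; apply: (le_measure mu (mem_set (open_borel oA)) (mem_set mN)).
move=> y fy; apply: NA => /= H; apply: fy.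
by have [] := H I.
Qed.

End HaarIntegral.

(** * Consequence of the inequality *)

Section Inequality.
Context {R : realType} {n : nat} {G : lieGroupType R n}.
Local Notation bG := (borel G).
Variable mu : probability (borel G) R.
Hypothesis mu_haar : left_invariant_measure mu.
Hypothesis G_compact : compact [set: G].
Variable X : 'I_n -> vector_field G.
Hypothesis X_left : forall j, left_invariant_vf (X j).

Definition complexify (f : G -> R) : G -> R[i] := fun x => (f x)%:C%C.

Lemma complexify_L2 (f : G -> R) : continuous f -> in_L2 mu (complexify f).
Proof.
move=> cf; split; first exact: (continuous_Lfun2 G_compact).
have c0 : continuous (fun _ : G => 0 : R) by move=> x; exact: cst_continuous.
exact: (continuous_Lfun2 G_compact mu c0).
Qed.

Lemma complexify_L2norm (f : G -> R) :
  L2norm mu (complexify f) = Num.sqrt (\int[mu]_x (f x ^+ 2)).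
Proof.
congr Num.sqrt; apply: eq_Rintegral => x _ /=.
by rewrite expr0n /= addr0.
Qed.

Lemma complexify_cintegral (f : G -> R) :
  cintegral mu (complexify f) = (\int[mu]_x f x)%:C%C.
Proof.
rewrite /cintegral; congr Complex.
rewrite /= (_ : (fun=> 0) = (fun x : bG => 0 : R))//.
by rewrite Rintegral_cst// mul0r.
Qed.

Lemma smooth_left_derive_continuous (f : G -> R) v : (forall x, smooth_at f x) ->
  continuous (left_derive v f).
Proof. by move=> sf x; apply: smooth_at_continuous; exact: smooth_at_left_derive. Qed.

(** Integration by parts makes the classical gradient a weak one, so real smooth functions are
    admissible in the inequality. *)
Lemma complexify_H1 (f : G -> R) : (forall x, smooth_at f x) ->
  H1_gradient mu X (complexify f) (fun j => complexify (left_derive (X j 1%g) f)).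
Proof.
move=> sf; split; first by apply: complexify_L2 => x; exact: smooth_at_continuous.
move=> j; split; first exact/complexify_L2/smooth_left_derive_continuous.
move=> g /smooth_funP sg.
have E1 : (fun x => complexify f x * (vf_apply (X j) g x)%:C%C) =
    complexify (fun x => f x * left_derive (X j 1%g) g x).
  by apply/funext => x; rewrite /complexify -rmorphM /= vf_apply_left.
have E2 : (fun x => complexify (left_derive (X j 1%g) f) x * (g x)%:C%C) =
    complexify (fun x => left_derive (X j 1%g) f x * g x).
  by apply/funext => x; rewrite /complexify -rmorphM.
rewrite E1 E2 !complexify_cintegral (integral_by_parts G_compact mu_haar _ sf sg).
by rewrite rmorphN.
Qed.

Lemma directional_complexify alpha (f : 'I_n -> G -> R) :
  directional alpha (fun j => complexify (f j)) =
  complexify (fun x => \sum_j alpha 0 j * f j x).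
Proof.
apply/funext => x; rewrite /directional /complexify rmorph_sum /=.
by apply: eq_bigr => j _; rewrite rmorphM.
Qed.

Lemma inequality_left_derive_constant (alpha : 'rV[R]_n) (delta c : R) :
  1 <= delta -> 0 < c ->
  (forall (f : G -> R[i]) (Df : 'I_n -> G -> R[i]),
     H1_gradient mu X f Df -> cintegral mu f = 0 ->
     gradient_norm mu Df `^ (delta - 1) * L2norm mu (directional alpha Df)
       >= c * L2norm mu f `^ delta) ->
  forall f : G -> R, (forall x, smooth_at f x) ->
    (forall x, left_derive (\sum_j alpha 0 j *: X j 1%g) f x = 0) ->
  forall x x', f x = f x'.
Proof.
move=> d1 c0 ineq f sf Yf.
have cf : continuous f by move=> x; exact: smooth_at_continuous.
pose m := \int[mu]_x f x.
(* Removing the mean makes the inequality applicable and does not affect the derivatives. *)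
pose g x := f x + - m.
have sg x : smooth_at g x by apply: smooth_atD => //; exact: smooth_at_cst.
have cg : continuous g by move=> x; exact: smooth_at_continuous.
have gm : cintegral mu (complexify g) = 0.
  rewrite complexify_cintegral /g RintegralD//; last 2 first.
  - exact: (continuous_integrable G_compact mu cf).
  - by apply: (continuous_integrable G_compact mu) => x; exact: cst_continuous.
  have -> : \int[mu]_x (- m) = - m.
    rewrite Rintegral_cst//; have -> : fine (mu setT) = 1 by rewrite probability_setT.
    by rewrite mulr1.
  by rewrite subrr.
have := ineq _ _ (complexify_H1 sg) gm.
rewrite directional_complexify.
have -> : (fun x => \sum_j alpha 0 j * left_derive (X j 1%g) g x) = fun=> 0.
  apply/funext => x.
  have := left_deriveD (\sum_j alpha 0 j *: X j 1%g) (sf x) (smooth_at_cst (- m) x).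
  rewrite Yf left_derive_cst addr0 left_derive_sum// => E.
  apply: etrans E; apply: eq_bigr => j _.
  by rewrite left_deriveZ.
rewrite !complexify_L2norm expr0n /=.
have -> : \int[mu]_x (0 : R) = 0 by rewrite Rintegral_cst// mul0r.
(* The gradient factor, whatever its value, is multiplied by the norm of Yg, which is 0. *)
rewrite sqrtr0 mulr0 => le0.
have I0 : 0 <= \int[mu]_x (g x ^+ 2) by apply: Rintegral_ge0 => x _; exact: sqr_ge0.
have {le0} : Num.sqrt (\int[mu]_x (g x ^+ 2)) `^ delta = 0.
  apply/eqP; rewrite eq_le powR_ge0 andbT.
  by rewrite -(ler_pM2l c0) mulr0.
move=> /powR_eq0_eq0 /eqP; rewrite sqrtr_eq0 => le0.
have {le0}I0' : \int[mu]_x (g x ^+ 2) = 0 by apply/eqP; rewrite eq_le le0.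
have cg2 : continuous (fun x => g x ^+ 2).
  by move=> x; have := cvgM (cg x) (cg x); rewrite /continuous_at expr2; exact.
have g0 x : g x = 0.
  apply/eqP; rewrite -sqrf_eq0; apply/eqP.
  exact: (continuous_integral_eq0 G_compact mu_haar cg2 (fun x => sqr_ge0 _) I0').
by move=> x x'; have := g0 x; rewrite -(g0 x') => /addIr.
Qed.

End Inequality.

(** * Lattices *)

Section RowNorm.
Context {R : realType} {n : nat}.
Implicit Types u v : 'rV[R]_n.

Lemma rV_coord_le_norm v i : `|v 0 i| <= `|v|.
Proof.
by rewrite [leRHS]/Num.Def.normr /= mx_normrE; apply/bigmax_geP; right => /=; exists (0, i).
Qed.

Lemma rV_norm_le v (c : R) : 0 <= c -> (forall i, `|v 0 i| <= c) -> `|v| <= c.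
Proof.
move=> c0 h; rewrite [leLHS]/Num.Def.normr /= mx_normrE; apply/bigmax_leP; split=> // -[i j] _ /=.
by rewrite ord1.
Qed.

Lemma rV_mulmx_le (b : 'M[R]_n) (t : 'rV[R]_n) (c d : R) : 0 <= c -> 0 <= d ->
  (forall i, `|t 0 i| <= c) -> (forall i j, `|b i j| <= d) ->
  `|t *m b| <= n%:R * (c * d).
Proof.
move=> c0 d0 tc bd; apply: rV_norm_le => [|j]; first by rewrite !mulr_ge0.
rewrite mxE (le_trans (ler_norm_sum _ _ _))//.
rewrite (@le_trans _ _ (\sum_(i < n) c * d))//.
  by apply: ler_sum => i _; rewrite normrM ler_pM.
by rewrite sumr_const card_ord mulr_natl.
Qed.

End RowNorm.

(** * Bases of discrete cocompact subgroups of R^n *)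

Section Lattice.
Context {R : realType} {n : nat}.
Variable L : set 'rV[R]_n.
Hypothesis L0 : L 0.
Hypothesis LB : forall u v, L u -> L v -> L (u - v).
Hypothesis L_discrete : exists2 e : R, 0 < e & forall u, L u -> `|u| < e -> u = 0.
Hypothesis L_cocompact : exists M : R, forall v, exists2 u, L u & `|v - u| <= M.

Let LN u : L u -> L (- u).
Proof. by move=> Lu; rewrite -sub0r; exact: LB. Qed.

Let LD u v : L u -> L v -> L (u + v).
Proof. by move=> Lu Lv; rewrite -[v]opprK; apply: LB => //; exact: LN. Qed.

Let LZ (a : R) u : a \is a Num.int -> L u -> L (a *: u).
Proof.
move=> /intrP[z ->] Lu.
have Ln k : L (k%:R *: u).
  by elim: k => [|k IH]; rewrite ?scale0r// -natr1 scalerDl scale1r; exact: LD.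
by case: z => k; [exact: Ln|rewrite NegzE rmorphN /= scaleNr; apply: LN; exact: Ln].
Qed.

Let LM (b : 'M[R]_n) (a : 'rV[R]_n) : (forall i, L (row i b)) ->
  (forall i, a 0 i \is a Num.int) -> L (a *m b).
Proof.
move=> Lb ai; rewrite mulmx_sum_row.
by elim/big_ind : _ => // i _; exact: LZ.
Qed.

(** Elements of [L] within [M] of large multiples of the basis vectors form a matrix close to a
    multiple of the identity, hence invertible. *)
Let lattice_spans : exists2 b : 'M[R]_n, (forall i, L (row i b)) & b \in unitmx.
Proof.
have [M HM] := L_cocompact.
have M0 : 0 <= M by have [u _ h] := HM 0; exact: le_trans h.
(* A row vector [x] killed by the matrix satisfies K|x| <= nM|x|, so K > nM forces x = 0. *)
pose K : R := n%:R * M + 1.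
have /choice[u Hu] : forall i : 'I_n, exists u, L u /\ `|K *: delta_mx 0 i - u| <= M.
  by move=> i; have [u] := HM (K *: delta_mx 0 i); exists u.
exists (\matrix_i u i) => [i|]; first by rewrite rowK; have [] := Hu i.
rewrite -row_free_unit; apply: inj_row_free => x xb.
have E : K *: x = x *m (K%:M - \matrix_i u i) by rewrite mulmxBr xb subr0 mul_mx_scalar.
have K0 : 0 <= K by rewrite addr_ge0// mulr_ge0.
have : K * `|x| <= n%:R * (`|x| * M).
  rewrite -[X in X * _]ger0_norm// -normrZ E.
  apply: rV_mulmx_le => // [|i j]; first exact: rV_coord_le_norm.
  have [_ h] := Hu i; apply: le_trans h.
  apply: le_trans (rV_coord_le_norm _ j).
  by rewrite !mxE eqxx mulr_natr /= (eq_sym j).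
rewrite mulrCA mulrC -subr_ge0 -mulrBr /K opprD addNKr mulrN1 oppr_ge0 => x0.
by apply/eqP; rewrite -normr_eq0 eq_le x0 normr_ge0.
Qed.

(* Among Q^n + 1 multiples of u two have their fractional coordinates in the
   same box of side 1/Q. *)
Let lattice_denominator (b : 'M[R]_n) : (forall i, L (row i b)) -> b \in unitmx ->
  exists2 N : nat, (0 < N)%N &
    forall u, L u -> forall i, N%:R * (u *m invmx b) 0 i \is a Num.int.
Proof.
move=> Lb ub; have [e e0 He] := L_discrete.
have [B [B0 HB]] : exists B : R, 0 <= B /\ forall i j, `|b i j| <= B.
  exists (\sum_i \sum_j `|b i j|); split.
    by apply: sumr_ge0 => i _; apply: sumr_ge0.
  move=> i j; rewrite (bigD1 i)//= (bigD1 j)//= -addrA lerDl.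
  by rewrite addr_ge0//; apply: sumr_ge0 => // k _; apply: sumr_ge0.
(* Q = q + 1 is so large that a vector of [L] whose coordinates in [b] are at most 1/Q has norm
   below [e], and is therefore 0. *)
pose q := Num.truncn (n%:R * B / e).
have Q0 : 0 < (q.+1%:R : R) by rewrite ltr0n.
have qe : n%:R * (q.+1%:R^-1 * B) < e.
  rewrite mulrCA mulrC ltr_pdivrMr// [ltRHS]mulrC -ltr_pdivrMr//.
  by apply: truncnS_gt.
(* The denominator [d] found for [u] depends on [u] but is at most Q^n; the factorial is a common
   multiple. *)
exists ((q.+1 ^ n)`!)%N; first exact: fact_gt0.
move=> u Lu i0; set t := u *m invmx b.
pose fr (x : R) := x - (Num.floor x)%:~R.
have fr0 x : 0 <= fr x by rewrite subr_ge0 floor_le.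
have fr1 x : fr x < 1.
  by have := floorD1_gt x; rewrite intrD -ltrBlDl.
pose box (j : 'I_(q.+1 ^ n).+1) : {ffun 'I_n -> 'I_q.+1} :=
  [ffun i => inord (Num.truncn (q.+1%:R * fr (j%:R * t 0 i)))].
have tr_lt x : (Num.truncn (q.+1%:R * fr x) < q.+1)%N.
  rewrite -(ltr_nat R); apply: (@le_lt_trans _ _ (q.+1%:R * fr x)).
    by rewrite truncn_le// mulr_ge0// ltW.
  by rewrite -[ltRHS]mulr1 ltr_pM2l.
have [j [k [jk Ejk]]] : exists j k : 'I_(q.+1 ^ n).+1, (j < k)%N /\ box j = box k.
  have /injectivePn[j [k jk E]] : ~~ injectiveb box.
    apply/negP => /injectiveP/leq_card.
    by rewrite card_ffun !card_ord ltnn.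
  have : (j : nat) != k by [].
  by rewrite neq_ltn => /orP[h|h]; [exists j, k|exists k, j].
pose d := (k - j)%N.
have d0 : (0 < d)%N by rewrite subn_gt0.
have dle : (d <= q.+1 ^ n)%N by rewrite (leq_trans (leq_subr _ _))// -ltnS.
pose z : 'rV[R]_n := \row_i ((Num.floor (k%:R * t 0 i))%:~R - (Num.floor (j%:R * t 0 i))%:~R).
have zi i : z 0 i \is a Num.int by rewrite mxE rpredB// intr_int.
pose w := d%:R *: u - z *m b.
have Lw : L w by apply: LB; [apply: LZ => //; exact: natr_int|exact: LM].
have wE : w = (d%:R *: t - z) *m b by rewrite mulmxBl -scalemxAl /t mulmxKV.
have dt i : (d%:R *: t - z) 0 i = fr (k%:R * t 0 i) - fr (j%:R * t 0 i).
  by rewrite !mxE /fr natrB ?(ltnW jk)//; ring.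
have small i : `|(d%:R *: t - z) 0 i| <= q.+1%:R^-1.
  rewrite dt; have := congr1 (fun f : {ffun _ -> _} => f i) Ejk; rewrite !ffunE.
  move=> /(congr1 val); rewrite /= !inordK//.
  move: (fr _) (fr _) (fr0 (k%:R * t 0 i)) (fr0 (j%:R * t 0 i)) => y' x' y'0 x'0 E.
  have xy (x y : R) : 0 <= x -> 0 <= y ->
      Num.truncn (q.+1%:R * x) = Num.truncn (q.+1%:R * y) -> x - y <= q.+1%:R^-1.
    move=> x0 y0 Exy; rewrite -(ler_pM2l Q0) divff ?gt_eqF// mulrBr lerBlDr.
    apply/ltW/(lt_le_trans (truncnS_gt _)).
    rewrite Exy -natr1 addrC lerD2l truncn_le//.
    by rewrite mulr_ge0// ltW.
  rewrite ler_norml; apply/andP; split; last by apply: xy => //; exact/esym.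
  by rewrite lerNl opprB; apply: xy.
have w0 : w = 0.
  apply: He => //; rewrite wE; apply: le_lt_trans qe.
  by apply: rV_mulmx_le => //; rewrite invr_ge0 ltW.
have tz : d%:R *: t = z.
  apply/eqP; rewrite -subr_eq0; apply/eqP.
  by move: w0; rewrite wE => /(congr1 (mulmx^~ (invmx b))); rewrite mulmxK// mul0mx.
have /dvdnP[m ->] : (d %| (q.+1 ^ n)`!)%N by apply: dvdn_fact; rewrite d0.
rewrite natrM -mulrA rpredM ?natr_int//.
by have := zi i0; rewrite -tz mxE.
Qed.

(** Common denominators make [D] integer-valued on invertible matrices with rows in [L], so one of
    them, [c], has minimal [D]. If an element of [L] had a non-integral i-th coordinate in [c], of
    fractional part [s], putting it in row i, reduced modulo that row, would multiply [D] by s <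
    1. *)
Lemma lattice_basis : exists2 P : 'M[R]_n, P \in unitmx &
  forall a : 'rV[R]_n, L (a *m P) <-> forall i, a 0 i \is a Num.int.
Proof.
have [b Lb ub] := lattice_spans.
have [N N0 HN] := lattice_denominator Lb ub.
pose D (c : 'M[R]_n) := `|\det (N%:R *: (c *m invmx b))|.
pose good m := `[< exists c : 'M[R]_n, [/\ forall i, L (row i c), c \in unitmx & D c = m%:R] >].
have Dnat c : (forall i, L (row i c)) -> exists m : nat, D c = m%:R.
  move=> Lc.
  have H i j : N%:R * (c *m invmx b) i j \is a Num.int.
    by have := HN _ (Lc i) j; rewrite -row_mul mxE.
  apply/natrP; apply: natr_norm_int.
  rewrite /determinant; apply: rpred_sum => s _; apply: rpredM.
    by rewrite rpredX// rpredN rpred1.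
  apply: rpred_prod => i _; rewrite mxE.
  exact: H.
have ex : exists m, good m.
  by have [m Dm] := Dnat _ Lb; exists m; apply/asboolP; exists b.
pose m := ex_minn ex.
have [c [Lc uc Dc]] : exists c : 'M[R]_n, [/\ forall i, L (row i c), c \in unitmx & D c = m%:R].
  by apply/asboolP; rewrite /m; case: ex_minnP.
have mmin k : good k -> (m <= k)%N by rewrite /m; case: ex_minnP => ? _; exact.
exists c => // a; split; last exact: LM.
move=> Lac i; apply/negP => /negP ai.
pose s := a 0 i - (Num.floor (a 0 i))%:~R.
have s0 : 0 < s.
  rewrite subr_gt0 lt_neqAle floor_le andbT; apply: contraNneq ai => <-.
  exact: intr_int.
have s1 : s < 1.
  by have := floorD1_gt (a 0 i); rewrite intrD -ltrBlDl.
(* The identity except for row i, which is [a] with its i-th entry replaced by [s]; the expansion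
   along column i gives determinant [s]. *)
pose S : 'M[R]_n := \matrix_(k, l)
  if k == i then a 0 l - (Num.floor (a 0 i))%:~R * (i == l)%:R else (k == l)%:R.
have dS : \det S = s.
  rewrite (expand_det_col _ i) (bigD1 i)//= big1 ?addr0; last first.
    by move=> k ki; rewrite mxE (negbTE ki) mul0r.
  rewrite mxE !eqxx mulr1 /cofactor -signr_odd addnn odd_double mul1r.
  rewrite (_ : row' _ _ = 1%:M) ?det1 ?mulr1//.
  apply/matrixP => k l; rewrite !mxE eq_sym (negbTE (neq_lift _ _)).
  by rewrite (inj_eq lift_inj).
have rS k : row k (S *m c) =
    if k == i then a *m c - (Num.floor (a 0 i))%:~R *: row i c else row k c.
  rewrite row_mul; case: eqP => [->|/eqP ki].
    have -> : row i S = a - (Num.floor (a 0 i))%:~R *: delta_mx 0 i.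
      by apply/rowP => l; rewrite !mxE eqxx /= (eq_sym l).
    by rewrite mulmxBl -scalemxAl -rowE.
  have -> : row k S = delta_mx 0 k.
    by apply/rowP => l; rewrite !mxE (negbTE ki) /= (eq_sym l).
  by rewrite -rowE.
have LS k : L (row k (S *m c)).
  rewrite rS; case: ifP => _; last exact: Lc.
  by apply: LB => //; apply: LZ; [exact: intr_int|exact: Lc].
have uS : S *m c \in unitmx.
  by rewrite unitmx_mul uc andbT unitmxE dS unitfE gt_eqF.
have DS : D (S *m c) = s * D c.
  by rewrite /D -mulmxA !detZ det_mulmx dS mulrCA normrM gtr0_norm.
have [k Dk] := Dnat _ LS.
have mk : (m <= k)%N by apply: mmin; apply/asboolP; exists (S *m c).
have Dc0 : 0 < D c.
  rewrite normr_gt0 detZ det_mulmx det_inv !mulf_neq0//.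
  - by rewrite expf_neq0// pnatr_eq0 -lt0n.
  - by move: uc; rewrite unitmxE unitfE.
  - by rewrite invr_neq0//; move: ub; rewrite unitmxE unitfE.
move: mk; rewrite -(ler_nat R) -Dk DS -Dc leNgt => /negP; apply.
by rewrite -[ltRHS]mul1r ltr_pM2r.
Qed.

End Lattice.

(** * Local estimates for the product *)

Section AxesBound.
Context {R : realType}.

Lemma norm_le_dist (x y e : R) : `|x - y| <= e -> `|y| <= `|x| + e.
Proof. by move=> h; rewrite -lerBlDl (le_trans _ h)// distrC lerB_dist. Qed.

Lemma derive2_le n m (F : 'rV[R]_n * 'rV[R]_m -> R) p c u v : smooth_near F p ->
  (forall i j, `|'D_(delta_mx 0 i, 0) ('D_(0, delta_mx 0 j) F) p| <= c i j) ->
  `|'D_(u, 0) ('D_(0, v) F) p| <= (\sum_i \sum_j c i j) * (`|u| * `|v|).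
Proof.
move=> sF Dc.
have vE : (0, v) = \sum_j v 0 j *: (0, delta_mx 0 j) :> 'rV[R]_n * 'rV[R]_m.
  have -> : \sum_j v 0 j *: (0, delta_mx 0 j) =
      (0, \sum_j v 0 j *: delta_mx 0 j) :> 'rV[R]_n * 'rV[R]_m.
    elim/big_ind2 : _ => // [x1 x2 y1 y2 -> ->|i _].
      by congr (_, _); rewrite /= addr0.
    by congr (_, _); rewrite /= scaler0.
  by congr (_, _); exact: row_sum_delta.
have uE : (u, 0) = \sum_i u 0 i *: (delta_mx 0 i, 0) :> 'rV[R]_n * 'rV[R]_m.
  have -> : \sum_i u 0 i *: (delta_mx 0 i, 0) =
      (\sum_i u 0 i *: delta_mx 0 i, 0) :> 'rV[R]_n * 'rV[R]_m.
    elim/big_ind2 : _ => // [x1 x2 y1 y2 -> ->|i _].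
      by congr (_, _); rewrite /= addr0.
    by congr (_, _); rewrite /= scaler0.
  by congr (_, _); exact: row_sum_delta.
have dF w := smooth_near_differentiable (smooth_near_derive w sF).
have E : 'D_(u, 0) ('D_(0, v) F) p =
    \sum_i \sum_j u 0 i * v 0 j * 'D_(delta_mx 0 i, 0) ('D_(0, delta_mx 0 j) F) p.
  rewrite uE (derivev_sum _ _ (dF (0, v))); apply: eq_bigr => i _.
  rewrite (derivevZ _ _ (dF (0, v))).
  have -> : 'D_(delta_mx 0 i, 0) ('D_(0, v) F) p =
      'D_(delta_mx 0 i, 0) (\sum_j v 0 j *: 'D_(0, delta_mx 0 j) F) p.
    apply: near_eq_derive; apply: filterS (smooth_near_near sF) => q.
    move=> /smooth_near_differentiable dq.
    rewrite vE (derivev_sum _ _ dq) fct_sumE; apply: eq_bigr => j _.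
    by rewrite (derivevZ _ _ dq).
  rewrite derive_sum; last first.
    by move=> j; apply: derivableZ; apply: diff_derivable; exact: dF.
  rewrite scaler_sumr; apply: eq_bigr => j _.
  rewrite deriveZ; last by apply: diff_derivable; exact: dF.
  by rewrite [LHS]mulrA.
rewrite E (le_trans (ler_norm_sum _ _ _))// mulr_suml; apply: ler_sum => i _.
rewrite (le_trans (ler_norm_sum _ _ _))// mulr_suml; apply: ler_sum => j _.
rewrite !normrM mulrC ler_pM ?mulr_ge0//.
by apply: ler_pM => //; exact: rV_coord_le_norm.
Qed.

(** [mvt_axes] expresses F(u, v) as a mixed derivative at an intermediate point; it is bilinear in
    [u] and [v], with coefficients bounded near 0. *)
Lemma axes_bound1 n m (F : 'rV[R]_n * 'rV[R]_m -> R) : smooth_near F (0, 0) ->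
  (\forall w \near (0 : 'rV[R]_n), F (w, 0) = 0) ->
  (\forall z \near (0 : 'rV[R]_m), F (0, z) = 0) ->
  exists2 C : R, 0 <= C & exists2 r : R, 0 < r &
    forall u v, `|u| < r -> `|v| < r -> `|F (u, v)| <= C * (`|u| * `|v|).
Proof.
move=> sF F1 F2.
pose D i j := 'D_(delta_mx 0 i, 0) ('D_(0, delta_mx 0 j) F).
pose c i j : R := `|D i j (0, 0)| + 1.
have N : \forall p \near ((0, 0) : 'rV[R]_n * 'rV[R]_m), forall i j, `|D i j p| <= c i j.
  apply: (@filter_forall _ _ (fun i => [set p | forall j, `|D i j p| <= c i j])
    (nbhs ((0, 0) : 'rV[R]_n * 'rV[R]_m)) (nbhs_filter _)) => i.
  apply: (@filter_forall _ _ (fun j => [set p | `|D i j p| <= c i j])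
    (nbhs ((0, 0) : 'rV[R]_n * 'rV[R]_m)) (nbhs_filter _)) => j.
  have cD := smooth_near_continuous (smooth_near_derive (delta_mx 0 i, 0)
    (smooth_near_derive (0, delta_mx 0 j) sF)).
  have : \forall z \near ((0, 0) : 'rV[R]_n * 'rV[R]_m), `|D i j (0, 0) - D i j z| <= 1.
    by move: cD => /cvgr_dist_le/(_ 1 ltr01).
  apply: filterS => z h; exact: norm_le_dist h.
have [r1 r10 H1] := near_box (filterI (smooth_near_near sF) N).
have /nbhs_ballP[r2 /= r20 H2] := F1.
have /nbhs_ballP[r3 /= r30 H3] := F2.
exists (\sum_i \sum_j c i j).
  by apply: sumr_ge0 => i _; apply: sumr_ge0 => j _; rewrite addr_ge0.
exists (Num.min r1 (Num.min r2 r3)); first by rewrite !lt_min r10 r20 r30.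
move=> u v; rewrite !lt_min => /andP[u1 /andP[u2 u3]] /andP[v1 /andP[v2 v3]].
have [|||s [t [s01 t01 E]]] := @mvt_axes _ _ _ F 0 0 u v.
- move=> s t s01 t01.
  by have [] := H1 (s *: u) (t *: v) (segment_lt s01 u1) (segment_lt t01 v1).
- move=> s s01; rewrite add0r; apply: H2; rewrite -ball_normE /= sub0r normrN.
  exact: segment_lt.
- move=> s s01; rewrite add0r; apply: H3; rewrite -ball_normE /= sub0r normrN.
  exact: segment_lt.
have [sp Dp] := H1 (s *: u) (t *: v) (segment_lt s01 u1) (segment_lt t01 v1).
by rewrite -[in F (u, v)](add0r u) -[in F (_, v)](add0r v) E; exact: derive2_le sp Dp.
Qed.

Lemma axes_bound n m k (F : 'rV[R]_n * 'rV[R]_m -> 'rV[R]_k) : smooth_near F (0, 0) ->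
  (\forall w \near (0 : 'rV[R]_n), F (w, 0) = 0) ->
  (\forall z \near (0 : 'rV[R]_m), F (0, z) = 0) ->
  exists2 C : R, 0 <= C & exists2 r : R, 0 < r &
    forall u v, `|u| < r -> `|v| < r -> `|F (u, v)| <= C * (`|u| * `|v|).
Proof.
move=> sF F1 F2.
have /choice[C HC] : forall i, exists C : R, 0 <= C /\ exists2 r : R, 0 < r &
    forall u v, `|u| < r -> `|v| < r -> `|F (u, v) 0 i| <= C * (`|u| * `|v|).
  move=> i; have [|||C C0 H] := @axes_bound1 _ _ (fun p => F p 0 i).
  - exact: smooth_near_coord.
  - by apply: filterS F1 => w ->; rewrite mxE.
  - by apply: filterS F2 => w ->; rewrite mxE.
  by exists C.
exists (\sum_i C i); first by apply: sumr_ge0 => i _; have [] := HC i.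
(* A radius common to all coordinates, as a finite intersection of neighbourhoods of 0 on the
   right. *)
have : \forall r \near (0 : R)^'+, forall i u v, `|u| < r -> `|v| < r ->
    `|F (u, v) 0 i| <= C i * (`|u| * `|v|).
  apply: (@filter_forall _ _ (fun i => [set r | forall u v, `|u| < r -> `|v| < r ->
    `|F (u, v) 0 i| <= C i * (`|u| * `|v|)])) => i; have [_ [r r0 H]] := HC i.
  have : \forall s \near (0 : R)^'+, s < r by exact: nbhs_right_lt.
  by apply: filterS => s sr u v us vs; apply: H; exact: lt_trans sr.
have p0 : \forall r \near (0 : R)^'+, 0 < r by exact: nbhs_right_gt.
move=> /(filterI p0)/filter_ex[r [r0 H]]; exists r => // u v ur vr.
apply: rV_norm_le => [|i].
  by rewrite mulr_ge0// ?mulr_ge0// sumr_ge0// => i _; have [] := HC i.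
rewrite (le_trans (H i u v ur vr))// ler_wpM2r ?mulr_ge0//.
by rewrite (bigD1 i)//= lerDl sumr_ge0// => j _; have [] := HC j.
Qed.

End AxesBound.

(** * The group law in coordinates centred at 1 *)

Section LocalGroup.
Context {R : realType} {n : nat} {G : lieGroupType R n}.
Local Notation phi := (chart_at (1%g : G)).
Local Notation z0 := (chart_map phi (1%g : G)).
Local Notation inv1 := (chart_inv phi).

Definition coord1 (x : G) : 'rV[R]_n := chart_map phi x - z0.

(** The domain is part of the condition because [chart_map] has arbitrary values outside it. *)
Definition small (r : R) (x : G) := chart_dom phi x /\ `|coord1 x| <= r.

Lemma coord1K x : chart_dom phi x -> inv1 (z0 + coord1 x) = x.
Proof. by move=> dx; rewrite /coord1 addrC subrK chart_mapK. Qed.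

Lemma coord1_1 : coord1 1%g = 0.
Proof. by rewrite /coord1 subrr. Qed.

Lemma small1 r : 0 <= r -> small r 1%g.
Proof. by split; [exact: chart1_dom|rewrite coord1_1 normr0]. Qed.

Lemma small_le r s x : r <= s -> small r x -> small s x.
Proof. by move=> rs [dx xr]; split=> //; exact: le_trans rs. Qed.

Lemma small_nbhs r : 0 < r -> nbhs (1%g : G) (small r).
Proof.
move=> r0; apply: filterI; first exact/chart_dom_nbhs/chart1_dom.
have := chart_map_continuous (chart1_dom (G := G)); move=> /cvgr_dist_le/(_ r r0).
by apply: filterS => x; rewrite distrC.
Qed.

Lemma nbhs_small (P : G -> Prop) : nbhs (1%g : G) P ->
  exists2 r, 0 < r & forall x, small r x -> P x.
Proof.
move=> NP; have ci : {for z0, continuous (inv1 : _ -> G)}.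
  exact/chart_inv_continuous/chart_imgP/chart1_dom.
have : \forall z \near z0, P (inv1 z) by apply: ci; rewrite chart1_inv.
move=> /nbhs_ballP[r /= r0 H]; exists (r / 2); first by rewrite divr_gt0.
move=> x [dx xr]; rewrite -(chart_mapK dx); apply: H.
rewrite -ball_normE /= distrC (le_lt_trans xr)// ltr_pdivrMr// ltr_pMr//.
by rewrite ltr1n.
Qed.

Lemma chart1_img_near : exists2 r : R, 0 < r & forall u, `|u| <= r -> chart_img phi (z0 + u).
Proof.
have /nbhs_ballP[r /= r0 H] := chart_img_nbhs (chart1_dom (G := G)).
exists (r / 2) => [|u ur]; first by rewrite divr_gt0.
apply: H; rewrite -ball_normE /= opprD addNKr normrN (le_lt_trans ur)//.
by rewrite ltr_pdivrMr// ltr_pMr// ltr1n.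
Qed.

(** [axes_bound] for the difference between the product and the sum, which vanishes when either
    factor is 1. *)
Lemma coord1_mul_le : exists2 C : R, 0 <= C & exists2 r : R, 0 < r &
  forall x y, small r x -> small r y -> chart_dom phi (x * y)%g /\
    `|coord1 (x * y)%g - (coord1 x + coord1 y)| <= C * (`|coord1 x| * `|coord1 y|).
Proof.
pose p (z : 'rV[R]_n * 'rV[R]_n) : G := (inv1 (z0 + z.1) * inv1 (z0 + z.2))%g.
pose F z := coord1 (p z) - (z.1 + z.2).
have s1 : smooth_into_near (fun z : 'rV[R]_n * 'rV[R]_n => inv1 (z0 + z.1) : G) (0, 0).
  apply: (@smooth_into_near_comp _ _ _ _ _ (fun z : 'rV[R]_n * 'rV[R]_n => z0 + z.1)).
  - exact: framed_rV.
  - by apply: smooth_nearD; [exact: smooth_near_cst|exact: smooth_near_fst].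
  - by rewrite /= addr0; exact: smooth_into_near_inv1.
have s2 : smooth_into_near (fun z : 'rV[R]_n * 'rV[R]_n => inv1 (z0 + z.2) : G) (0, 0).
  apply: (@smooth_into_near_comp _ _ _ _ _ (fun z : 'rV[R]_n * 'rV[R]_n => z0 + z.2)).
  - exact: framed_rV.
  - by apply: smooth_nearD; [exact: smooth_near_cst|exact: smooth_near_snd].
  - by rewrite /= addr0; exact: smooth_into_near_inv1.
have sp : smooth_into_near p (0, 0) by exact: smooth_into_near_mul.
have p0 : p (0, 0) = 1%g by rewrite /p /= addr0 chart1_inv mulg1.
have sF : smooth_near F (0, 0).
  apply: smooth_nearD.
    apply: smooth_nearD; last exact: smooth_near_cst.
    by have [_] := sp; apply; [exact: chart1_atlas|rewrite p0; exact: chart1_dom].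
  apply: (@smooth_near_linear _ _ _ (fun z : 'rV[R]_n * 'rV[R]_n => - (z.1 + z.2))).
    by move=> a u v /=; rewrite scalerN scalerDr -opprD addrACA.
  by move=> z; apply: cvgN; apply: cvgD; [exact: cvg_fst|exact: cvg_snd].
have [rc rc0 Hc] := chart1_img_near.
have Nc : \forall w \near (0 : 'rV[R]_n), chart_img phi (z0 + w).
  apply/nbhs_ballP; exists rc => //= w; rewrite -ball_normE /= sub0r normrN => /ltW.
  exact: Hc.
have [|||C C0 [r r0 H]] := @axes_bound _ _ _ _ F.
- exact: sF.
- apply: filterS Nc => w wi; rewrite /F /p /= !addr0 chart1_inv mulg1 /coord1.
  by rewrite chart_invK// (addrC z0) addrK subrr.
- apply: filterS Nc => w wi; rewrite /F /p /= addr0 add0r chart1_inv mul1g /coord1.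
  by rewrite chart_invK// (addrC z0) addrK subrr.
have [rd rd0 Hd] : exists2 rd, 0 < rd & forall x y, small rd x -> small rd y ->
    chart_dom phi (x * y)%g.
  have := @mul_continuous R n G (1%g, 1%g); rewrite /continuous_at /= mulg1.
  move=> /(_ _ (chart_dom_nbhs chart1_dom)) [[P Q] /= [P1 Q1] PQ].
  have [r1 r10 H1] := nbhs_small P1; have [r2 r20 H2] := nbhs_small Q1.
  exists (Num.min r1 r2) => [|x y sx sy]; first by rewrite lt_min r10 r20.
  apply: (PQ (x, y)); split; [apply: H1|apply: H2].
    by apply: small_le sx; rewrite ge_min lexx.
  by apply: small_le sy; rewrite ge_min lexx orbT.
exists C => //; exists (Num.min (r / 2) rd); first by rewrite lt_min divr_gt0.
have r2 : r / 2 < r by rewrite ltr_pdivrMr// ltr_pMr// ltr1n.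
move=> x y [dx]; rewrite le_min => /andP[x1 x2] [dy]; rewrite le_min => /andP[y1 y2].
split; first by apply: Hd.
have := H (coord1 x) (coord1 y) (le_lt_trans x1 r2) (le_lt_trans y1 r2).
by rewrite /F /p /= !coord1K.
Qed.

Lemma local_estimates : exists r C : R, [/\ 0 < r, 0 <= C /\ C * r <= 1,
  forall u, `|u| <= r -> chart_img phi (z0 + u),
  forall x y, small r x -> small r y -> chart_dom phi (x * y)%g /\
    `|coord1 (x * y)%g - (coord1 x + coord1 y)| <= C * (`|coord1 x| * `|coord1 y|) &
  forall x, small r x -> chart_dom phi (x^-1)%g /\
    `|coord1 (x^-1)%g + coord1 x| <= C * (`|coord1 x| * `|coord1 x|)].
Proof.
have [C C0 [r1 r10 H1]] := coord1_mul_le.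
have [r2 r20 H2] := chart1_img_near.
(* This gives C s <= 1/2. Then the bound for x x^-1 = 1 shows that the inverse at most doubles the
   norm of the coordinate, and its error is at most 2C times the square of that norm; hence the
   final constant 2C. *)
pose s := Num.min r1 (2 * C + 1)^-1.
have C1 : 0 < 2 * C + 1 by rewrite ltr_wpDl// mulr_ge0.
have s0 : 0 < s by rewrite lt_min r10 invr_gt0.
have sC : C * s <= 2^-1.
  rewrite (@le_trans _ _ (C * (2 * C + 1)^-1))//.
    by rewrite ler_wpM2l// ge_min lexx orbT.
  rewrite ler_pdivrMr// mulrDr mulr1 mulKf//.
  by rewrite lerDl invr_ge0.
have ss : s <= r1 by rewrite ge_min lexx.
clearbody s.
have [r3 r30 H3] : exists2 r, 0 < r & forall x, small r x -> small s (x^-1)%g.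
  apply: nbhs_small; have := @inv_continuous R n G 1%g; rewrite /continuous_at invg1.
  exact: (fun h => h _ (small_nbhs s0)).
pose r := Num.min (Num.min s r2) r3.
have rs : r <= s by rewrite !ge_min lexx.
exists r, (2 * C); split.
- by rewrite !lt_min s0 r20 r30.
- split; first by rewrite mulr_ge0.
  rewrite -mulrA -ler_pdivlMl// mulr1 (le_trans _ sC)// ler_wpM2l//.
- by move=> u ur; apply: H2; apply: le_trans ur _; rewrite !ge_min lexx orbT.
- move=> x y sx sy; have rr1 : r <= r1.
    exact: le_trans ss.
  have [d h] := H1 x y (small_le rr1 sx) (small_le rr1 sy); split=> //.
  apply: le_trans h _; rewrite ler_wpM2r ?mulr_ge0//.
  by rewrite ler_peMl// ler1n.
move=> x sx.
have [dV xV] : small s (x^-1)%g by apply: H3; apply: small_le sx; rewrite ge_min lexx orbT.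
split=> //.
have [_ h] := H1 x (x^-1)%g (small_le (le_trans rs ss) sx) (small_le ss (conj dV xV)).
move: h; rewrite mulgV coord1_1 sub0r normrN => h.
have Cx : C * `|coord1 x| <= 2^-1.
  apply: le_trans sC; rewrite ler_wpM2l//; have [_ xr] := sx; exact: le_trans rs.
have h2 : `|coord1 (x^-1)%g| <= 2 * `|coord1 x|.
  have : `|coord1 (x^-1)%g| <= `|coord1 x| + 2^-1 * `|coord1 (x^-1)%g|.
    rewrite -lerBlDl; apply: le_trans (lerB_normD _ _) _.
    rewrite addrC (le_trans h)// mulrA ler_wpM2r//.
  lra.
rewrite addrC (le_trans h)// -mulrA [2 * _]mulrC -!mulrA ler_wpM2l// ler_wpM2l//.
by rewrite mulrC.
Qed.

End LocalGroup.

(** * The exponential map of a compact commutative group *)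

Lemma ultra_fmap (T V : Type) (f : T -> V) (F : set_system T) :
  UltraFilter F -> UltraFilter (f @ F).
Proof.
move=> FU; have FP : ProperFilter F := @ultra_proper _ _ FU.
split; first exact: fmap_proper_filter.
move=> H HP FH; apply/seteqP; split=> [A HA|]; last exact: FH.
have [//|FA] := in_ultra_setVsetC (f @^-1` A) FU.
have HnA : H (~` A) by apply: FH; rewrite /fmap /= preimage_setC.
by have [x []] := filter_ex (filterI HA HnA).
Qed.

(** * Convergence of dyadic powers *)

Section LocalPowers.
Context {R : realType} {n : nat} {G : lieGroupType R n}.
Local Notation phi := (chart_at (1%g : G)).
Local Notation z0 := (chart_map phi (1%g : G)).
Local Notation inv1 := (chart_inv phi).
Local Notation small := (@small R n G).
Local Notation N x := `|coord1 x|.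

(** It is the image of a compact ball in a Hausdorff space. Closedness lets estimates pass to the
    limit. *)
Lemma small_closed r : (forall u, `|u| <= r -> chart_img phi (z0 + u)) ->
  closed (small r).
Proof.
move=> Hr; pose A : set 'rV[R]_n := [set z | `|z - z0| <= r].
have cA : compact A.
  apply: bounded_closed_compact.
    exists (`|z0| + r); split; first exact: num_real.
    move=> M Mr z Az; apply: le_trans (ltW Mr).
    by rewrite -lerBlDl; apply: le_trans Az; exact: lerB_dist.
  apply: (@preimage_closed _ _ (fun z : 'rV[R]_n => `|z - z0|) [set x | x <= r]);
    last exact: closed_le.
  move=> z _; apply: (@continuous_comp _ _ _ (fun z : 'rV[R]_n => z - z0)
    (fun z : 'rV[R]_n => `|z|)); last exact: norm_continuous.
  apply: smooth_near_continuous.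
  by apply: smooth_nearD; [exact: smooth_near_id|exact: smooth_near_cst].
have iA z : A z -> chart_img phi z.
  by move=> Az; have := Hr _ Az; rewrite addrC subrK.
have -> : small r = inv1 @` A.
  apply/seteqP; split=> [x [dx xr]|_ [z Az <-]].
    by exists (chart_map phi x) => //; exact: chart_mapK.
  by split; [exact/chart_inv_dom/iA|rewrite /coord1 chart_invK//; exact: iA].
apply: compact_closed; first exact: manifold_hausdorff.
apply: continuous_compact cA; apply: continuous_in_subspaceT => z /set_mem Az.
exact/chart_inv_continuous/iA.
Qed.

Variables r C : R.
Hypothesis r0 : 0 < r.
Hypothesis C0 : 0 <= C.
Hypothesis Cr : C * r <= 1.
Hypothesis Himg : forall u, `|u| <= r -> chart_img phi (z0 + u).
Hypothesis Hmul : forall x y, small r x -> small r y -> chart_dom phi (x * y)%g /\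
    `|coord1 (x * y)%g - (coord1 x + coord1 y)| <= C * (N x * N y).
Hypothesis Hinv : forall x, small r x -> chart_dom phi (x^-1)%g /\
    `|coord1 (x^-1)%g + coord1 x| <= C * (N x * N x).

Lemma small_C x : small r x -> C * N x <= 1.
Proof. by move=> [_ xr]; apply: le_trans Cr; rewrite ler_wpM2l. Qed.

(** Only the second factor is doubled. In a product built one factor at a time the accumulated part
    keeps coefficient 1, so that sizes grow linearly and not geometrically. *)
Lemma small_mul x y : small r x -> small r y -> small (N x + 2 * N y) (x * y)%g.
Proof.
move=> sx sy; have [d h] := Hmul sx sy; split=> //.
have Cx := small_C sx.
have h1 : C * (N x * N y) <= N y by rewrite mulrA ler_piMl.
have h2 := ler_normD (coord1 x) (coord1 y).
have := lerB_dist (coord1 (x * y)%g) (coord1 x + coord1 y).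
lra.
Qed.

Lemma small_inv x : small r x -> small (2 * N x) (x^-1)%g.
Proof.
move=> sx; have [d h] := Hinv sx; split=> //.
have Cx := small_C sx.
have h1 : C * (N x * N x) <= N x by rewrite mulrA ler_piMl.
have := lerB_normD (coord1 (x^-1)%g) (coord1 x).
lra.
Qed.

Lemma small_exp m x : chart_dom phi x -> 2 * m%:R * N x <= r ->
  small (2 * m%:R * N x) (x ^+ m)%g.
Proof.
move=> dx; elim: m => [|m IH] mr.
  by rewrite expg0; apply: small1; rewrite mulr0 mul0r.
have m0 : 0 <= m%:R :> R by [].
have nx : 0 <= N x by [].
have mN : 0 <= m%:R * N x by exact: mulr_ge0.
have E : 2 * m.+1%:R * N x = 2 * m%:R * N x + 2 * N x by rewrite -natr1; ring.
have mr' : 2 * m%:R * N x <= r by lra.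
have xr : N x <= r by lra.
have sm := IH mr'; rewrite expgSr.
have [d h] := small_mul (small_le mr' sm) (conj dx xr).
by split=> //; rewrite E (le_trans h)// lerD2r; have [] := sm.
Qed.

Definition exp1 (u : 'rV[R]_n) : G := inv1 (z0 + u).

Lemma exp1_coord u : `|u| <= r -> coord1 (exp1 u) = u.
Proof. by move=> /Himg iu; rewrite /coord1 /exp1 chart_invK// (addrC z0) addrK. Qed.

Lemma exp1_small u : `|u| <= r -> small r (exp1 u).
Proof.
move=> ur; split; last by rewrite exp1_coord.
exact/chart_inv_dom/Himg.
Qed.

(** Measures how far the inverse chart [exp1] is from a homomorphism. *)
Definition defect u v : G := (exp1 (u + v) * (exp1 u * exp1 v)^-1)%g.

Lemma defect_small s (u v : 'rV[R]_n) : 8 * s <= r -> `|u| <= s -> `|v| <= s ->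
  small (22 * C * s ^+ 2) (defect u v).
Proof.
move=> sr us vs.
have s0 : 0 <= s by exact: le_trans us.
have sr' : s <= r by lra.
have su := exp1_small (le_trans us sr'); have sv := exp1_small (le_trans vs sr').
have [dw hw] := Hmul su sv.
rewrite (exp1_coord (le_trans us sr')) (exp1_coord (le_trans vs sr')) in hw.
set w := (exp1 u * exp1 v)%g in dw hw *.
have Cs : C * s <= 1.
  by apply: le_trans Cr; rewrite ler_wpM2l.
have uv : `|u| * `|v| <= s ^+ 2 by rewrite expr2 ler_pM.
have Cuv : C * (`|u| * `|v|) <= C * s ^+ 2 by rewrite ler_wpM2l.
have Cs2 : C * s ^+ 2 <= s by rewrite expr2 mulrA ler_piMl.
have n2 := ler_normD u v.
have Nw : N w <= 3 * s.
  by have := lerB_dist (coord1 w) (u + v); lra.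
have sw : small r w by split=> //; lra.
have [dwV hwV] := Hinv sw.
have [_ NwV] := small_inv sw.
have swV : small r (w^-1)%g by split=> //; lra.
have uvr : `|u + v| <= r by lra.
have [d h] := Hmul (exp1_small uvr) swV.
rewrite (exp1_coord uvr) in h.
split=> //.
have w2 : N w * N w <= 9 * s ^+ 2.
  have := ler_pM (normr_ge0 (coord1 w)) (normr_ge0 (coord1 w)) Nw Nw.
  by move=> /le_trans; apply; rewrite le_eqVlt; apply/orP; left; apply/eqP; ring.
have Cw2 : C * (N w * N w) <= C * (9 * s ^+ 2) by rewrite ler_wpM2l.
have uvw : `|u + v| * N (w^-1)%g <= 12 * s ^+ 2.
  have a : `|u + v| <= 2 * s by lra.
  have b : N (w^-1)%g <= 6 * s by lra.
  have := ler_pM (normr_ge0 _) (normr_ge0 _) a b.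
  by move=> /le_trans; apply; rewrite le_eqVlt; apply/orP; left; apply/eqP; ring.
have Cuvw : C * (`|u + v| * N (w^-1)%g) <= C * (12 * s ^+ 2) by rewrite ler_wpM2l.
have t : `|u + v + coord1 (w^-1)%g| <= `|coord1 w - (u + v)| + `|coord1 (w^-1)%g + coord1 w|.
  rewrite -[X in X <= _]normrN.
  have -> : - (u + v + coord1 (w^-1)%g) = (coord1 w - (u + v)) - (coord1 (w^-1)%g + coord1 w).
    move: (coord1 (w^-1)%g) (coord1 w) (u + v) => c b a.
    by rewrite (opprD a) (opprD c) [- c - b]addrC addrACA subrr add0r.
  exact: ler_normB.
have := lerB_dist (coord1 (exp1 (u + v) * w^-1)%g) (u + v + coord1 (w^-1)%g).
rewrite /defect -/w.
(* The three errors: 1 for the product [w], 9 for its inversion since N w <= 3s, and 12 for the last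
   product, of factors of size at most 2s and 6s. *)
have -> : 22 * C * s ^+ 2 = C * s ^+ 2 + C * (9 * s ^+ 2) + C * (12 * s ^+ 2) by ring.
lra.
Qed.

Hypothesis G_comm : forall x y : G, (x * y = y * x)%g.

(* These converge, as k grows, to the value at u of the exponential map; an
   ultrafilter on k and the compactness of G spare the Cauchy estimate. *)
Definition dyadic_power (u : 'rV[R]_n) (k : nat) : G :=
  (exp1 ((2 ^- k) *: u) ^+ (2 ^ k))%g.

Let half_pow_gt0 k : 0 < (2 : R) ^- k.
Proof. by rewrite invr_gt0 exprn_gt0. Qed.

(** At scale 2^-k the defect is quadratic, of order 4^-k; its 2^k-th power grows at most linearly,
    which leaves order 2^-k. The constant 44 is twice 22, by [small_exp]. *)
Lemma defect_power k (u v : 'rV[R]_n) s : `|u| <= s -> `|v| <= s ->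
  8 * s * 2 ^- k <= r -> 44 * C * s ^+ 2 * 2 ^- k <= r ->
  small (44 * C * s ^+ 2 * 2 ^- k)
    (defect ((2 ^- k) *: u) ((2 ^- k) *: v) ^+ (2 ^ k))%g.
Proof.
move=> us vs sr sr2; have p0 := half_pow_gt0 k; have p0' := ltW p0.
have Z (w : 'rV[R]_n) : `|w| <= s -> `|(2 ^- k) *: w| <= s * 2 ^- k.
  by move=> ws; rewrite normrZ ger0_norm// mulrC ler_wpM2r.
have sr' : 8 * (s * 2 ^- k) <= r by rewrite mulrA.
have [d h] := defect_small sr' (Z _ us) (Z _ vs).
have h2 : 2 * (2 ^ k)%:R * N (defect ((2 ^- k) *: u) ((2 ^- k) *: v)) <= 44 * C * s ^+ 2 * 2 ^- k.
  apply: (@le_trans _ _ (2 * (2 ^ k)%:R * (22 * C * (s * 2 ^- k) ^+ 2))).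
    by rewrite ler_wpM2l// mulr_ge0.
  rewrite le_eqVlt; apply/orP; left; apply/eqP; rewrite natrX.
  have k0 : (2 : R) ^+ k != 0 by rewrite expf_neq0.
  by field.
exact: small_le h2 (small_exp d (le_trans h2 sr2)).
Qed.

(** Commutativity distributes the power over the product of the defect and the two factors. *)
Lemma dyadic_powerD u v k :
  dyadic_power (u + v) k =
  (defect ((2 ^- k) *: u) ((2 ^- k) *: v) ^+ (2 ^ k) *
    (dyadic_power u k * dyadic_power v k))%g.
Proof.
have cm x y : commute x y := G_comm x y.
rewrite /dyadic_power -!expgMn//; congr (_ ^+ _)%g.
by rewrite /defect scalerDr -mulgA mulVg mulg1.
Qed.

Lemma dyadic_powerS u k : dyadic_power u k =
  (defect ((2 ^- k) *: (2^-1 *: u)) ((2 ^- k) *: (2^-1 *: u)) ^+ (2 ^ k) *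
    dyadic_power u k.+1)%g.
Proof.
have h2 : 2^-1 + 2^-1 = 1 :> R by field.
have uE : u = 2^-1 *: u + 2^-1 *: u by rewrite -scalerDl h2 scale1r.
rewrite {1}uE dyadic_powerD; congr (_ * _)%g.
have cm x y : commute x y := G_comm x y.
rewrite /dyadic_power -expgnDr addnn -mul2n -expnS scalerA.
by rewrite exprS invfM mulrC.
Qed.

Lemma half_pow_le (a e : R) : 0 < e -> exists k0, forall k, (k0 <= k)%N -> a * 2 ^- k <= e.
Proof.
move=> e0; have am := archi_boundP (normr_ge0 (a / e)).
exists (Num.bound `|a / e|) => k mk.
rewrite ler_pdivrMr ?exprn_gt0// -ler_pdivrMl// mulrC.
apply: le_trans (ler_norm _) _; apply: le_trans (ltW am) _.
rewrite -natrX ler_nat (leq_trans _ (ltnW (ltn_expl k (ltnSn 1))))//.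
Qed.

Let q (u : 'rV[R]_n) k := (exp1 u * (dyadic_power u k)^-1)%g.

(** From k to k + 1, [q u k] is multiplied on the right by a defect power of size at most 11 C |u|^2
    2^-k, which [small_mul] counts twice; the terms 22 C |u|^2 2^-k add up to the stated bound. *)
Lemma dyadic_error (u : 'rV[R]_n) k : 8 * `|u| <= r -> 44 * C * `|u| ^+ 2 <= r ->
  small (44 * C * `|u| ^+ 2 * (1 - 2 ^- k)) (q u k).
Proof.
move=> ur ur2; elim: k => [|k [d h]].
  rewrite expr0 invr1 subrr mulr0 /q /dyadic_power expr0 invr1 scale1r expn0 expg1 mulgV.
  exact: small1.
have n0 := normr_ge0 u.
have s0 : 0 <= C * `|u| ^+ 2 by rewrite mulr_ge0// sqr_ge0.
have p0 := half_pow_gt0 k; have p1 : 2 ^- k <= (1 : R).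
  by rewrite invf_le1 ?exprn_gt0// exprn_ege1// ler1n.
have hu : `|2^-1 *: u| <= `|u| / 2 by rewrite normrZ ger0_norm ?invr_ge0// mulrC.
have E : 44 * C * (`|u| / 2) ^+ 2 * 2 ^- k = 11 * (C * `|u| ^+ 2) * 2 ^- k.
  by field; rewrite expf_neq0.
have b1 : 8 * (`|u| / 2) * 2 ^- k <= r.
  apply: (@le_trans _ _ (8 * (`|u| / 2) * 1)); last by lra.
  by rewrite ler_wpM2l// mulr_ge0// divr_ge0.
have b2 : 44 * C * (`|u| / 2) ^+ 2 * 2 ^- k <= r.
  rewrite E; apply: (@le_trans _ _ (11 * (C * `|u| ^+ 2) * 1)); last by lra.
  by rewrite ler_wpM2l// mulr_ge0.
have [dd hd] := defect_power hu hu b1 b2.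
have sq : small r (q u k).
  split=> //; apply: le_trans h _; apply: le_trans ur2.
  by rewrite ler_piMr ?mulr_ge0// lerBlDr lerDl ltW.
have qS : q u k.+1 =
    (q u k * defect ((2 ^- k) *: (2^-1 *: u)) ((2 ^- k) *: (2^-1 *: u)) ^+ (2 ^ k))%g.
  rewrite /q [in RHS]dyadic_powerS invgM -mulgA; congr (_ * _)%g.
  by rewrite -mulgA mulVg mulg1.
have [d' h'] := small_mul sq (conj dd (le_trans hd b2)).
rewrite qS; split=> //; apply: le_trans h' _.
have -> : 44 * C * `|u| ^+ 2 * (1 - 2 ^- k.+1) =
    44 * C * `|u| ^+ 2 * (1 - 2 ^- k) + 2 * (11 * (C * `|u| ^+ 2) * 2 ^- k).
  by rewrite (exprS 2 k); field; rewrite expf_neq0.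
by rewrite lerD// ler_wpM2l// -E.
Qed.

Hypothesis G_compact : compact [set: G].

(** Additivity holds in the limit because the defect powers tend to 1, and the estimate near 0
    survives because it defines a closed set. *)
Lemma exponential_exists : exists E : 'rV[R]_n -> G,
  (forall u v, E (u + v) = (E u * E v)%g) /\
  (forall u : 'rV[R]_n, 88 * `|u| <= r -> small r (E u) /\
     `|coord1 (E u) - u| <= 176 * C * `|u| ^+ 2).
Proof.
have [U [UU oU]] := ultraFilterLemma (eventually_filter).
have PU : ProperFilter U := @ultra_proper _ _ UU.
have /choice[E HE] : forall u, exists x : G, dyadic_power u @ U --> x.
  move=> u; have cG := G_compact; rewrite compact_ultra in cG.
  have FT : (dyadic_power u @ U) [set: G] by exact: (@filterT _ U).
  by have [x [_ ux]] := cG _ (ultra_fmap (dyadic_power u) UU) FT; exists x.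
have uni := @cvg_unique G (@manifold_hausdorff R n G).
have cvgM (f g : nat -> G) x y : f @ U --> x -> g @ U --> y ->
    (fun k => f k * g k)%g @ U --> (x * y)%g.
  move=> fx gy; have h := @mul_continuous R n G (x, y).
  have h2 : (fun k => (f k, g k)) @ U --> (x, y) by exact: (cvg_pair fx gy).
  exact: (cvg_comp _ _ h2 h).
have cvgV (f : nat -> G) x : f @ U --> x -> (fun k => (f k)^-1)%g @ U --> (x^-1)%g.
  move=> fx; exact: (cvg_comp _ _ fx (@inv_continuous R n G x)).
exists E; split=> [u v|u ur].
  pose s := Num.max `|u| `|v|.
  pose d k := (defect ((2 ^- k) *: u) ((2 ^- k) *: v) ^+ (2 ^ k))%g.
  have d1 : d @ U --> (1%g : G).
    move=> P /nbhs_small[rho rho0 HP]; apply: oU.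
    have e0 : 0 < Num.min r rho by rewrite lt_min r0.
    have [k1 H1] := half_pow_le (8 * s) r0.
    have [k2 H2] := half_pow_le (44 * C * s ^+ 2) e0.
    exists (maxn k1 k2) => // k; rewrite /= geq_max => /andP[kk1 kk2].
    have := H2 k kk2; rewrite le_min => /andP[ha hb].
    apply: HP; apply: small_le hb _; apply: defect_power => //.
    - by rewrite le_max lexx.
    - by rewrite le_max lexx orbT.
    - exact: H1.
  have := cvgM _ _ _ _ d1 (cvgM _ _ _ _ (HE u) (HE v)).
  rewrite mul1g => h; apply: (uni _ _ _ _ (HE (u + v))).
  by apply: cvg_trans h; apply: near_eq_cvg; apply: filterE => k; rewrite dyadic_powerD.
(* The bound of [dyadic_error] made uniform in k. The factor 88 in the hypothesis ensures 2 rho <=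
   r, so that the inverse of [p] below is still small. *)
pose rho := 44 * C * `|u| ^+ 2.
have n0 := normr_ge0 u.
have u1 : `|u| <= r by lra.
have Cu : C * `|u| <= 1 by apply: le_trans Cr; rewrite ler_wpM2l.
have Cu2 : C * `|u| ^+ 2 <= `|u| by rewrite expr2 mulrA ler_piMl.
have rho0 : 0 <= rho by rewrite /rho !mulr_ge0// sqr_ge0.
have rhor : 2 * rho <= r by rewrite /rho -mulrA; lra.
have rhor' : rho <= r by lra.
have cl : closed (small rho) by apply: small_closed => w wr; apply: Himg; lra.
have [dq hq] : small rho (exp1 u * (E u)^-1)%g.
  have h := cvgM _ _ _ _ (@cvg_cst _ (exp1 u) _ U _) (cvgV _ _ (HE u)).
  have Hk : \forall k \near U, small rho (exp1 u * (dyadic_power u k)^-1)%g.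
    apply: filterE => k.
    apply: small_le (dyadic_error k _ _).
    - by rewrite -/rho ler_piMr// lerBlDr lerDl ltW// half_pow_gt0.
    - lra.
    - by rewrite -/rho; lra.
  exact: (@closed_cvg nat G U PU _ (small rho) cl Hk _ (h _)).
set p := (exp1 u * (E u)^-1)%g in dq hq.
have EE : E u = (p^-1 * exp1 u)%g by rewrite /p invgM invgK -mulgA mulVg mulg1.
have sp : small r p by split=> //; lra.
have [dV hV] := small_inv sp.
have spV : small r (p^-1)%g by split=> //; lra.
have su := exp1_small u1.
have [d h] := Hmul spV su.
rewrite EE; rewrite (exp1_coord u1) in h.
have h1 : C * (N (p^-1)%g * `|u|) <= N (p^-1)%g.
  by rewrite mulrCA ler_piMr.
(* The inverse of [p] contributes 2 rho, and the error of its product with [exp1 u] at most 2 rho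
   again; this is the origin of 176 = 4 x 44. *)
have h2 : `|coord1 (p^-1 * exp1 u)%g - u| <= 4 * rho.
  have -> : coord1 (p^-1 * exp1 u)%g - u =
      (coord1 (p^-1 * exp1 u)%g - (coord1 (p^-1)%g + u)) + coord1 (p^-1)%g.
    move: (coord1 (p^-1 * exp1 u)%g) (coord1 (p^-1)%g) => a b.
    by rewrite opprD [- b - u]addrC -addrA subrK.
  have := ler_normD (coord1 (p^-1 * exp1 u)%g - (coord1 (p^-1)%g + u)) (coord1 (p^-1)%g).
  lra.
have h3 : 4 * rho = 176 * C * `|u| ^+ 2 by rewrite /rho; ring.
split; last by rewrite -h3.
split=> //.
have := lerB_dist (coord1 (p^-1 * exp1 u)%g) u.
have h4 : 88 * (C * `|u| ^+ 2) <= `|u|.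
  have -> : 88 * (C * `|u| ^+ 2) = C * (88 * `|u|) * `|u| by ring.
  by rewrite ler_piMl//; apply: le_trans Cr; rewrite ler_wpM2l.
have h5 : 4 * rho = 2 * (88 * (C * `|u| ^+ 2)) by rewrite /rho; ring.
lra.
Qed.

End LocalPowers.

(** * Smoothness, surjectivity and kernel of the exponential *)

Section Exponential.
Context {R : realType} {n : nat} {G : lieGroupType R n}.
Local Notation phi := (chart_at (1%g : G)).
Local Notation z0 := (chart_map phi (1%g : G)).
Local Notation inv1 := (chart_inv phi).
Local Notation small := (@small R n G).
Local Notation N x := `|coord1 x|.

Variables (E : 'rV[R]_n -> G) (e K : R).
Hypothesis e0 : 0 < e.
Hypothesis Ke : 2 * (K * e) <= 1.
Hypothesis K0 : 0 <= K.
Hypothesis ED : forall u v, E (u + v) = (E u * E v)%g.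
Hypothesis Esmall : forall u, `|u| <= e -> chart_dom phi (E u) /\
  `|coord1 (E u) - u| <= K * `|u| ^+ 2.

Lemma exp_coord_le u : `|u| <= e ->
  small (2 * `|u|) (E u) /\ 2 * `|coord1 (E u) - u| <= `|u|.
Proof.
move=> ue; have [d h] := Esmall ue; have n0 := normr_ge0 u.
have h1 : 2 * (K * `|u| ^+ 2) <= `|u|.
  rewrite expr2 !mulrA ler_piMl// -mulrA; apply: le_trans Ke.
  by rewrite ler_wpM2l// ler_wpM2l.
have := lerB_dist (coord1 (E u)) u.
by split; [split=> //|]; lra.
Qed.

Lemma exp0 : E 0 = 1%g.
Proof. by have := ED 0 0; rewrite addr0 -{1}[E 0]mulg1 => /mulgI. Qed.

Lemma expN u : E (- u) = (E u)^-1%g.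
Proof. by apply: (mulgI (E u)); rewrite -ED subrr exp0 mulgV. Qed.

Lemma exp_continuous : continuous E.
Proof.
have c0 : {for 0, continuous E}.
  move=> P; rewrite exp0 => /nbhs_small[rho rho0 HP].
  apply/nbhs_ballP; exists (Num.min e (rho / 2)) => /=.
    by rewrite lt_min e0 divr_gt0.
  move=> u; rewrite -ball_normE /= sub0r normrN lt_min => /andP[/ltW ue ur].
  have [s _] := exp_coord_le ue.
  by apply: HP; apply: (small_le _ s); lra.
move=> u.
have -> : E = (fun u' => (E u * E (u' - u))%g).
  by apply/funext => u'; rewrite -ED addrC subrK.
apply: continuous_mul; first exact: cst_continuous.
apply: (@continuous_comp _ _ _ (fun u' : 'rV[R]_n => u' - u) E); last by rewrite subrr.
apply: smooth_near_continuous.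
by apply: smooth_nearD; [exact: smooth_near_id|exact: smooth_near_cst].
Qed.

(** The quadratic error makes the identity the differential at 0. *)
Lemma exp_differentiable0 : differentiable (coord1 \o E) 0 /\
  forall v, 'D_v (coord1 \o E) 0 = v.
Proof.
have il : linear (id : 'rV[R]_n -> 'rV[R]_n) by [].
have [d dE] : differentiable (coord1 \o E) 0 /\
    'd (coord1 \o E) 0 = linear_pack il :> (_ -> _).
  apply: differentiable_near; first by move=> x; exact: cvg_id.
  move=> a a0; apply/nbhs_ballP.
  exists (Num.min e (a / (K + 1))) => /=.
    by rewrite lt_min e0 divr_gt0// ltr_wpDl.
  move=> u; rewrite -ball_normE /= sub0r normrN lt_min => /andP[/ltW ue ur].
  have [_ h] := Esmall ue; rewrite addr0 exp0 coord1_1 subr0.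
  apply: le_trans h _; rewrite expr2 mulrA ler_wpM2r//.
  move: ur; rewrite ltr_pdivlMr ?ltr_wpDl// => ur.
  have := normr_ge0 u; rewrite mulrDr mulr1 in ur; lra.
by split=> // v; rewrite deriveE// dE.
Qed.

(* E intertwines D_v with the left invariant field v, so it is as smooth as
   the functions it is composed with. *)
Lemma exp_derive (V : normedModType R) (f : G -> V) u v : smooth_at f (E u) ->
  differentiable (f \o E) u /\ 'D_v (f \o E) u = left_derive v f (E u).
Proof.
move=> sf; pose g z := f (E u * inv1 z)%g.
pose t (w : 'rV[R]_n) := w - u; pose q (w : 'rV[R]_n) := coord1 (E w) + z0.
have st : smooth_near t u.
  by apply: smooth_nearD; [exact: smooth_near_id|exact: smooth_near_cst].
have dt := smooth_near_differentiable st.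
have tu : t u = 0 by rewrite /t subrr.
have Dt : 'D_v t u = v.
  have du := smooth_near_differentiable (smooth_near_id u).
  rewrite /t deriveD; [|exact: diff_derivable|exact: derivable_cst].
  by rewrite derive_id derive_cst addr0.
have [dE DE] := exp_differentiable0.
have dq : differentiable q (t u).
  by rewrite tu; apply: differentiableD => //; exact: differentiable_cst.
have Dq : 'D_v q 0 = v.
  rewrite /q deriveD; [|by apply: diff_derivable|exact: derivable_cst].
  by rewrite derive_cst addr0; exact: DE.
have q0 : q 0 = z0 by rewrite /q exp0 coord1_1 add0r.
have dqt : differentiable (q \o t) u by exact: differentiable_comp.
have Dqt : 'D_v (q \o t) u = v.
  by rewrite (derive_comp _ dt dq) Dt tu Dq.
have dg : differentiable g ((q \o t) u).
  by rewrite /= tu q0; exact: smooth_near_differentiable (smooth_near_trans sf).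
have nE : \near u, (g \o (q \o t)) u = (f \o E) u.
  have ct : {for u, continuous (E \o t)}.
    by apply: continuous_comp; [exact: smooth_near_continuous|exact: exp_continuous].
  have : \forall w \near u, chart_dom phi (E (t w)).
    apply: ct; rewrite /= tu exp0; exact/chart_dom_nbhs/chart1_dom.
  apply: filterS => w dw.
  by rewrite /= /g /q addrC coord1K// -ED /t addrC subrK.
split.
  by apply: near_eq_differentiable nE _; exact: differentiable_comp.
rewrite -(near_eq_derive _ nE) (derive_comp _ dqt dg) Dqt /= tu q0.
by [].
Qed.

Lemma exp_Ck k (V : normedModType R) (A : set 'rV[R]_n) (f : G -> V) : open A ->
  (forall u, A u -> smooth_at f (E u)) -> Ck_on k A (f \o E).
Proof.
move=> oA; elim: k f => [|k IH] f sf.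
  move=> u Au; apply: differentiable_continuous.
  by have [] := exp_derive 0 (sf _ Au).
split=> [u Au|v]; first by have [] := exp_derive 0 (sf _ Au).
apply: (Ck_on_eq oA (f := left_derive v f \o E)) => [u Au|].
  by have [_ ->] := exp_derive v (sf _ Au).
by apply: IH => u /sf; exact: smooth_at_left_derive.
Qed.

Lemma exp_smooth u : smooth_into_near E u.
Proof.
split=> [|d ad du]; first exact: exp_continuous.
apply: (@smooth_on_near _ _ _ (E @^-1` chart_dom d)) => //.
  by apply: open_comp; [move=> w _; exact: exp_continuous|exact: chart_dom_open].
move=> k; apply: exp_Ck => [|w dw]; last exact: smooth_at_chart_map.
by apply: open_comp; [move=> w _; exact: exp_continuous|exact: chart_dom_open].
Qed.

(** The coordinate of 1 is 0, while that of E u is within |u|/2 of [u]. *)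
Lemma exp_kernel_discrete u : E u = 1%g -> `|u| < e -> u = 0.
Proof.
move=> Eu /ltW ue; have [_] := exp_coord_le ue.
rewrite Eu coord1_1 sub0r normrN => h.
by apply/normr0_eq0; have := normr_ge0 u; lra.
Qed.

Variables r C : R.
Hypothesis er : 2 * e <= r.
Hypothesis C0 : 0 <= C.
Hypothesis KCe : 2 * ((K + 2 * C) * e) <= 1.
Hypothesis Hmul : forall x y, small r x -> small r y -> chart_dom phi (x * y)%g /\
    `|coord1 (x * y)%g - (coord1 x + coord1 y)| <= C * (N x * N y).

Let er1 : e <= r. Proof. by move: e0 er; lra. Qed.

(* Newton's method for E t = x. *)
Lemma newton_step x : small e x -> small (2^-1 * N x) (x * E (- coord1 x))%g.
Proof.
move=> [dx xe]; set s := coord1 x in xe *.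
have n0 := normr_ge0 s.
have se : `|- s| <= e by rewrite normrN.
have [dE hE] := Esmall se; have [sE _] := exp_coord_le se.
rewrite !normrN opprK in hE sE.
have xr : small r x by split=> //; exact: le_trans xe er1.
have Er : small r (E (- s)) by apply: (small_le _ sE); apply: le_trans er; rewrite ler_wpM2l.
have [d h] := Hmul xr Er; split=> //; rewrite -/s in h.
have h1 : C * (`|s| * N (E (- s))) <= C * (`|s| * (2 * `|s|)).
  by rewrite ler_wpM2l// ler_wpM2l//; case: sE.
(* The error of [E] contributes K|s|^2 and that of the product 2C|s|^2, since E(-s) has size at most
   2|s|; [KCe] makes the total at most |s|/2. *)
have h2 : 2 * ((K + 2 * C) * `|s|) * `|s| <= `|s|.
  rewrite ler_piMl//; apply: le_trans KCe.
  by rewrite ler_wpM2l// ler_wpM2l// addr_ge0// mulr_ge0.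
have h3 := ler_normD (coord1 (x * E (- s))%g - (s + coord1 (E (- s)))) (s + coord1 (E (- s))).
rewrite subrK in h3; rewrite addrC in hE.
have E2 : 2 * ((K + 2 * C) * `|s|) * `|s| =
    2 * (K * `|s| ^+ 2) + 2 * (C * (`|s| * (2 * `|s|))) by ring.
lra.
Qed.

(** The successive corrections are bounded by a geometric series, which keeps [t] within twice the
    size of [x]. *)
Lemma newton_iterate x k : small e x ->
  exists2 t, `|t| <= 2 * N x * (1 - 2 ^- k) & small (2 ^- k * N x) (x * E (- t))%g.
Proof.
move=> sx; have [dx xe] := sx; elim: k => [|k [t ts st]].
  exists 0; rewrite ?expr0 ?invr1 ?subrr ?mulr0 ?normr0// oppr0 exp0 mulg1 mul1r.
  by split.
have n0 := normr_ge0 (coord1 x).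
have p0 : 0 < 2 ^- k :> R by rewrite invr_gt0 exprn_gt0.
have p1 : 2 ^- k * N x <= N x.
  by rewrite ler_piMl// invf_le1 ?exprn_gt0// exprn_ege1// ler1n.
have pS : 2 ^- k.+1 = 2^-1 * 2 ^- k :> R by rewrite exprS invfM.
have se := small_le (le_trans p1 xe) st.
have st' := newton_step se.
have [_ bt] := st.
exists (t + coord1 (x * E (- t))%g).
  have := ler_normD t (coord1 (x * E (- t))%g); rewrite pS.
  have : 2 * N x * (1 - 2^-1 * 2 ^- k) = 2 * N x * (1 - 2 ^- k) + 2 ^- k * N x.
    by field; rewrite expf_neq0.
  lra.
rewrite opprD ED mulgA; apply: (small_le _ st').
by rewrite pS -mulrA ler_wpM2l// invr_ge0.
Qed.

(** The iterates put [x] in the closure of the image of a closed ball. That image is compact, hence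
    closed, so the convergence of the iterates themselves is not examined. *)
Lemma exp_onto_near x : small e x -> exists2 t, `|t| <= 2 * e & E t = x.
Proof.
move=> sx; have [dx xe] := sx.
pose B : set 'rV[R]_n := [set t | `|t| <= 2 * e].
have cB : compact B.
  apply: bounded_closed_compact.
    exists (2 * e); split; first exact: num_real.
    by move=> M Mr z Bz; exact: le_trans (ltW Mr).
  apply: (@preimage_closed _ _ (fun z : 'rV[R]_n => `|z|) [set x | x <= 2 * e]);
    last exact: closed_le.
  by move=> z _; exact: norm_continuous.
have clB : closed (E @` B).
  apply: compact_closed; first exact: manifold_hausdorff.
  by apply: continuous_compact cB; exact/continuous_subspaceT/exp_continuous.
suff [t Bt Et] : (E @` B) x by exists t.
apply: clB => P NP.
have cf : {for 1%g, continuous (fun q : G => (q^-1 * x)%g)}.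
  by apply: continuous_mul; [exact: inv_continuous|exact: cst_continuous].
have /nbhs_small[rho rho0 HP] : nbhs (1%g : G) ((fun q : G => (q^-1 * x)%g) @^-1` P).
  by apply: cf; rewrite invg1 mul1g.
have [k0 Hk] := half_pow_le (N x) rho0.
have [t ts st] := newton_iterate k0 sx.
have n0 := normr_ge0 (coord1 x).
have p0 : 0 < 2 ^- k0 :> R by rewrite invr_gt0 exprn_gt0.
exists (E t); split.
  exists t => //; apply: le_trans ts _.
  apply: (@le_trans _ _ (2 * N x)); last by lra.
  by rewrite ler_piMr ?mulr_ge0// lerBlDr lerDl ltW.
have := HP _ (small_le _ st).
rewrite /= expN invgM invgK -mulgA mulVg mulg1; apply.
by rewrite mulrC; exact: Hk.
Qed.

Hypothesis G_connected : connected [set: G].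

Lemma exp_nbhs1 : nbhs (1%g : G) (E @` [set t | `|t| <= 2 * e]).
Proof.
apply: filterS (small_nbhs (G := G) e0) => x /exp_onto_near[t te <-].
by exists t.
Qed.

Lemma exp_onto x : exists u, E u = x.
Proof.
have H : forall x, (E @` setT) x.
  apply: connected_subgroup => //.
  - by apply: filterS exp_nbhs1 => y [t _ <-]; exists t.
  - by move=> _ _ [u _ <-] [v _ <-]; exists (u + v).
  - by move=> _ [u _ <-]; exists (- u) => //; rewrite expN.
by have [u _] := H x; exists u.
Qed.

Hypothesis G_compact : compact [set: G].

(** By compactness every element of [G] has a logarithm of norm at most [M]; subtracting from [v]
    such a logarithm of E v lands in the kernel. *)
Lemma exp_kernel_cocompact : exists M, forall v, exists2 u, E u = 1%g & `|v - u| <= M.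
Proof.
have [M HM] : exists M, forall x : G, setT x -> exists2 u, `|u| <= M & E u = x.
  pose P (A : set G) := exists M, forall x : G, A x -> exists2 u, `|u| <= M & E u = x.
  apply: (@compact_induction G P) => //.
  - by exists 0.
  - move=> A B [M HA] [M' HB]; exists (Num.max M M') => x [/HA|/HB] [u ub Eu];
      by exists u => //; rewrite le_max ub ?orbT.
  - by move=> A B AB [M HB]; exists M => x /AB/HB.
  - move=> x; have [u Eu] := exp_onto x.
    exists ((fun y => x^-1 * y)%g @^-1` (E @` [set t | `|t| <= 2 * e])).
      apply: (@lmul_continuous R n G x^-1%g x); rewrite /lmul mulVg.
      exact: exp_nbhs1.
    exists (`|u| + 2 * e) => y [t te Et]; exists (u + t).
      by apply: le_trans (ler_normD _ _) _; rewrite lerD2l.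
    by rewrite ED Eu Et mulgA mulgV mul1g.
exists M => v; have [w wM Ew] := HM (E v) I.
exists (v - w); first by rewrite ED expN Ew mulgV.
by rewrite opprB addrC subrK.
Qed.

End Exponential.

(** * Compact connected commutative groups are tori *)

Section LeftDeriveChart.
Context {R : realType} {n : nat} {G : lieGroupType R n}.
Local Notation phi := (chart_at (1%g : G)).
Local Notation z0 := (chart_map phi (1%g : G)).
Local Notation inv1 := (chart_inv phi).

(** Left translations by [x] and by its inverse, read in the charts [c] and [phi], are mutually
    inverse near the relevant points, hence so are their differentials. *)
Lemma left_derive_chart_bijective (c : chart R n G) x : @atlas R n G c ->
  chart_dom c x -> bijective (fun v => left_derive v (chart_map c) x).
Proof.
move=> ac cx; have sc := smooth_at_chart_map ac cx.
pose q y := chart_map phi (x^-1 * chart_inv c y)%g.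
pose s z := chart_map c (x * inv1 z)%g.
exists (fun w => 'D_w q (chart_map c x)) => [v|w]; last first.
  have := chart_derive w ac cx sc => <-.
  rewrite (@near_eq_derive _ _ _ _ id) ?derive_id//.
  by apply: filterS (chart_img_nbhs cx) => y iy /=; rewrite chart_invK.
have sz0 : s z0 = chart_map c x by rewrite /s chart1_inv mulg1.
have ds : differentiable s z0.
  exact: smooth_near_differentiable (smooth_near_trans sc).
have dq : differentiable q (s z0).
  rewrite sz0; apply: smooth_near_differentiable.
  have sq : smooth_into_near (fun y => (x^-1 * chart_inv c y)%g) (chart_map c x).
    apply: smooth_into_near_mul; first exact: smooth_into_near_cst.
    by apply: smooth_into_near_chart_inv => //; exact: chart_imgP.
  have [_] := sq; apply; first exact: chart1_atlas.
  by rewrite /= chart_mapK// mulVg; exact: chart1_dom.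
have := derive_comp v ds dq; rewrite sz0 => <-.
rewrite (@near_eq_derive _ _ _ _ id) ?derive_id//.
have N : \forall z \near z0, chart_dom c (x * inv1 z)%g.
  have [cq _] := smooth_into_near_trans x; apply: cq; rewrite chart1_inv mulg1.
  exact: chart_dom_nbhs.
have N1 := chart_img_nbhs (chart1_dom (G := G)).
apply: filterS2 N N1 => z dz iz; rewrite /= /q /s chart_mapK// mulgA mulVg mul1g.
exact: chart_invK.
Qed.

Lemma commutative_torus : compact [set: G] -> connected [set: G] ->
  (forall x y : G, (x * y = y * x)%g) -> is_torus G.
Proof.
move=> G_compact G_connected G_comm.
have [r [C [r0 [C0 Cr] Himg Hmul Hinv]]] := local_estimates (G := G).
have [E [ED Ebound]] := exponential_exists r0 C0 Cr Himg Hmul Hinv G_comm G_compact.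
pose K := 176 * C; pose K' := 2 * (K + 2 * C) + 1.
have K0 : 0 <= K by rewrite mulr_ge0.
have K'0 : 0 < K' by rewrite ltr_wpDl// mulr_ge0// addr_ge0// mulr_ge0.
(* The first bound is the range of the estimate on [E], the second what the Newton step requires;
   the added 1 keeps [K'] positive even when C = 0. *)
pose e := Num.min (r / 88) K'^-1.
have e0 : 0 < e by rewrite lt_min divr_gt0// invr_gt0.
have er : 88 * e <= r by rewrite mulrC -ler_pdivlMr// ge_min lexx.
have K'e : K' * e <= 1 by rewrite -ler_pdivlMl// mulr1 ge_min lexx orbT.
clearbody e.
have er2 : 2 * e <= r by lra.
have KCe : 2 * ((K + 2 * C) * e) <= 1 by move: K'e e0; rewrite /K'; lra.
have Ce : 0 <= C * e by rewrite mulr_ge0// ltW.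
have Ke : 2 * (K * e) <= 1 by move: KCe Ce; lra.
have Esmall (u : 'rV[R]_n) : `|u| <= e ->
    chart_dom phi (E u) /\ `|coord1 (E u) - u| <= K * `|u| ^+ 2.
  move=> ue; have [|[d _] h] := Ebound u; last by [].
  by apply: le_trans er; rewrite ler_wpM2l.
have onto := exp_onto e0 Ke K0 ED Esmall er2 C0 KCe Hmul G_connected.
have cocompact := exp_kernel_cocompact e0 Ke K0 ED Esmall er2 C0 KCe Hmul G_connected G_compact.
have E0 := exp0 ED; have EN := expN ED.
have [|u v|||P Pu HP] := @lattice_basis R n [set u | E u = 1%g].
- exact: E0.
- by move=> /= Eu Ev; rewrite ED EN Eu Ev invg1 mulg1.
- exists e => // u Eu; exact: (exp_kernel_discrete Ke K0 Esmall Eu).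
- exact: cocompact.
(* The change of coordinates that carries the integer vectors onto the kernel of [E]. *)
pose l (a : 'rV[R]_n) := a *m P.
have ll : linear l by move=> a u v; rewrite /l mulmxDl scalemxAl.
have sl u : smooth_near l u.
  have -> : l = fun a => \sum_i a 0 i *: row i P.
    by apply/funext => a; rewrite /l mulmx_sum_row.
  apply: smooth_near_sum => i; apply: smooth_near_scale; last exact: smooth_near_cst.
  exact: (smooth_near_coord i (smooth_near_id u)).
have dl u : differentiable l u := smooth_near_differentiable (sl u).
exists n, (E \o l); split.
- apply: (smooth_into_intoP (E \o l) openT).2 => u _.
  apply: smooth_into_near_comp (sl u) _; first exact: framed_rV.
  exact: exp_smooth e0 Ke K0 ED Esmall _.
- by move=> u v; rewrite /= /l mulmxDl ED.
- move=> x; have [u Eu] := onto x; exists (u *m invmx P).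
  by rewrite /= /l mulmxKV.
- exact: HP.
- move=> u; set c := chart_at _.
  have sc : smooth_at (chart_map c) (E (l u)).
    by apply: smooth_at_chart_map; [exact: chart_at_atlas|exact: chart_at_dom].
  (* By [exp_derive] and the linearity of [l], the differential to be inverted is this composite of
     two bijections. *)
  apply: (@eq_bij _ _ ((fun v => left_derive v (chart_map c) (E (l u))) \o l)).
    apply: bij_comp; last by exists (mulmx^~ (invmx P)) => v; rewrite /l ?mulmxK ?mulmxKV.
    by apply: left_derive_chart_bijective; [exact: chart_at_atlas|exact: chart_at_dom].
  move=> v; have [dE DE] := exp_derive e0 Ke K0 ED Esmall ('D_v l u) sc.
  have lc : continuous l by move=> w; exact: smooth_near_continuous.
  have Dl : 'D_v l u = l v := derive_linear (l := linear_pack ll) u v lc.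
  have := derive_comp v (dl u) dE; rewrite DE Dl => h.
  exact: esym h.
Qed.

End LeftDeriveChart.

Theorem corollary3p2 (R : realType) (n : nat) (G : lieGroupType R n)
    (G_compact : compact [set: G]) (G_connected : connected [set: G])
    (mu : probability (borel G) R) (mu_haar : left_invariant_measure mu)
    (h : riemannian_metric G) (h_inv : bi_invariant_metric h)
    (X : 'I_n -> vector_field G) (X_basis : left_invariant_basis X)
    (X_laplace : forall phi : G -> R, smooth_fun phi -> forall x,
       laplace_beltrami h phi x =
       - \sum_j vf_apply (X j) (vf_apply (X j) phi) x)
    (alpha : 'rV[R]_n) (delta : R) (delta_ge1 : 1 <= delta) :
  (exists c : R, 0 < c /\
     forall (f : G -> R[i]) (Df : 'I_n -> G -> R[i]),
       H1_gradient mu X f Df -> cintegral mu f = 0 ->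
       gradient_norm mu Df `^ (delta - 1) * L2norm mu (directional alpha Df)
         >= c * L2norm mu f `^ delta) ->
  is_torus G.
Proof.
move=> [c [c0 ineq]]; apply: commutative_torus => //.
have [X_left _] := X_basis.
apply: (left_derive_constant_commutes (y := \sum_j alpha 0 j *: X j 1%g)) => // f.
exact: (inequality_left_derive_constant mu_haar G_compact X_left delta_ge1 c0 ineq).
Qed.
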